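(* Let $\gamma:I\to\mathbb{R}^2$ be a $C^\infty$ curve with $0\in I$ and suppose $\gamma'(0)=\gamma''(0)=\gamma'''(0)=\mathbf{0}$ and $A\neq0$ (so $\kappa_q$ is defined). (1) $\gamma$ is $\mathcal{A}$-equivalent at $t=0$ to $(t^4,t^5)$ if and only if $\kappa_q=0$. (2) $\gamma$ is $\mathcal{A}$-equivalent at $t=0$ to $(t^4,t^5+t^7)$ if and only if $\kappa_q>0$. (3) $\gamma$ is $\mathcal{A}$-equivalent at $t=0$ to $(t^4,t^5-t^7)$ if and only if $\kappa_q<0$. (4) The three germs $(t^4,t^5)$, $(t^4,t^5+t^7)$, $(t^4,t^5-t^7)$ at $t=0$ are pairwise not $\mathcal{A}$-equivalent, but they are pairwise $C^1$-equivalent at $t=0$. (Moreover, a $C^\infty$ curve with $\gamma'(0)=\gamma''(0)=\gamma'''(0)=\mathbf 0$ and $A\ne0$ is required in each ''if and only if'': i.e. $\gamma$ is $\mathcal{A}$-equivalent to one of the three germs iff it satisfies these conditions together with the stated condition on $\kappa_q$.)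
   Context: $A=\det(\gamma^{(5)}(0),\gamma^{(4)}(0))$, $B=\det(\gamma^{(6)}(0),\gamma^{(4)}(0))$, $C=\det(\gamma^{(7)}(0),\gamma^{(4)}(0))$, $D=\det(\gamma^{(6)}(0),\gamma^{(5)}(0))$. The $(4,5;\pm7)$-cuspidal curvature is $\kappa_q=\dfrac{-77B^2+105AD+60AC}{\|\gamma^{(4)}(0)\|^5}$. For $r\in\mathbb{N}_{>0}\cup\{\infty,\omega\}$, germs $\gamma_1,\gamma_2$ are $C^r$-equivalent if there exist $C^r$ diffeomorphism germs $\psi$ of $(\mathbb{R},0)$ and $\Psi$ of $\mathbb{R}^2$ with $\Psi\circ\gamma_1\circ\psi^{-1}=\gamma_2$; $\mathcal{A}$-equivalence is $C^\infty$-equivalence. *)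

(* Defs.v *)
From Stdlib Require Import Reals.
From Coquelicot Require Import Coquelicot.
Open Scope R_scope.

Inductive reg := Fin (n : nat) | Inf.

Fixpoint CrR (n : nat) (U : R -> Prop) (f : R -> R) : Prop :=
  match n with
  | O => forall x, U x -> continuous f x
  | S m => (forall x, U x -> continuous f x) /\
           (forall x, U x -> ex_derive f x) /\ CrR m U (Derive f)
  end.

Definition d1 (f : R * R -> R) (p : R * R) : R :=
  Derive (fun s => f (s, snd p)) (fst p).
Definition d2 (f : R * R -> R) (p : R * R) : R :=
  Derive (fun s => f (fst p, s)) (snd p).

Fixpoint CrR2 (n : nat) (U : R * R -> Prop) (f : R * R -> R) : Prop :=
  match n with
  | O => forall p, U p -> continuous f p
  | S m => (forall p, U p -> continuous f p) /\
           (forall p, U p -> ex_derive (fun s => f (s, snd p)) (fst p)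
                             /\ ex_derive (fun s => f (fst p, s)) (snd p)) /\
           CrR2 m U (d1 f) /\ CrR2 m U (d2 f)
  end.

Definition Cr1 (r : reg) (U : R -> Prop) (f : R -> R) : Prop :=
  match r with Fin n => CrR n U f | Inf => forall n, CrR n U f end.

Definition Cr2 (r : reg) (U : R * R -> Prop) (F : R * R -> R * R) : Prop :=
  match r with
  | Fin n => CrR2 n U (fun p => fst (F p)) /\ CrR2 n U (fun p => snd (F p))
  | Inf => forall n, CrR2 n U (fun p => fst (F p)) /\ CrR2 n U (fun p => snd (F p))
  end.

Definition diffeo1_germ (r : reg) (psi phi : R -> R) : Prop :=
  psi 0 = 0 /\
  exists U V : R -> Prop,
    open U /\ open V /\ U 0 /\
    (forall x, U x -> V (psi x)) /\ (forall y, V y -> U (phi y)) /\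
    (forall x, U x -> phi (psi x) = x) /\ (forall y, V y -> psi (phi y) = y) /\
    Cr1 r U psi /\ Cr1 r V phi.

Definition diffeo2_germ (r : reg) (Psi : R * R -> R * R) (p : R * R) : Prop :=
  exists (U V : R * R -> Prop) (Phi : R * R -> R * R),
    open U /\ open V /\ U p /\
    (forall q, U q -> V (Psi q)) /\ (forall q, V q -> U (Phi q)) /\
    (forall q, U q -> Phi (Psi q) = q) /\ (forall q, V q -> Psi (Phi q) = q) /\
    Cr2 r U Psi /\ Cr2 r V Phi.

Definition Cr_equiv (r : reg) (g1 g2 : R -> R * R) : Prop :=
  exists (psi phi : R -> R) (Psi : R * R -> R * R),
    diffeo1_germ r psi phi /\ diffeo2_germ r Psi (g1 0) /\
    exists eps, 0 < eps /\ forall t, Rabs t < eps -> Psi (g1 (phi t)) = g2 t.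

Definition A_equiv (g1 g2 : R -> R * R) : Prop := Cr_equiv Inf g1 g2.

Definition smooth_curve_on (a b : R) (g : R -> R * R) : Prop :=
  forall n, CrR n (fun t => a < t < b) (fun t => fst (g t)) /\
            CrR n (fun t => a < t < b) (fun t => snd (g t)).

Definition dgam (g : R -> R * R) (k : nat) : R * R :=
  (Derive_n (fun t => fst (g t)) k 0, Derive_n (fun t => snd (g t)) k 0).

Definition det2 (u v : R * R) : R := fst u * snd v - snd u * fst v.

Definition cA (g : R -> R * R) := det2 (dgam g 5) (dgam g 4).
Definition cB (g : R -> R * R) := det2 (dgam g 6) (dgam g 4).
Definition cC (g : R -> R * R) := det2 (dgam g 7) (dgam g 4).
Definition cD (g : R -> R * R) := det2 (dgam g 6) (dgam g 5).

Definition norm2 (u : R * R) : R := sqrt (fst u ^ 2 + snd u ^ 2).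

Definition kappa_q (g : R -> R * R) : R :=
  (-77 * cB g ^ 2 + 105 * cA g * cD g + 60 * cA g * cC g) / norm2 (dgam g 4) ^ 5.

Definition cusp45_cond (g : R -> R * R) : Prop :=
  dgam g 1 = (0, 0) /\ dgam g 2 = (0, 0) /\ dgam g 3 = (0, 0) /\ cA g <> 0.

Definition E0 (t : R) : R * R := (t ^ 4, t ^ 5).
Definition Ep (t : R) : R * R := (t ^ 4, t ^ 5 + t ^ 7).
Definition Em (t : R) : R * R := (t ^ 4, t ^ 5 - t ^ 7).

(* Main.v *)
Require Import Defs.
From Stdlib Require Import Reals.
From Coquelicot Require Import Coquelicot.
From Stdlib Require Import Lra Lia List FunctionalExtensionality Classical IndefiniteDescription Ranalysis5 PSeries_reg.
Import Defs.
Open Scope R_scope.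

(** Quadratic and higher terms of a diffeomorphism of the plane act on a curve of order 4 only from
    order 8 on, so the 7-jet of the curve is transformed by a linear map and a reparametrization; under
    both, the numerator of [kappa_q] is multiplied by a square. Conversely, linear changes, the shears
    [x + p y + q y^2] and reparametrizations by a fourth root of the first coordinate bring the curve to
    [(t^4, t^5 + c t^7 + e3 t^8 + e4 t^9 + e5 t^10 + c e4 t^11 + O(t^12))]. The numbers 8, 9, 10 and all
    those from 12 on lie in the semigroup generated by 4 and 5, so the second coordinate is a smooth
    function [F (t^4, t^5 + c t^7)] with [F_y (0,0) = 1]: the remainder [O(t^12)] is handled by writing a
    smooth function as [sum_(i<4) t^i a_i(t^4)], which is Whitney's theorem on even functions applied
    twice (Borel's theorem extends the [a_i] to negative arguments). The sign of [c] is read off from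
    [kappa_q], and the absolute value of [c] is removed by scaling. In class [C^1] the term
    [t^7 = y |y|^(2/5)] is removed by a change of the second coordinate alone. *)

(** * Calculus of [C^r] functions of one and two variables *)

(** A perturbation of order 4 + m in the first coordinate is undone by a reparametrization and then
    reappears at order 5 + m in the second. The orders above 5 outside the semigroup are 6, 7 and
    11. Order 6 is reached through [y] (m = 1) and order 11 through [y^2] (m = 6), but order 7 would
    require a monomial of order 6 in the first coordinate, and 6 is itself a gap. This is why one
    coefficient [c] survives and why two shears suffice.

    The plane diffeomorphisms that have to be constructed are affine maps and polynomial shears,
    whose inverses are explicit, and maps of the form (x, F (x, y)). The inverse function theorem is
    therefore needed only fiber by fiber, where [F] is strictly increasing in y and the intermediate
    value theorem produces the inverse; its regularity is then bootstrapped from the formulas for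
    its partial derivatives. The same theorem gives the reparametrizations of the line. *)

Lemma open_slice1 (U : R * R -> Prop) (p : R * R) :
  open U -> U p -> locally (fst p) (fun s => U (s, snd p)).
Proof.
  intros HU Hp. destruct (HU p Hp) as [e He].
  exists e. intros s Hs. apply He. split; [exact Hs | apply ball_center].
Qed.

Lemma open_slice2 (U : R * R -> Prop) (p : R * R) :
  open U -> U p -> locally (snd p) (fun s => U (fst p, s)).
Proof.
  intros HU Hp. destruct (HU p Hp) as [e He].
  exists e. intros s Hs. apply He. split; [apply ball_center | exact Hs].
Qed.

Lemma CrR2_continuous n U f : CrR2 n U f -> forall p, U p -> continuous f p.
Proof. destruct n; [ | intros [H _]]; auto. Qed.

Lemma CrR_continuous n U f : CrR n U f -> forall p, U p -> continuous f p.
Proof. destruct n; [ | intros [H _]]; auto. Qed.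

Lemma CrR2_le n : forall U f, CrR2 (S n) U f -> CrR2 n U f.
Proof.
  induction n; intros U f (H1 & H2 & H3 & H4); [exact H1 | ].
  repeat split; auto; apply H2; auto.
Qed.

Lemma CrR2_sub n : forall (U V : R * R -> Prop) f,
  (forall p, V p -> U p) -> CrR2 n U f -> CrR2 n V f.
Proof.
  induction n; intros U V f H; [intros H1 p Hp; apply H1; auto | ].
  intros (H1 & H2 & H3 & H4).
  refine (conj _ (conj _ (conj (IHn U V _ H H3) (IHn U V _ H H4)))); auto.
Qed.

Lemma CrR_sub n : forall (U V : R -> Prop) f,
  (forall p, V p -> U p) -> CrR n U f -> CrR n V f.
Proof.
  induction n; intros U V f H; [intros H1 p Hp; apply H1; auto | ].
  intros (H1 & H2 & H3).
  refine (conj _ (conj _ (IHn U V _ H H3))); auto.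
Qed.

(** Openness of [U] makes [f] and [g] agree near each point along both axes, so that their partial
    derivatives can be compared. *)
Lemma CrR2_ext n : forall U f g, open U -> (forall p, U p -> f p = g p) ->
  CrR2 n U f -> CrR2 n U g.
Proof.
  assert (C : forall U (f g : R * R -> R), open U -> (forall p, U p -> f p = g p) ->
    (forall p, U p -> continuous f p) -> forall p, U p -> continuous g p).
  { intros U f g HU He H p Hp. apply (continuous_ext_loc g f p); auto.
    generalize (HU _ Hp); apply filter_imp; auto. }
  induction n; intros U f g HU He; [exact (C U f g HU He) | ].
  intros (H1 & H2 & H3 & H4). split; [ | split; [ | split]].
  - exact (C U f g HU He H1).
  - intros p Hp. destruct (H2 p Hp) as [Ha Hb]. split.
    + apply (ex_derive_ext_loc (fun s => f (s, snd p))); auto.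
      generalize (open_slice1 U p HU Hp); apply filter_imp. intros; now apply He.
    + apply (ex_derive_ext_loc (fun s => f (fst p, s))); auto.
      generalize (open_slice2 U p HU Hp); apply filter_imp. intros; now apply He.
  - apply (IHn U (d1 f)); auto. intros p Hp. apply Derive_ext_loc.
    generalize (open_slice1 U p HU Hp); apply filter_imp. intros; now apply He.
  - apply (IHn U (d2 f)); auto. intros p Hp. apply Derive_ext_loc.
    generalize (open_slice2 U p HU Hp); apply filter_imp. intros; now apply He.
Qed.

Lemma CrR_ext n : forall U f g, open U -> (forall p, U p -> f p = g p) ->
  CrR n U f -> CrR n U g.
Proof.
  assert (C : forall U (f g : R -> R), open U -> (forall p, U p -> f p = g p) ->
    (forall p, U p -> continuous f p) -> forall p, U p -> continuous g p).
  { intros U f g HU He H p Hp. apply (continuous_ext_loc g f p); auto.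
    generalize (HU _ Hp); apply filter_imp; auto. }
  induction n; intros U f g HU He; [exact (C U f g HU He) | ].
  intros (H1 & H2 & H3). split; [ | split].
  - exact (C U f g HU He H1).
  - intros p Hp. apply (ex_derive_ext_loc f); auto.
    generalize (HU p Hp); apply filter_imp. intros; now apply He.
  - apply (IHn U (Derive f)); auto. intros p Hp. apply Derive_ext_loc.
    generalize (HU p Hp); apply filter_imp. intros; now apply He.
Qed.

Lemma CrR2_const n U (c : R) : open U -> CrR2 n U (fun _ => c).
Proof.
  intros HU. revert c. induction n; intros c.
  - intros p _. apply continuous_const.
  - split; [ | split; [ | split]].
    + intros p _. apply continuous_const.
    + intros p _. split; apply ex_derive_const.
    + apply (CrR2_ext n U (fun _ => 0)); auto.
      intros p _. unfold d1. now rewrite Derive_const.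
    + apply (CrR2_ext n U (fun _ => 0)); auto.
      intros p _. unfold d2. now rewrite Derive_const.
Qed.

Lemma CrR2_plus n : forall U f g, open U -> CrR2 n U f -> CrR2 n U g ->
  CrR2 n U (fun p => f p + g p).
Proof.
  induction n; intros U f g HU.
  - intros Hf Hg p Hp. apply (continuous_plus f g); auto.
  - intros (F1 & F2 & F3 & F4) (G1 & G2 & G3 & G4). split; [ | split; [ | split]].
    + intros p Hp. apply (continuous_plus f g); auto.
    + intros p Hp. destruct (F2 p Hp), (G2 p Hp). split; apply @ex_derive_plus; auto.
    + apply (CrR2_ext n U (fun p => d1 f p + d1 g p)); auto.
      intros p Hp. destruct (F2 p Hp), (G2 p Hp). symmetry; apply Derive_plus; auto.
    + apply (CrR2_ext n U (fun p => d2 f p + d2 g p)); auto.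
      intros p Hp. destruct (F2 p Hp), (G2 p Hp). symmetry; apply Derive_plus; auto.
Qed.

Lemma CrR2_mult n : forall U f g, open U -> CrR2 n U f -> CrR2 n U g ->
  CrR2 n U (fun p => f p * g p).
Proof.
  induction n; intros U f g HU.
  - intros Hf Hg p Hp. apply (continuous_mult f g); auto.
  - intros F G. generalize (CrR2_le _ _ _ F) (CrR2_le _ _ _ G). intros F0 G0.
    destruct F as (F1 & F2 & F3 & F4), G as (G1 & G2 & G3 & G4).
    split; [ | split; [ | split]].
    + intros p Hp. apply (continuous_mult f g); auto.
    + intros p Hp. destruct (F2 p Hp), (G2 p Hp). split; apply ex_derive_mult; auto.
    + apply (CrR2_ext n U (fun p => d1 f p * g p + f p * d1 g p)); auto.
      * intros p Hp. destruct (F2 p Hp), (G2 p Hp).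
        unfold d1. rewrite Derive_mult; auto; now destruct p.
      * apply CrR2_plus; auto.
    + apply (CrR2_ext n U (fun p => d2 f p * g p + f p * d2 g p)); auto.
      * intros p Hp. destruct (F2 p Hp), (G2 p Hp).
        unfold d2. rewrite Derive_mult; auto; now destruct p.
      * apply CrR2_plus; auto.
Qed.

Lemma CrR2_lift_fst n : forall U f, open U -> CrR n U f ->
  CrR2 n (fun p => U (fst p)) (fun p => f (fst p)).
Proof.
  intros U f HU.
  assert (HO : open (fun p : R * R => U (fst p))).
  { apply (open_comp fst U); [intros p _; apply continuous_fst | exact HU]. }
  revert f. induction n; intros f.
  - intros H p Hp. apply continuous_comp; [apply continuous_fst | auto].
  - intros (H1 & H2 & H3). split; [ | split; [ | split]].
    + intros p Hp. apply continuous_comp; [apply continuous_fst | auto].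
    + intros p Hp. split; [exact (H2 _ Hp) | simpl; apply ex_derive_const].
    + apply (IHn (Derive f)); auto.
    + apply (CrR2_ext n _ (fun _ => 0)); auto; [ | now apply CrR2_const].
      intros p _. unfold d2; simpl. now rewrite Derive_const.
Qed.

Lemma CrR2_lift_snd n : forall U f, open U -> CrR n U f ->
  CrR2 n (fun p => U (snd p)) (fun p => f (snd p)).
Proof.
  intros U f HU.
  assert (HO : open (fun p : R * R => U (snd p))).
  { apply (open_comp snd U); [intros p _; apply continuous_snd | exact HU]. }
  revert f. induction n; intros f.
  - intros H p Hp. apply continuous_comp; [apply continuous_snd | auto].
  - intros (H1 & H2 & H3). split; [ | split; [ | split]].
    + intros p Hp. apply continuous_comp; [apply continuous_snd | auto].
    + intros p Hp. split; [simpl; apply ex_derive_const | exact (H2 _ Hp)].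
    + apply (CrR2_ext n _ (fun _ => 0)); auto; [ | now apply CrR2_const].
      intros p _. unfold d1; simpl. now rewrite Derive_const.
    + apply (IHn (Derive f)); auto.
Qed.

Lemma continuous_section (x0 y : R) : continuous (fun s : R => (x0, s)) y.
Proof.
  intros P [e He]. exists e. intros s Hs. apply He.
  split; [apply ball_center | exact Hs].
Qed.

(** Together with [CrR2_lift_snd], this yields one-variable closure properties from the two-variable
    ones: lift to functions of the second coordinate, apply the plane lemma, restrict to a line. *)
Lemma CrR2_slice n x0 : forall U f, CrR2 n U f ->
  CrR n (fun y => U (x0, y)) (fun y => f (x0, y)).
Proof.
  assert (C : forall (f : R * R -> R) y, continuous f (x0, y) ->
    continuous (fun y => f (x0, y)) y).
  { intros f y H. apply (continuous_comp (fun s : R => (x0, s)) f); auto.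
    apply continuous_section. }
  induction n; intros U f; [intros H y Hy; apply C; auto | ].
  intros (H1 & H2 & H3 & H4). split; [ | split].
  - intros y Hy; apply C; auto.
  - intros y Hy. apply (H2 (x0, y) Hy).
  - apply (IHn U (d2 f) H4).
Qed.

(** Partial derivatives alone would not give a chain rule; continuity of [d1 f] upgrades them to
    total differentiability. *)
Lemma CrR2_differentiable U f : open U -> CrR2 1 U f -> forall p, U p ->
  differentiable_pt_lim (fun x y => f (x, y)) (fst p) (snd p) (d1 f p) (d2 f p).
Proof.
  intros HU (H1 & H2 & H3 & H4) [x y] Hp.
  assert (L : locally (x, y) (fun p => continuous f p /\ ex_derive (fun s => f (s, snd p)) (fst p)
     /\ ex_derive (fun s => f (fst p, s)) (snd p))).
  { generalize (HU _ Hp); apply filter_imp; auto. }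
  apply filterdiff_differentiable_pt_lim.
  apply (is_derive_filterdiff (fun x y => f (x,y)) x y (fun x y => d1 f (x,y)) (d2 f (x,y))).
  - destruct L as [e He]. exists e. intros [u v] Huv.
    destruct (He _ Huv) as (_ & Ha & _). apply Derive_correct. exact Ha.
  - apply Derive_correct. apply (H2 _ Hp).
  - apply (continuous_ext (d1 f)); [now intros [] | now apply H3].
Qed.

(** The chain rule writes both partial derivatives as sums of products of composites of [d1 f],
    [d2 f] with partial derivatives of [u], [v]. All of these have class one lower, so induction on
    [n] applies when [f], [u], [v] are generalized. *)
Lemma CrR2_comp n : forall U W f u v, open U -> open W ->
  (forall p, U p -> W (u p, v p)) ->
  CrR2 n W f -> CrR2 n U u -> CrR2 n U v -> CrR2 n U (fun p => f (u p, v p)).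
Proof.
  assert (C : forall (f : R * R -> R) u v p, continuous f (u p, v p) -> continuous u p ->
     continuous v p -> continuous (fun p : R * R => f (u p, v p)) p).
  { intros f u v p Hf Hu Hv. apply (continuous_comp_2 u v (fun x y => f (x, y))); auto.
    apply (continuous_ext f); [now intros [] | auto]. }
  induction n; intros U W f u v HU HW HUW.
  - intros Hf Hu Hv p Hp. apply C; auto.
  - intros F Hu Hv.
    generalize (CrR2_le _ _ _ F) (CrR2_le _ _ _ Hu) (CrR2_le _ _ _ Hv). intros F0 u0 v0.
    assert (F1 : CrR2 1 W f).
    { clear - F. induction n; auto. apply IHn. now apply CrR2_le. }
    generalize (CrR2_differentiable _ _ HW F1). intros D. clear F1.
    destruct F as (F1 & F2 & F3 & F4), Hu as (U1 & U2 & U3 & U4), Hv as (V1 & V2 & V3 & V4).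
    assert (D1 : forall p, U p -> is_derive (fun s => f (u (s, snd p), v (s, snd p))) (fst p)
       (d1 f (u p, v p) * d1 u p + d2 f (u p, v p) * d1 v p)).
    { intros p Hp. apply is_derive_Reals.
      apply (derivable_pt_lim_comp_2d (fun x y => f (x, y)) (fun s => u (s, snd p)) (fun s => v (s, snd p))).
      - specialize (D _ (HUW p Hp)). now destruct p.
      - apply is_derive_Reals. apply Derive_correct. apply (U2 p Hp).
      - apply is_derive_Reals. apply Derive_correct. apply (V2 p Hp). }
    assert (D2 : forall p, U p -> is_derive (fun s => f (u (fst p, s), v (fst p, s))) (snd p)
       (d1 f (u p, v p) * d2 u p + d2 f (u p, v p) * d2 v p)).
    { intros p Hp. apply is_derive_Reals.
      apply (derivable_pt_lim_comp_2d (fun x y => f (x, y)) (fun s => u (fst p, s)) (fun s => v (fst p, s))).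
      - specialize (D _ (HUW p Hp)). now destruct p.
      - apply is_derive_Reals. apply Derive_correct. apply (U2 p Hp).
      - apply is_derive_Reals. apply Derive_correct. apply (V2 p Hp). }
    split; [ | split; [ | split]].
    + intros p Hp. apply C; auto.
    + intros p Hp. split; eexists; [apply D1 | apply D2]; auto.
    + apply (CrR2_ext n U (fun p => d1 f (u p, v p) * d1 u p + d2 f (u p, v p) * d1 v p)); auto.
      * intros p Hp. symmetry. apply is_derive_unique. now apply D1.
      * apply CrR2_plus; auto; apply CrR2_mult; auto; apply (IHn U W); auto.
    + apply (CrR2_ext n U (fun p => d1 f (u p, v p) * d2 u p + d2 f (u p, v p) * d2 v p)); auto.
      * intros p Hp. symmetry. apply is_derive_unique. now apply D2.
      * apply CrR2_plus; auto; apply CrR2_mult; auto; apply (IHn U W); auto.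
Qed.

Lemma open_all {T : UniformSpace} : open (fun _ : T => True).
Proof. apply open_true. Qed.

Lemma CrR_const n U c : CrR n U (fun _ => c).
Proof.
  apply (CrR_sub n (fun _ => True)); auto.
  apply (CrR2_slice n 0 (fun _ => True) (fun _ => c)).
  apply CrR2_const, open_all.
Qed.

Lemma CrR_id n U : CrR n U (fun x => x).
Proof.
  apply (CrR_sub n (fun _ => True)); auto.
  destruct n; [intros x _; apply continuous_id | ].
  split; [intros x _; apply continuous_id | split; [intros x _; apply ex_derive_id | ]].
  apply (CrR_ext n _ (fun _ => 1)); [apply open_all | | apply CrR_const].
  intros x _. now rewrite Derive_id.
Qed.

Lemma CrR2_fst n U : open U -> CrR2 n U fst.
Proof.
  intros HU. apply (CrR2_sub n (fun _ => True)); auto.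
  apply (CrR2_lift_fst n (fun _ => True) (fun x => x)); [apply open_all | apply CrR_id].
Qed.

Lemma CrR2_snd n U : open U -> CrR2 n U snd.
Proof.
  intros HU. apply (CrR2_sub n (fun _ => True)); auto.
  apply (CrR2_lift_snd n (fun _ => True) (fun x => x)); [apply open_all | apply CrR_id].
Qed.

Lemma open_snd (U : R -> Prop) : open U -> open (fun p : R * R => U (snd p)).
Proof. intros HU. apply (open_comp snd U); [intros p _; apply continuous_snd | exact HU]. Qed.

Lemma open_fst (U : R -> Prop) : open U -> open (fun p : R * R => U (fst p)).
Proof. intros HU. apply (open_comp fst U); [intros p _; apply continuous_fst | exact HU]. Qed.

Lemma CrR_plus n U f g : open U -> CrR n U f -> CrR n U g -> CrR n U (fun x => f x + g x).
Proof.
  intros HU Hf Hg.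
  apply (CrR2_slice n 0 (fun p => U (snd p)) (fun p => f (snd p) + g (snd p))).
  apply CrR2_plus; [now apply open_snd | | ]; now apply CrR2_lift_snd.
Qed.

Lemma CrR_mult n U f g : open U -> CrR n U f -> CrR n U g -> CrR n U (fun x => f x * g x).
Proof.
  intros HU Hf Hg.
  apply (CrR2_slice n 0 (fun p => U (snd p)) (fun p => f (snd p) * g (snd p))).
  apply CrR2_mult; [now apply open_snd | | ]; now apply CrR2_lift_snd.
Qed.

Lemma CrR2_comp1 n U W f u : open U -> open W -> (forall p, U p -> W (u p)) ->
  CrR n W f -> CrR2 n U u -> CrR2 n U (fun p => f (u p)).
Proof.
  intros HU HW H Hf Hu.
  apply (CrR2_comp n U (fun p => W (snd p)) (fun p => f (snd p)) u u); auto.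
  - now apply open_snd.
  - now apply CrR2_lift_snd.
Qed.

Lemma CrR_comp n U W f u : open U -> open W -> (forall p, U p -> W (u p)) ->
  CrR n W f -> CrR n U u -> CrR n U (fun x => f (u x)).
Proof.
  intros HU HW H Hf Hu.
  apply (CrR2_slice n 0 (fun p => U (snd p)) (fun p => f (u (snd p)))).
  apply (CrR2_comp1 n _ W f (fun p => u (snd p))); auto.
  - now apply open_snd.
  - now apply CrR2_lift_snd.
Qed.

Lemma open_neq0 : open (fun x : R => x <> 0).
Proof.
  apply (open_ext (fun x => x < 0 \/ 0 < x)); [intros x; lra | ].
  apply open_or; [apply open_lt | apply open_gt].
Qed.

Lemma CrR_inv n : CrR n (fun x => x <> 0) Rinv.
Proof.
  assert (C : forall x, x <> 0 -> continuous Rinv x).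
  { intros x Hx. apply continuity_pt_filterlim, continuity_pt_inv; auto.
    apply derivable_continuous_pt, derivable_pt_id. }
  induction n; [exact C | split; [exact C | split]].
  - intros x Hx. auto_derive; auto.
  - apply (CrR_ext n _ (fun x => (-1) * (/ x * / x))); [apply open_neq0 | | ].
    + intros x Hx. symmetry. apply is_derive_unique. auto_derive; auto. field; auto.
    + apply CrR_mult; [apply open_neq0 | apply CrR_const | ].
      apply CrR_mult; auto. apply open_neq0.
Qed.

Lemma CrR_sqrt n : CrR n (fun x => 0 < x) sqrt.
Proof.
  assert (C : forall x, 0 < x -> continuous sqrt x).
  { intros x Hx. apply continuity_pt_filterlim, continuity_pt_sqrt; lra. }
  induction n; [exact C | split; [exact C | split]].
  - intros x Hx. auto_derive; auto.
  - apply (CrR_ext n _ (fun x => / 2 * / sqrt x)); [apply open_gt | | ].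
    + intros x Hx. symmetry. apply is_derive_unique. auto_derive; auto. field.
      apply Rgt_not_eq, sqrt_lt_R0; auto.
    + apply CrR_mult; [apply open_gt | apply CrR_const | ].
      apply (CrR_comp n _ (fun x => x <> 0) Rinv sqrt); auto;
        [apply open_gt | apply open_neq0 | | apply CrR_inv].
      intros x Hx. apply Rgt_not_eq, sqrt_lt_R0; auto.
Qed.

(** * Inverses of maps preserving the first coordinate *)

Lemma open_Rabs_lt (d : R) : open (fun x : R => Rabs x < d).
Proof.
  apply (open_ext (fun x => - d < x /\ x < d)).
  - intros x. split; [intros [H1 H2]; now apply Rabs_def1 | intros H; now apply Rabs_def2 in H].
  - apply open_and; [apply open_gt | apply open_lt].
Qed.

Lemma continuous_eps (f : R -> R) x : continuous f x <->
  forall eps, 0 < eps -> exists del, 0 < del /\ forall y, Rabs (y - x) < del -> Rabs (f y - f x) < eps.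
Proof.
  split.
  - intros H eps He. destruct (proj1 (filterlim_locally f (f x)) H (mkposreal eps He)) as [d Hd].
    exists d; split; [apply cond_pos | intros y Hy; now apply Hd].
  - intros H. apply (proj2 (filterlim_locally f (f x))). intros eps. destruct (H eps (cond_pos eps)) as (d & Hd & H1).
    exists (mkposreal d Hd). intros y Hy. now apply H1.
Qed.

(** Caratheodory's form of differentiability. For an implicit function it reduces the derivative to
    the continuity of a quotient of slopes. *)
Lemma is_derive_slope (f phi : R -> R) x : continuous phi x ->
  locally x (fun s => f s - f x = phi s * (s - x)) -> is_derive f x (phi x).
Proof.
  intros Hc [e He]. apply is_derive_Reals. intros eps Heps.
  destruct (proj1 (continuous_eps _ _) Hc eps Heps) as (d & Hd & H1).
  assert (Hm : 0 < Rmin e d) by (apply Rmin_pos; [apply cond_pos | auto]).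
  exists (mkposreal _ Hm). simpl. intros h Hh Hlt.
  assert (Rabs h < e /\ Rabs h < d) as [L1 L2].
  { split; eapply Rlt_le_trans; eauto; [apply Rmin_l | apply Rmin_r]. }
  rewrite (He (x + h)).
  - replace (phi (x + h) * (x + h - x) / h - phi x) with (phi (x + h) - phi x) by (field; auto).
    apply H1. now replace (x + h - x) with h by ring.
  - unfold ball; simpl. unfold AbsRing_ball, abs, minus, plus, opp; simpl.
    now replace (x + h + - x) with h by ring.
Qed.

Lemma slope_is_derive (f : R -> R) x l : is_derive f x l ->
  exists phi, continuous phi x /\ phi x = l /\ forall s, f s - f x = phi s * (s - x).
Proof.
  intros H. exists (fun s => if Req_EM_T s x then l else (f s - f x) / (s - x)).
  split; [ | split].
  - apply continuous_eps. intros eps Heps. apply is_derive_Reals in H.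
    destruct (H eps Heps) as [d Hd]. exists d. split; [apply cond_pos | ].
    intros y Hy. destruct (Req_EM_T x x) as [_ | N]; [ | now destruct N].
    destruct (Req_EM_T y x) as [_ | N]; [rewrite Rminus_diag, Rabs_R0; auto | ].
    specialize (Hd (y - x)). replace (x + (y - x)) with y in Hd by ring.
    apply Hd; auto. lra.
  - destruct (Req_EM_T x x) as [_ | N]; [reflexivity | now destruct N].
  - intros s. destruct (Req_EM_T s x) as [-> | N]; [ring | field; lra].
Qed.

Section FiberedInverse.

Variables (W : R * R -> Prop) (F : R * R -> R).
Hypotheses (HW : open W) (HF : CrR2 1 W F).
Variable e : R.
Hypothesis Hbox : forall x y, Rabs x < e -> Rabs y < e -> W (x, y) /\ 0 < d2 F (x, y).

Let U (p : R * R) := Rabs (fst p) < e /\ Rabs (snd p) < e.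
(** The image of [U] under (x, y) |-> (x, F (x, y)), where the inverse is defined. *)
Let V (q : R * R) := Rabs (fst q) < e /\ exists y, Rabs y < e /\ F (fst q, y) = snd q.

Lemma fiber_box_open : open U.
Proof.
  apply open_and; [apply (open_fst (fun x => Rabs x < e)) | apply (open_snd (fun x => Rabs x < e))];
    apply open_Rabs_lt.
Qed.

Lemma fiber_between y1 y2 c : Rabs y1 < e -> Rabs y2 < e -> Rmin y1 y2 <= c <= Rmax y1 y2 -> Rabs c < e.
Proof.
  intros H1 H2 H3. apply Rabs_def2 in H1. apply Rabs_def2 in H2.
  unfold Rmin, Rmax in H3. destruct (Rle_dec y1 y2); apply Rabs_def1; lra.
Qed.

Lemma fiber_mvt x y1 y2 : Rabs x < e -> Rabs y1 < e -> Rabs y2 < e ->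
  exists c, Rmin y1 y2 <= c <= Rmax y1 y2 /\ F (x, y2) - F (x, y1) = d2 F (x, c) * (y2 - y1).
Proof.
  intros Hx H1 H2.
  assert (D : forall c, Rmin y1 y2 <= c <= Rmax y1 y2 -> is_derive (fun s => F (x, s)) c (d2 F (x, c))).
  { intros c Hc. apply (Derive_correct (fun s => F (x, s))).
    destruct HF as (_ & H & _). apply (H (x, c)). apply Hbox; auto.
    eapply fiber_between; [exact H1 | exact H2 | exact Hc]. }
  destruct (MVT_gen (fun s => F (x, s)) y1 y2 (fun c => d2 F (x, c))) as (c & Hc & E); simpl in *.
  - intros c Hc. apply D. lra.
  - intros c Hc. apply derivable_continuous_pt. exists (d2 F (x, c)). apply is_derive_Reals; auto.
  - exists c. auto.
Qed.

Lemma fiber_lt x y1 y2 : Rabs x < e -> Rabs y1 < e -> Rabs y2 < e -> y1 < y2 -> F (x, y1) < F (x, y2).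
Proof.
  intros Hx H1 H2 H. destruct (fiber_mvt x y1 y2) as (c & Hc & E); auto.
  destruct (Hbox x c) as [_ P]; auto.
  { eapply fiber_between; [exact H1 | exact H2 | exact Hc]. }
  assert (0 < d2 F (x, c) * (y2 - y1)) by (apply Rmult_lt_0_compat; lra). lra.
Qed.

Lemma fiber_inj x y1 y2 : Rabs x < e -> Rabs y1 < e -> Rabs y2 < e -> F (x, y1) = F (x, y2) -> y1 = y2.
Proof.
  intros Hx H1 H2 H. destruct (Rtotal_order y1 y2) as [L | [L | L]]; auto.
  - generalize (fiber_lt x y1 y2 Hx H1 H2 L). lra.
  - generalize (fiber_lt x y2 y1 Hx H2 H1 L). lra.
Qed.

(** By monotonicity [F (x0, y0)] lies strictly between the values at [y0 - h] and [y0 + h]. The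
    inequalities persist for nearby (x, z), and the intermediate value theorem gives a preimage.
    This serves both the openness of the image and, through [eps], the continuity of the inverse. *)
Lemma fiber_open_map x0 y0 eps : Rabs x0 < e -> Rabs y0 < e -> 0 < eps ->
  locally (x0, F (x0, y0)) (fun q => Rabs (fst q) < e /\
    exists y, Rabs (y - y0) < eps /\ Rabs y < e /\ F (fst q, y) = snd q).
Proof.
  intros Hx Hy Heps.
  assert (exists h, 0 < h /\ h < eps /\ Rabs (y0 - h) < e /\ Rabs (y0 + h) < e) as (h & h0 & h1 & h2 & h3).
  { apply Rabs_def2 in Hy. exists (Rmin eps (Rmin (e - y0) (e + y0)) / 2).
    assert (0 < Rmin eps (Rmin (e - y0) (e + y0))) by (repeat apply Rmin_pos; lra).
    generalize (Rmin_l eps (Rmin (e - y0) (e + y0))) (Rmin_r eps (Rmin (e - y0) (e + y0)))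
      (Rmin_l (e - y0) (e + y0)) (Rmin_r (e - y0) (e + y0)). intros.
    repeat split; try apply Rabs_def1; lra. }
  assert (L1 : F (x0, y0 - h) < F (x0, y0)) by (apply fiber_lt; auto; lra).
  assert (L2 : F (x0, y0) < F (x0, y0 + h)) by (apply fiber_lt; auto; lra).
  assert (C : forall y, Rabs y < e -> continuous (fun q : R * R => F (fst q, y)) (x0, F (x0, y0))).
  { intros y Hy'. apply (continuous_comp_2 fst (fun _ => y) (fun a b => F (a, b))).
    - apply continuous_fst.
    - apply continuous_const.
    - apply (continuous_ext F); [now intros [] | ]. apply HF. now apply Hbox. }
  assert (O : open (fun q : R * R => Rabs (fst q) < e)) by
    apply (open_fst (fun x => Rabs x < e)), open_Rabs_lt.
  assert (P1 : locally (x0, F (x0, y0)) (fun q : R * R => F (fst q, y0 - h) - snd q < 0)).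
  { assert (K : continuous (fun q : R * R => F (fst q, y0 - h) - snd q) (x0, F (x0, y0))).
    { apply (continuous_minus (fun q : R * R => F (fst q, y0 - h)) snd); [auto | apply continuous_snd]. }
    apply (K (fun z => z < 0)). apply open_lt. simpl; lra. }
  assert (P2 : locally (x0, F (x0, y0)) (fun q : R * R => 0 < F (fst q, y0 + h) - snd q)).
  { assert (K : continuous (fun q : R * R => F (fst q, y0 + h) - snd q) (x0, F (x0, y0))).
    { apply (continuous_minus (fun q : R * R => F (fst q, y0 + h)) snd); [auto | apply continuous_snd]. }
    apply (K (fun z => 0 < z)). apply open_gt. simpl; lra. }
  generalize (filter_and _ _ (O (x0, F (x0, y0)) Hx) (filter_and _ _ P1 P2)).
  apply filter_imp. intros [x z] (Q0 & Q1 & Q2). simpl in *. split; auto.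
  assert (B : forall y, y0 - h <= y <= y0 + h -> Rabs y < e).
  { intros y By. apply Rabs_def2 in h2. apply Rabs_def2 in h3. apply Rabs_def1; lra. }

  destruct (IVT_interv (fun y => F (x, y) - z) (y0 - h) (y0 + h)) as (y & Hy1 & Hy2); try lra.
  { intros y Hy'. apply continuity_pt_filterlim.
    apply (continuous_minus (fun y => F (x, y)) (fun _ => z)); [ | apply continuous_const].
    apply (continuous_comp (fun s : R => (x, s)) F); [apply continuous_section | ].
    apply HF. now apply Hbox; auto. }
  exists y. split; [apply Rabs_def1; lra | split; [auto | lra]].
Qed.

Lemma fiber_image_open : open V.
Proof.
  intros [x z] (Hx & y & Hy & E). simpl in *. subst z.
  generalize (fiber_open_map x y 1 Hx Hy Rlt_0_1). apply filter_imp.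
  intros q (Q1 & y' & _ & Q2 & Q3). split; auto. now exists y'.
Qed.

Variable G : R * R -> R.
Hypothesis HG : forall q, V q -> Rabs (G q) < e /\ F (fst q, G q) = snd q.

Lemma fiber_inverse_continuous q : V q -> continuous G q.
Proof.
  intros Hq. destruct (HG q Hq) as [G1 G2]. destruct Hq as [Hx Hy].
  apply (proj2 (filterlim_locally G (G q))). intros eps.
  generalize (fiber_open_map (fst q) (G q) eps Hx G1 (cond_pos eps)).
  rewrite G2. replace (fst q, snd q) with q by now destruct q. apply filter_imp.
  intros q' (Q1 & y & Q2 & Q3 & Q4).
  assert (Vq : V q') by (split; auto; now exists y).
  destruct (HG q' Vq) as [G3 G4].
  replace (G q') with y; [exact Q2 | ].
  apply (fiber_inj (fst q')); auto. exact (eq_trans Q4 (eq_sym G4)).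
Qed.

(* Differentiates [G] along a curve [(X s, Z s)]: the mean value theorem in the fiber turns
   [F (X s, G (X s, Z s)) = Z s] into [b s = F_y * (G s - G s0)] with [b s = Z s - F (X s, G s0)]. *)
Lemma fiber_inverse_derive (X Z : R -> R) s0 l : continuous X s0 -> continuous Z s0 ->
  V (X s0, Z s0) ->
  is_derive (fun s => Z s - F (X s, G (X s0, Z s0))) s0 l ->
  is_derive (fun s => G (X s, Z s)) s0 (l / d2 F (X s0, G (X s0, Z s0))).
Proof.
  intros CX CZ Hq Hb. set (y0 := G (X s0, Z s0)) in *.
  destruct (slope_is_derive _ _ _ Hb) as (beta & B1 & B2 & B3).
  destruct (HG _ Hq) as [G1 G2]. fold y0 in G1, G2. simpl in G2.
  assert (CG : continuous (fun s => G (X s, Z s)) s0).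
  { apply (continuous_comp_2 X Z (fun a b => G (a, b))); auto.
    apply (continuous_ext G); [now intros [] | ]. now apply fiber_inverse_continuous. }
  assert (LV : locally s0 (fun s => V (X s, Z s))).
  { assert (CXZ : continuous (fun s => (X s, Z s)) s0).
    { apply (continuous_comp_2 X Z (fun a b => (a, b))); auto.
      apply (continuous_ext (fun p => p)); [now intros [] | apply continuous_id]. }
    apply (CXZ V). now apply fiber_image_open. }
  (* The intermediate point need not be unique. Any choice function works: its value is squeezed
     between [y0] and [G (X s, Z s)], hence it is continuous at [s0]. *)
  destruct (functional_choice (fun s c => V (X s, Z s) ->
    Rmin y0 (G (X s, Z s)) <= c <= Rmax y0 (G (X s, Z s)) /\
    F (X s, G (X s, Z s)) - F (X s, y0) = d2 F (X s, c) * (G (X s, Z s) - y0))) as [xi Hxi].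
  { intros s. destruct (classic (V (X s, Z s))) as [Vs | N].
    - destruct (HG _ Vs) as [G3 G4].
      destruct (fiber_mvt (X s) y0 (G (X s, Z s))) as (c & Hc); auto; [apply Vs | ]. now exists c.
    - exists 0. intros; contradiction. }
  assert (xi0 : xi s0 = y0).
  { destruct (Hxi s0 Hq) as [H _]. fold y0 in H. unfold Rmin, Rmax in H.
    destruct (Rle_dec y0 y0); lra. }
  assert (Cxi : continuous xi s0).
  { apply (proj2 (filterlim_locally xi (xi s0))). intros eps.
    generalize (filter_and _ _ LV (proj1 (filterlim_locally (fun s => G (X s, Z s)) y0) CG eps)).
    apply filter_imp. intros s [Vs Bs]. destruct (Hxi s Vs) as [H _]. rewrite xi0.
    change (Rabs (G (X s, Z s) - y0) < eps) in Bs. change (Rabs (xi s - y0) < eps).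
    apply Rabs_def2 in Bs. unfold Rmin, Rmax in H.
    destruct (Rle_dec y0 (G (X s, Z s))); apply Rabs_def1; lra. }
  assert (Ca : continuous (fun s => d2 F (X s, xi s)) s0).
  { apply (continuous_comp_2 X xi (fun a b => d2 F (a, b))); auto. rewrite xi0.
    apply (continuous_ext (d2 F)); [now intros [] | ].
    destruct HF as (_ & _ & _ & H). apply H. apply Hbox; auto. apply Hq. }
  assert (N0 : d2 F (X s0, y0) <> 0).
  { apply Rgt_not_eq. apply Hbox; auto. apply Hq. }
  replace (l / d2 F (X s0, y0)) with (beta s0 / d2 F (X s0, xi s0)) by now rewrite B2, xi0.
  apply (is_derive_slope (fun s => G (X s, Z s)) (fun s => beta s / d2 F (X s, xi s))).
  - apply (continuous_mult beta (fun s => / d2 F (X s, xi s))); auto.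
    apply (continuous_comp (fun s => d2 F (X s, xi s)) Rinv); auto.
    apply (CrR_continuous 0 _ _ (CrR_inv 0)). now rewrite xi0.
  - revert LV. apply filter_imp. intros s Vs. destruct (Hxi s Vs) as [H1 H2].
    destruct (HG _ Vs) as [G3 G4]. simpl in G4. rewrite G4 in H2.
    specialize (B3 s). rewrite G2, Rminus_diag, Rminus_0_r, H2 in B3.
    assert (d2 F (X s, xi s) <> 0).
    { apply Rgt_not_eq. apply Hbox; [apply Vs | ].
      eapply fiber_between; [exact G1 | exact G3 | exact H1]. }
    fold y0. apply (Rmult_eq_reg_l (d2 F (X s, xi s))); auto. rewrite B3. field. auto.
Qed.

Lemma fiber_inverse_partials q : V q ->
  is_derive (fun s => G (s, snd q)) (fst q) (- (d1 F (fst q, G q) * / d2 F (fst q, G q))) /\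
  is_derive (fun s => G (fst q, s)) (snd q) (/ d2 F (fst q, G q)).
Proof.
  intros Hq. destruct (HG q Hq) as [G1 _]. destruct q as [x z]. simpl in *.
  assert (N0 : d2 F (x, G (x, z)) <> 0).
  { apply Rgt_not_eq. apply Hbox; auto. apply Hq. }
  split.
  - replace (- _) with (- d1 F (x, G (x, z)) / d2 F (x, G (x, z))) by (field; auto).
    apply (fiber_inverse_derive (fun s => s) (fun _ => z) x); auto.
    + apply continuous_id.
    + apply continuous_const.
    + assert (D : is_derive (fun s => F (s, G (x, z))) x (d1 F (x, G (x, z)))).
      { apply (Derive_correct (fun s => F (s, G (x, z)))).
        destruct HF as (_ & H & _). apply (H (x, G (x, z))). apply Hbox; auto. apply Hq. }
      replace (- d1 F (x, G (x, z))) with (0 - d1 F (x, G (x, z))) by ring.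
      apply (is_derive_minus (fun _ => z) (fun s => F (s, G (x, z)))); auto.
      apply (is_derive_const z x).
  - replace (/ _) with (1 / d2 F (x, G (x, z))) by (field; auto).
    apply (fiber_inverse_derive (fun _ => x) (fun s => s) z); auto.
    + apply continuous_const.
    + apply continuous_id.
    + auto_derive; auto.
Qed.

(** Bootstrapping: the partial derivatives of [G] are rational expressions in those of [F] evaluated
    at (x, G), so each class of [G] yields the next one as long as [F] allows it. *)
Lemma fiber_inverse_CrR2 n : CrR2 (S n) W F -> CrR2 (S n) V G.
Proof.
  assert (C0 : CrR2 0 V G) by (intros q Hq; now apply fiber_inverse_continuous).
  assert (OV := fiber_image_open).
  assert (Step : forall n, CrR2 (S n) W F -> CrR2 n V G -> CrR2 (S n) V G).
  { clear n. intros n (F1 & F2 & F3 & F4) Hn.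
    assert (K : forall f, CrR2 n W f -> CrR2 n V (fun q => f (fst q, G q))).
    { intros f Hf. apply (CrR2_comp n V W f fst G); auto; [ | now apply CrR2_fst].
      intros q Hq. apply Hbox; [apply Hq | now apply HG]. }
    assert (KI : CrR2 n V (fun q => / d2 F (fst q, G q))).
    { apply (CrR2_comp1 n V (fun x => x <> 0) Rinv (fun q => d2 F (fst q, G q))); auto.
      - apply open_neq0.
      - intros q Hq. apply Rgt_not_eq. apply Hbox; [apply Hq | now apply HG].
      - apply CrR_inv. }
    split; [exact C0 | split; [ | split]].
    - intros q Hq. destruct (fiber_inverse_partials q Hq) as [D1 D2].
      split; eexists; [exact D1 | exact D2].
    - apply (CrR2_ext n V (fun q => (-1) * (d1 F (fst q, G q) * / d2 F (fst q, G q)))); auto.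
      + intros q Hq. symmetry. apply is_derive_unique.
        replace (-1 * _) with (- (d1 F (fst q, G q) * / d2 F (fst q, G q))) by ring.
        now apply fiber_inverse_partials.
      + apply CrR2_mult; auto; [now apply CrR2_const | ]. apply CrR2_mult; auto.
    - apply (CrR2_ext n V (fun q => / d2 F (fst q, G q))); auto.
      intros q Hq. symmetry. apply is_derive_unique. now apply fiber_inverse_partials. }
  induction n; intros H; apply Step; auto. apply IHn. now apply CrR2_le.
Qed.

End FiberedInverse.

(** [G] is chosen before [n], so a single inverse has every class that [F] has, as the smooth case
    requires. *)
Lemma fibered_inverse (W : R * R -> Prop) (F : R * R -> R) :
  open W -> W (0, 0) -> CrR2 1 W F -> 0 < d2 F (0, 0) ->
  exists (U V : R * R -> Prop) (G : R * R -> R),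
    open U /\ open V /\ U (0, 0) /\ (forall p, U p -> W p) /\
    (forall p, U p -> V (fst p, F p)) /\ (forall q, V q -> U (fst q, G q)) /\
    (forall p, U p -> G (fst p, F p) = snd p) /\ (forall q, V q -> F (fst q, G q) = snd q) /\
    (forall n, CrR2 (S n) W F -> CrR2 (S n) V G).
Proof.
  intros HW W0 HF Hpos.
  assert (L : locally (0, 0) (fun p => W p /\ 0 < d2 F p)).
  { apply filter_and; [now apply HW | ].
    destruct HF as (_ & _ & _ & C). apply (C (0, 0) W0 (fun z => 0 < z)). now apply open_gt. }
  destruct L as [e He].
  assert (Hbox : forall x y, Rabs x < e -> Rabs y < e -> W (x, y) /\ 0 < d2 F (x, y)).
  { intros x y Hx Hy. apply He. split; [change (Rabs (x - 0) < e) | change (Rabs (y - 0) < e)];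
      now rewrite Rminus_0_r. }
  set (V := fun q : R * R => Rabs (fst q) < e /\ exists y, Rabs y < e /\ F (fst q, y) = snd q).
  destruct (functional_choice (fun q y => V q -> Rabs y < e /\ F (fst q, y) = snd q)) as [G HG].
  { intros q. destruct (classic (V q)) as [[_ [y Hy]] | N]; [now exists y | ].
    exists 0. intros; contradiction. }
  exists (fun p => Rabs (fst p) < e /\ Rabs (snd p) < e), V, G.
  assert (UV : forall p : R * R, Rabs (fst p) < e /\ Rabs (snd p) < e -> V (fst p, F p)).
  { intros [x y] [H1 H2]. split; auto. now exists y. }
  split; [apply fiber_box_open | split; [now apply (fiber_image_open W) | split; [ | split; [ | split; [ | split; [ | split; [ | split]]]]]]]; auto.
  - simpl. rewrite Rabs_R0. split; apply cond_pos.
  - intros [x y] [H1 H2]. now apply Hbox.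
  - intros q Hq. split; [apply Hq | now apply HG].
  - intros [x y] [H1 H2]. destruct (HG _ (UV (x, y) (conj H1 H2))) as [G1 G2].
    apply (fiber_inj W F HF e Hbox x); auto.
  - intros q Hq. now apply HG.
  - intros n Hn. now apply (fiber_inverse_CrR2 W F HW HF e Hbox G HG n).
Qed.

(** * Germs of diffeomorphisms *)

Lemma locally_0 (P : R -> Prop) :
  locally 0 P <-> exists eps, 0 < eps /\ forall t, Rabs t < eps -> P t.
Proof.
  split.
  - intros [e He]. exists e. split; [apply cond_pos | ]. intros t Ht. apply He.
    change (Rabs (t - 0) < e). now rewrite Rminus_0_r.
  - intros (e & He & H). exists (mkposreal e He). intros t Ht. apply H.
    change (Rabs (t - 0) < e) in Ht. now rewrite Rminus_0_r in Ht.
Qed.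

(** An equality for finite classes, matching [Cr1 (Fin m)], which asks for order [m] itself.
    Quantifying over these [n] treats finite and smooth classes uniformly. *)
Definition reg_le (n : nat) (r : reg) : Prop :=
  match r with Fin m => n = m | Inf => True end.

Lemma Cr1_iff r U f : Cr1 r U f <-> forall n, reg_le n r -> CrR n U f.
Proof.
  destruct r as [m | ]; simpl.
  - split; [intros H n ->; auto | auto].
  - split; auto.
Qed.

Lemma Cr2_iff r U F : Cr2 r U F <-> forall n, reg_le n r ->
  CrR2 n U (fun p => fst (F p)) /\ CrR2 n U (fun p => snd (F p)).
Proof.
  destruct r as [m | ]; simpl.
  - split; [intros H n ->; auto | auto].
  - split; auto.
Qed.

Lemma continuous_pair (T : UniformSpace) (f : T -> R * R) x :
  continuous (fun t => fst (f t)) x -> continuous (fun t => snd (f t)) x -> continuous f x.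
Proof.
  intros H1 H2.
  apply (continuous_ext (fun t => (fst (f t), snd (f t)))); [intros t; now destruct (f t) | ].
  apply (continuous_comp_2 (fun t => fst (f t)) (fun t => snd (f t)) (fun a b => (a, b))); auto.
  apply (continuous_ext (fun p => p)); [now intros [] | apply continuous_id].
Qed.

Lemma Cr2_continuous r U F : Cr2 r U F -> forall p, U p -> continuous F p.
Proof.
  intros H p Hp.
  assert (exists n, CrR2 n U (fun p => fst (F p)) /\ CrR2 n U (fun p => snd (F p))) as (n & H1 & H2).
  { destruct r as [m | ]; [exists m | exists O]; apply H. }
  apply continuous_pair; eapply CrR2_continuous; eauto.
Qed.

Lemma Cr1_continuous r U f : Cr1 r U f -> forall p, U p -> continuous f p.
Proof.
  intros H p Hp. assert (exists n, CrR n U f) as (n & H1).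
  { destruct r as [m | ]; [exists m | exists O]; apply H. }
  eapply CrR_continuous; eauto.
Qed.

Lemma open_preimage (S T : UniformSpace) (U : S -> Prop) (V : T -> Prop) (f : S -> T) :
  open U -> open V -> (forall p, U p -> continuous f p) -> open (fun p => U p /\ V (f p)).
Proof.
  intros HU HV Hf p [Up Vp]. apply filter_and; [now apply HU | ].
  apply (Hf p Up V). now apply HV.
Qed.

Lemma Cr2_comp r U W F G : open U -> open W -> (forall p, U p -> W (F p)) ->
  Cr2 r W G -> Cr2 r U F -> Cr2 r U (fun p => G (F p)).
Proof.
  intros HU HW H. rewrite !Cr2_iff. intros HG HF n Hn.
  destruct (HG n Hn) as [G1 G2], (HF n Hn) as [F1 F2].
  split.
  - apply (CrR2_ext n U (fun p => fst (G (fst (F p), snd (F p))))); auto.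
    + intros p _. now destruct (F p).
    + apply (CrR2_comp n U W (fun q => fst (G q))); auto.
      intros p Hp. specialize (H p Hp). now destruct (F p).
  - apply (CrR2_ext n U (fun p => snd (G (fst (F p), snd (F p))))); auto.
    + intros p _. now destruct (F p).
    + apply (CrR2_comp n U W (fun q => snd (G q))); auto.
      intros p Hp. specialize (H p Hp). now destruct (F p).
Qed.

Lemma Cr2_sub r (U V : R * R -> Prop) F : (forall p, V p -> U p) -> Cr2 r U F -> Cr2 r V F.
Proof.
  rewrite !Cr2_iff. intros H HF n Hn. destruct (HF n Hn).
  split; eapply CrR2_sub; eauto.
Qed.

Lemma diffeo2_comp r Psi1 Psi2 p : diffeo2_germ r Psi1 p -> diffeo2_germ r Psi2 (Psi1 p) ->
  diffeo2_germ r (fun q => Psi2 (Psi1 q)) p.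
Proof.
  intros (U1 & V1 & Phi1 & OU1 & OV1 & Up & UV1 & VU1 & I1 & J1 & C1 & D1)
    (U2 & V2 & Phi2 & OU2 & OV2 & Up2 & UV2 & VU2 & I2 & J2 & C2 & D2).
  assert (O : open (fun q => U1 q /\ U2 (Psi1 q))).
  { apply open_preimage; auto. eapply Cr2_continuous; eauto. }
  assert (O' : open (fun q => V2 q /\ V1 (Phi2 q))).
  { apply open_preimage; auto. eapply Cr2_continuous; eauto. }
  exists (fun q => U1 q /\ U2 (Psi1 q)), (fun q => V2 q /\ V1 (Phi2 q)), (fun q => Phi1 (Phi2 q)).
  split; [exact O | split; [exact O' | split; [tauto | split; [ | split; [ | split; [ | split; [ | split]]]]]]].
  - intros q [H1 H2]. split; auto. rewrite I2; auto.
  - intros q [H1 H2]. split; auto. rewrite J1; auto.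
  - intros q [H1 H2]. rewrite I2; auto.
  - intros q [H1 H2]. rewrite J1; auto.
  - apply (Cr2_comp r _ U2 Psi1 Psi2); auto; [tauto | ]. apply (Cr2_sub r U1); auto; tauto.
  - apply (Cr2_comp r _ V1 Phi2 Phi1); auto; [tauto | ]. apply (Cr2_sub r V2); auto; tauto.
Qed.

Lemma diffeo1_sym r psi phi : diffeo1_germ r psi phi -> diffeo1_germ r phi psi.
Proof.
  intros (H0 & U & V & OU & OV & U0 & UV & VU & I & J & C & D).
  split; [rewrite <- H0 at 1; auto | ].
  exists V, U. repeat (split; auto). rewrite <- H0; auto.
Qed.

Lemma diffeo1_comp r psi1 phi1 psi2 phi2 : diffeo1_germ r psi1 phi1 -> diffeo1_germ r psi2 phi2 ->
  diffeo1_germ r (fun t => psi2 (psi1 t)) (fun t => phi1 (phi2 t)).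
Proof.
  intros (Z1 & U1 & V1 & OU1 & OV1 & Up & UV1 & VU1 & I1 & J1 & C1 & D1)
    (Z2 & U2 & V2 & OU2 & OV2 & Up2 & UV2 & VU2 & I2 & J2 & C2 & D2).
  assert (O : open (fun q => U1 q /\ U2 (psi1 q))).
  { apply open_preimage; auto. eapply Cr1_continuous; eauto. }
  assert (O' : open (fun q => V2 q /\ V1 (phi2 q))).
  { apply open_preimage; auto. eapply Cr1_continuous; eauto. }
  split; [now rewrite Z1 | ].
  exists (fun q => U1 q /\ U2 (psi1 q)), (fun q => V2 q /\ V1 (phi2 q)).
  split; [exact O | split; [exact O' | split; [rewrite Z1; tauto | split; [ | split; [ | split; [ | split; [ | split]]]]]]].
  - intros q [H1 H2]. split; auto. rewrite I2; auto.
  - intros q [H1 H2]. split; auto. rewrite J1; auto.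
  - intros q [H1 H2]. rewrite I2; auto.
  - intros q [H1 H2]. rewrite J1; auto.
  - rewrite Cr1_iff in *. intros n Hn. apply (CrR_comp n _ U2); auto; [tauto | ].
    apply (CrR_sub n U1); auto; tauto.
  - rewrite Cr1_iff in *. intros n Hn. apply (CrR_comp n _ V1); auto; [tauto | ].
    apply (CrR_sub n V2); auto; tauto.
Qed.

(** [Phi] inverts [Psi] only on [U]; continuity of [g1] keeps [g1 t] inside [U] for small [t]. *)
Lemma Cr_equiv_sym r g1 g2 : continuous g1 0 -> Cr_equiv r g1 g2 -> Cr_equiv r g2 g1.
Proof.
  intros Cg (psi & phi & Psi & H1 & (U & V & Phi & OU & OV & Up & UV & VU & I & J & C & D) & He).
  rewrite <- locally_0 in He.
  generalize (diffeo1_sym _ _ _ H1). intros H2.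
  assert (E0 : Psi (g1 0) = g2 0).
  { destruct H2 as [P0 _]. rewrite <- P0 at 1. now apply locally_singleton in He. }
  exists phi, psi, Phi. split; [auto | split].
  - exists V, U, Psi. repeat (split; auto). rewrite <- E0. auto.
  - apply locally_0. destruct H1 as (Z & U1 & V1 & OU1 & OV1 & U0 & UV1 & VU1 & I1 & J1 & C1 & D1).
    assert (Cpsi : continuous psi 0) by (eapply Cr1_continuous; eauto).
    assert (L1 : locally 0 (fun t => Psi (g1 (phi (psi t))) = g2 (psi t))).
    { apply (Cpsi (fun s => Psi (g1 (phi s)) = g2 s)). now rewrite Z. }
    generalize (filter_and _ _ L1 (filter_and _ _ (OU1 0 U0) (Cg U (OU _ Up)))).
    apply filter_imp. intros t (K1 & K2 & K3). rewrite <- K1, I1; auto.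
Qed.

Lemma Cr_equiv_trans r g1 g2 g3 : Cr_equiv r g1 g2 -> Cr_equiv r g2 g3 -> Cr_equiv r g1 g3.
Proof.
  intros (psi1 & phi1 & Psi1 & H1 & D1 & E1) (psi2 & phi2 & Psi2 & H2 & D2 & E2).
  rewrite <- locally_0 in E1. rewrite <- locally_0 in E2.
  assert (E0 : Psi1 (g1 0) = g2 0).
  { destruct (diffeo1_sym _ _ _ H1) as [P0 _]. rewrite <- P0 at 1. now apply locally_singleton in E1. }
  exists (fun t => psi2 (psi1 t)), (fun t => phi1 (phi2 t)), (fun q => Psi2 (Psi1 q)).
  split; [now apply diffeo1_comp | split; [apply diffeo2_comp; auto; now rewrite E0 | ]].
  apply locally_0.
  assert (Cphi : continuous phi2 0).
  { destruct (diffeo1_sym _ _ _ H2) as (_ & U & V & _ & _ & U0 & _ & _ & _ & _ & C & _).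
    eapply Cr1_continuous; eauto. }
  destruct (diffeo1_sym _ _ _ H2) as [Z _].
  assert (L1 : locally 0 (fun t => Psi1 (g1 (phi1 (phi2 t))) = g2 (phi2 t))).
  { apply (Cphi (fun s => Psi1 (g1 (phi1 s)) = g2 s)). now rewrite Z. }
  generalize (filter_and _ _ L1 E2). apply filter_imp. intros t [K1 K2]. now rewrite K1.
Qed.

Lemma diffeo1_id r : diffeo1_germ r (fun t => t) (fun t => t).
Proof.
  split; auto. exists (fun _ => True), (fun _ => True).
  repeat (split; auto using open_true); rewrite Cr1_iff; intros; apply CrR_id.
Qed.

Lemma diffeo2_global r Psi Phi p : (forall q, Phi (Psi q) = q) -> (forall q, Psi (Phi q) = q) ->
  (forall n, CrR2 n (fun _ => True) (fun q => fst (Psi q)) /\ CrR2 n (fun _ => True) (fun q => snd (Psi q))) ->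
  (forall n, CrR2 n (fun _ => True) (fun q => fst (Phi q)) /\ CrR2 n (fun _ => True) (fun q => snd (Phi q))) ->
  diffeo2_germ r Psi p.
Proof.
  intros. exists (fun _ => True), (fun _ => True), Phi.
  repeat (split; auto using open_true); rewrite Cr2_iff; auto.
Qed.

Lemma Cr_equiv_target r g1 g2 Psi : diffeo2_germ r Psi (g1 0) ->
  locally 0 (fun t => Psi (g1 t) = g2 t) -> Cr_equiv r g1 g2.
Proof.
  intros H L. exists (fun t => t), (fun t => t), Psi.
  split; [apply diffeo1_id | split; auto]. now apply locally_0.
Qed.

Lemma Cr_equiv_source r g1 g2 psi phi : diffeo1_germ r psi phi ->
  locally 0 (fun t => g1 (phi t) = g2 t) -> Cr_equiv r g1 g2.
Proof.
  intros H L. exists psi, phi, (fun q => q). split; [auto | split].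
  - apply (diffeo2_global r _ (fun q => q)); auto; intros n; split;
      apply (CrR2_fst n) || apply (CrR2_snd n); apply open_true.
  - now apply locally_0.
Qed.

Lemma fibered_diffeo r (W : R * R -> Prop) (F : R * R -> R) : r <> Fin 0 ->
  open W -> W (0, 0) -> CrR2 1 W F -> (forall n, reg_le n r -> CrR2 n W F) -> 0 < d2 F (0, 0) ->
  diffeo2_germ r (fun p => (fst p, F p)) (0, 0).
Proof.
  intros Hr HW W0 H1 HF Hpos.
  destruct (fibered_inverse W F HW W0 H1 Hpos)
    as (U & V & G & OU & OV & U0 & UW & UV & VU & I & J & HG).
  exists U, V, (fun q => (fst q, G q)).
  repeat (split; auto).
  - intros [x y] Hq. simpl. f_equal. now apply (I (x, y)).
  - intros [x y] Hq. simpl. f_equal. now apply (J (x, y)).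
  - apply Cr2_iff. intros n Hn. simpl. split; [now apply CrR2_fst | ].
    apply (CrR2_sub n W); auto.
  - apply Cr2_iff. intros n Hn. simpl. split; [now apply (CrR2_fst n) | ].
    destruct n; [apply CrR2_le, HG; auto | apply HG; auto].
Qed.

(** Obtained by restricting the fibered inverse of (x, y) |-> (x, f y) to the fiber over 0. *)
Lemma inverse_germ r (W : R -> Prop) (f : R -> R) : r <> Fin 0 ->
  open W -> W 0 -> f 0 = 0 -> CrR 1 W f -> (forall n, reg_le n r -> CrR n W f) -> 0 < Derive f 0 ->
  exists phi, diffeo1_germ r f phi.
Proof.
  intros Hr HW W0 f0 H1 HF Hpos.
  destruct (fibered_inverse (fun p => W (snd p)) (fun p => f (snd p)))
    as (U & V & G & OU & OV & U0 & UW & UV & VU & I & J & HG); auto.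
  { now apply open_snd. }
  { now apply CrR2_lift_snd. }
  assert (S : forall A : R * R -> Prop, open A -> open (fun y => A (0, y))).
  { intros A HA. apply (open_comp (fun y : R => (0, y)) A); auto. intros y _. apply continuous_section. }
  exists (fun y => G (0, y)). split; auto.
  exists (fun y => U (0, y)), (fun y => V (0, y)).
  repeat (split; auto).
  - intros y Hy. apply (UV (0, y) Hy).
  - intros y Hy. apply (VU (0, y) Hy).
  - intros y Hy. apply (I (0, y) Hy).
  - intros y Hy. apply (J (0, y) Hy).
  - apply Cr1_iff. intros n Hn. apply (CrR_sub n W); auto. intros y Hy. apply (UW (0, y) Hy).
  - apply Cr1_iff. intros n Hn. apply (CrR2_slice n 0 V G).
    assert (K : forall n, CrR n W f -> CrR2 n (fun p => W (snd p)) (fun p => f (snd p))).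
    { intros m Hm. now apply CrR2_lift_snd. }
    destruct n; [apply CrR2_le, HG; apply K; auto | apply HG; auto].
Qed.

(** * Smooth functions on an interval and Hadamard's lemma *)

Lemma ex_derive_continuous_R (f : R -> R) (x : R) : ex_derive f x -> continuous f x.
Proof. exact (ex_derive_continuous f x). Qed.

Definition smooth (d : R) (f : R -> R) : Prop := forall n, CrR n (fun x => Rabs x < d) f.

(** A function presented together with candidates for all its derivatives, so that smoothness and
    the values of [Derive_n] follow from one-step derivative computations. *)
Definition tower (U : R -> Prop) (T : nat -> R -> R) : Prop :=
  forall j x, U x -> is_derive (T j) x (T (S j) x).

Lemma tower_CrR U T : open U -> tower U T -> forall n j, CrR n U (T j).
Proof.
  intros HU HT.
  assert (C : forall j x, U x -> continuous (T j) x).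
  { intros j x Hx. apply ex_derive_continuous_R. eexists. now apply HT. }
  induction n; intros j; [intros x Hx; now apply C | ].
  split; [intros x Hx; now apply C | split].
  - intros x Hx. eexists. now apply HT.
  - apply (CrR_ext n U (T (S j))); auto.
    intros x Hx. symmetry. apply is_derive_unique. now apply HT.
Qed.

Lemma smooth_Derive d f : smooth d f -> smooth d (Derive f).
Proof. intros H n. apply (H (S n)). Qed.

Lemma smooth_Derive_n d f j : smooth d f -> smooth d (Derive_n f j).
Proof. intros H. induction j; auto. now apply smooth_Derive. Qed.

Lemma smooth_ex_derive d f x : smooth d f -> Rabs x < d -> ex_derive f x.
Proof. intros H Hx. apply (H 1%nat); auto. Qed.

Lemma smooth_continuous d f x : smooth d f -> Rabs x < d -> continuous f x.
Proof. intros H Hx. apply (H 0%nat); auto. Qed.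

Lemma smooth_tower d f : smooth d f -> tower (fun x => Rabs x < d) (Derive_n f).
Proof.
  intros H j x Hx. apply Derive_correct. apply (smooth_ex_derive d); auto.
  now apply smooth_Derive_n.
Qed.

Lemma tower_Derive_n U T : open U -> tower U T -> forall j x, U x -> Derive_n (T 0%nat) j x = T j x.
Proof.
  intros HU HT. induction j; intros x Hx; [reflexivity | ].
  simpl. rewrite (Derive_ext_loc _ (T j)).
  - apply is_derive_unique. now apply HT.
  - generalize (HU x Hx). apply filter_imp. auto.
Qed.

Lemma smooth_sub d d' f : d' <= d -> smooth d f -> smooth d' f.
Proof. intros H Hf n. apply (CrR_sub n (fun x => Rabs x < d)); auto. intros; lra. Qed.

Lemma smooth_ext d f g : (forall x, Rabs x < d -> f x = g x) -> smooth d f -> smooth d g.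
Proof. intros H Hf n. apply (CrR_ext n _ f); auto. apply open_Rabs_lt. Qed.

Lemma smooth_const d c : smooth d (fun _ => c).
Proof. intros n. apply CrR_const. Qed.

Lemma smooth_id d : smooth d (fun x => x).
Proof. intros n. apply CrR_id. Qed.

Lemma smooth_plus d f g : smooth d f -> smooth d g -> smooth d (fun x => f x + g x).
Proof. intros Hf Hg n. apply CrR_plus; auto. apply open_Rabs_lt. Qed.

Lemma smooth_mult d f g : smooth d f -> smooth d g -> smooth d (fun x => f x * g x).
Proof. intros Hf Hg n. apply CrR_mult; auto. apply open_Rabs_lt. Qed.

Lemma smooth_opp d f : smooth d f -> smooth d (fun x => - f x).
Proof.
  intros Hf. apply (smooth_ext d (fun x => (-1) * f x)); [intros; ring | ].
  apply smooth_mult; auto. apply smooth_const.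
Qed.

Lemma smooth_minus d f g : smooth d f -> smooth d g -> smooth d (fun x => f x - g x).
Proof. intros Hf Hg. apply smooth_plus; auto. now apply smooth_opp. Qed.

Lemma smooth_pow d f k : smooth d f -> smooth d (fun x => f x ^ k).
Proof.
  intros Hf. induction k; simpl; [apply smooth_const | now apply smooth_mult].
Qed.

Lemma smooth_comp d e f u : (forall x, Rabs x < d -> Rabs (u x) < e) ->
  smooth e f -> smooth d u -> smooth d (fun x => f (u x)).
Proof.
  intros H Hf Hu n. apply (CrR_comp n _ (fun x => Rabs x < e)); auto; apply open_Rabs_lt.
Qed.

Lemma smooth_inv d f : (forall x, Rabs x < d -> f x <> 0) -> smooth d f -> smooth d (fun x => / f x).
Proof.
  intros H Hf n. apply (CrR_comp n _ (fun x => x <> 0) Rinv); auto.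
  - apply open_Rabs_lt.
  - apply open_neq0.
  - apply CrR_inv.
Qed.

Lemma smooth_sqrt d f : (forall x, Rabs x < d -> 0 < f x) -> smooth d f -> smooth d (fun x => sqrt (f x)).
Proof.
  intros H Hf n. apply (CrR_comp n _ (fun x => 0 < x) sqrt); auto.
  - apply open_Rabs_lt.
  - apply open_gt.
  - apply CrR_sqrt.
Qed.

Lemma Rabs_scale_lt s x d : 0 <= s <= 1 -> Rabs x < d -> Rabs (s * x) < d.
Proof.
  intros Hs Hx. rewrite Rabs_mult, (Rabs_right s) by lra.
  generalize (Rabs_pos x). intros.
  assert (s * Rabs x <= 1 * Rabs x) by (apply Rmult_le_compat_r; lra). lra.
Qed.

(** Differentiation under the integral sign in the Hadamard quotient, the integral of f' (s x) over
    0 <= s <= 1. *)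
Lemma hadamard_tower d f : smooth d f ->
  tower (fun x => Rabs x < d)
    (fun j x => RInt (fun s => s ^ j * Derive_n f (S j) (s * x)) 0 1).
Proof.
  intros Hf j x Hx.
  assert (HT := smooth_tower d f Hf).
  assert (D : forall u s, Rabs (s * u) < d ->
    is_derive (fun z => s ^ j * Derive_n f (S j) (s * z)) u (s ^ S j * Derive_n f (S (S j)) (s * u))).
  { intros u s Hs. replace (s ^ S j * Derive_n f (S (S j)) (s * u)) with
      (s ^ j * (s * Derive_n f (S (S j)) (s * u))) by (simpl; ring).
    apply (is_derive_scal (fun z => Derive_n f (S j) (s * z))).
    apply (is_derive_comp (Derive_n f (S j)) (fun z => s * z)); [now apply HT | ].
    auto_derive; auto. ring. }
  assert (C : forall i k u s, Rabs (s * u) < d -> continuous (fun s => s ^ i * Derive_n f k (s * u)) s).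
  { intros i k u s Hs. apply (continuous_mult (fun s => s ^ i) (fun s => Derive_n f k (s * u))).
    - apply ex_derive_continuous_R. auto_derive; auto.
    - apply (continuous_comp (fun s => s * u) (Derive_n f k)).
      + apply ex_derive_continuous_R. auto_derive; auto.
      + apply (smooth_continuous d); auto. now apply smooth_Derive_n. }
  assert (L : locally x (fun y => Rabs y < d)) by now apply open_Rabs_lt.
  rewrite <- (RInt_ext (fun s => Derive (fun z => s ^ j * Derive_n f (S j) (s * z)) x)).
  2:{ intros s. rewrite Rmin_left, Rmax_right by lra. intros Hs. apply is_derive_unique, D.
      apply Rabs_scale_lt; auto; lra. }
  apply (is_derive_RInt_param (fun y s => s ^ j * Derive_n f (S j) (s * y))).
  - revert L. apply filter_imp. intros y Hy s. rewrite Rmin_left, Rmax_right by lra. intros Hs.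
    eexists. apply D. now apply Rabs_scale_lt.
  - intros s. rewrite Rmin_left, Rmax_right by lra. intros Hs.
    assert (O : locally (x, s) (fun p : R * R => Rabs (snd p * fst p) < d)).
    { assert (K : continuous (fun p : R * R => snd p * fst p) (x, s)).
      { apply (continuous_mult (snd : R * R -> R) fst); [apply continuous_snd | apply continuous_fst]. }
      apply (K (fun z => Rabs z < d)). apply open_Rabs_lt. simpl. now apply Rabs_scale_lt. }
    apply (continuity_2d_pt_ext_loc (fun u s => s ^ S j * Derive_n f (S (S j)) (s * u))).
    + destruct O as [e He]. exists e. intros u v Hu Hv. symmetry. apply is_derive_unique, D.
      apply (He (u, v)). now split.
    + apply continuity_2d_pt_filterlim.
      apply (continuous_mult (fun p : R * R => snd p ^ S j) (fun p => Derive_n f (S (S j)) (snd p * fst p))).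
      * apply (continuous_comp snd (fun s => s ^ S j)); [apply continuous_snd | ].
        apply ex_derive_continuous_R. auto_derive; auto.
      * apply (continuous_comp (fun p : R * R => snd p * fst p) (Derive_n f (S (S j)))).
        -- apply (continuous_mult (snd : R * R -> R) fst); [apply continuous_snd | apply continuous_fst].
        -- apply (smooth_continuous d); [now apply (smooth_Derive_n d f (S (S j))) | ].
           simpl. now apply Rabs_scale_lt.
  - revert L. apply filter_imp. intros y Hy. apply (ex_RInt_continuous (V := R_CompleteNormedModule)).
    intros s. rewrite Rmin_left, Rmax_right by lra. intros Hs. apply C. now apply Rabs_scale_lt.
Qed.

(** The last clause, from the integral of s^j being 1 / (j + 1), lets Taylor coefficients be tracked
    through repeated division by [x]. *)
Lemma hadamard d f : 0 < d -> smooth d f ->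
  exists g, smooth d g /\ (forall x, Rabs x < d -> f x = f 0 + x * g x) /\
    forall j, Derive_n g j 0 = Derive_n f (S j) 0 / INR (S j).
Proof.
  intros Hd Hf. set (K := fun j x => RInt (fun s => s ^ j * Derive_n f (S j) (s * x)) 0 1).
  assert (HK : tower (fun x => Rabs x < d) K) by now apply hadamard_tower.
  assert (HO := open_Rabs_lt d).
  exists (K 0%nat). split; [ | split].
  - intros n. now apply tower_CrR.
  - intros x Hx.
    assert (I : is_RInt (fun s => x * Derive f (s * x)) 0 1 (f (1 * x) - f (0 * x))).
    { apply (is_RInt_derive (fun s => f (s * x))); intros s; rewrite Rmin_left, Rmax_right by lra; intros Hs.
      - apply (is_derive_comp f (fun s => s * x)).
        + apply (smooth_tower d f Hf 0%nat). now apply Rabs_scale_lt.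
        + auto_derive; auto. ring.
      - apply (continuous_scal_r x (fun s => Derive f (s * x))).
        apply (continuous_comp (fun s => s * x) (Derive f)).
        + apply ex_derive_continuous_R. auto_derive; auto.
        + apply (smooth_continuous d); [now apply smooth_Derive | now apply Rabs_scale_lt]. }
    apply (is_RInt_unique (V := R_CompleteNormedModule)) in I.
    rewrite Rmult_1_l, Rmult_0_l in I.
    assert (E : RInt (fun s => x * Derive f (s * x)) 0 1 = x * K 0%nat x).
    { unfold K. transitivity (scal x (RInt (fun s => s ^ 0 * Derive_n f 1 (s * x)) 0 1)); [ | reflexivity].
      rewrite <- (RInt_scal (V := R_CompleteNormedModule) (fun s => s ^ 0 * Derive_n f 1 (s * x)) 0 1 x).
      - apply RInt_ext. intros s _. change (x * Derive f (s * x) = x * (1 * Derive f (s * x))). ring.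
      - apply (ex_RInt_continuous (V := R_CompleteNormedModule)).
        intros s. rewrite Rmin_left, Rmax_right by lra. intros Hs.
        apply (continuous_ext (fun s => Derive f (s * x))); 
          [intros t; change (Derive f (t * x) = 1 * Derive f (t * x)); ring | ].
        apply (continuous_comp (fun s => s * x) (Derive f)).
        + apply ex_derive_continuous_R. auto_derive; auto.
        + apply (smooth_continuous d); [now apply smooth_Derive | now apply Rabs_scale_lt]. }
    lra.
  - intros j. rewrite (tower_Derive_n _ _ HO HK) by now rewrite Rabs_R0.
    unfold K. apply (is_RInt_unique (V := R_CompleteNormedModule)).
    assert (N : INR (S j) <> 0) by (apply not_0_INR; lia).
    apply (is_RInt_ext (fun s => s ^ j * Derive_n f (S j) 0)); [intros; now rewrite Rmult_0_r | ].
    replace (Derive_n f (S j) 0 / INR (S j)) with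
      (1 ^ S j / INR (S j) * Derive_n f (S j) 0 - 0 ^ S j / INR (S j) * Derive_n f (S j) 0).
    2:{ rewrite pow1, pow_ne_zero by lia. field; auto. }
    apply (is_RInt_derive (fun s => s ^ S j / INR (S j) * Derive_n f (S j) 0)); intros s _.
    + auto_derive; auto. replace (match j with 0%nat => 1 | S _ => INR j + 1 end) with (INR (S j)) by reflexivity.
      simpl pred.
      change (1 * (INR (S j) * s ^ j) * / INR (S j) * Derive_n f (S j) 0 = s ^ j * Derive_n f (S j) 0).
      field; auto.
    + apply ex_derive_continuous_R. auto_derive; auto.
Qed.

(** By the mean value theorem the difference quotient at [x0] is a value of [g] at a nearby point.
    Used at 0 for flat functions and for functions glued from two branches. *)
Lemma is_derive_limit (f g : R -> R) x0 : continuous f x0 -> continuous g x0 ->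
  locally x0 (fun x => x <> x0 -> is_derive f x (g x)) -> is_derive f x0 (g x0).
Proof.
  intros Cf Cg [e He]. apply is_derive_Reals. intros eps Heps.
  destruct (proj1 (continuous_eps _ _) Cg eps Heps) as (d & Hd & H1).
  assert (Hm : 0 < Rmin e d) by (apply Rmin_pos; [apply cond_pos | auto]).
  exists (mkposreal _ Hm). simpl. intros h Hh Hlt.
  assert (Rabs h < e /\ Rabs h < d) as [L1 L2].
  { split; eapply Rlt_le_trans; eauto; [apply Rmin_l | apply Rmin_r]. }
  assert (B : forall c, Rmin x0 (x0 + h) <= c <= Rmax x0 (x0 + h) -> Rabs (c - x0) <= Rabs h).
  { intros c. unfold Rmin, Rmax. destruct (Rle_dec x0 (x0 + h)); intros [Q1 Q2].
    - rewrite !Rabs_right; lra.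
    - rewrite !Rabs_left1; lra. }
  assert (D : forall c, Rmin x0 (x0 + h) <= c <= Rmax x0 (x0 + h) -> c <> x0 -> is_derive f c (g c)).
  { intros c Hc N. apply He; auto. change (Rabs (c - x0) < e). specialize (B c Hc). lra. }
  destruct (MVT_gen f x0 (x0 + h) g) as (c & Hc & E).
  - intros c Hc. apply D; [lra | ]. unfold Rmin, Rmax in Hc. destruct (Rle_dec x0 (x0 + h)); lra.
  - intros c Hc. apply continuity_pt_filterlim. destruct (Req_EM_T c x0) as [-> | N]; auto.
    apply ex_derive_continuous_R. eexists. now apply D.
  - rewrite E. replace (g c * (x0 + h - x0) / h - g x0) with (g c - g x0) by (field; auto).
    apply H1. specialize (B c Hc). lra.
Qed.

(** * Borel's theorem *)

(* At [x = 0] the convention [/ 0 = 0] gives the value [0], which is also the limit. *)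
Definition flat (k : nat) (x : R) : R := x * (/ x) ^ k * exp (- (/ x) ^ 2).

(** The [n]-th derivative of [flat k], that is of x^(1-k) exp(-1/x^2): one differentiation stays in
    this family, shifting [k] by 1 and by 3. *)
Fixpoint flat_tower (n k : nat) (x : R) : R :=
  match n with
  | O => flat k x
  | S m => (1 - INR k) * flat_tower m (S k) x + 2 * flat_tower m (3 + k) x
  end.

Lemma flat_tower_0 n : forall k, flat_tower n k 0 = 0.
Proof.
  induction n; intros k; simpl; [unfold flat; ring | rewrite !IHn; ring].
Qed.

(** With [u = / x], exp(u^2) dominates both 1 and (u^2)^k / k!, while |u^k| <= 1 + (u^2)^k. The
    factor |x| left over forces the limit 0 at the origin. *)
Lemma flat_bound k x : Rabs (flat k x) <= (1 + INR (Factorial.fact k)) * Rabs x.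
Proof.
  unfold flat. set (u := / x).
  rewrite Rmult_assoc, Rabs_mult, Rmult_comm.
  apply Rmult_le_compat_r; [apply Rabs_pos | ].
  rewrite Rabs_mult, (Rabs_right (exp _)) by (apply Rle_ge, Rlt_le, exp_pos).
  rewrite exp_Ropp.
  assert (E := exp_pos (u ^ 2)).
  apply (Rmult_le_reg_r (exp (u ^ 2))); auto.
  rewrite Rmult_assoc, Rinv_l, Rmult_1_r by lra.
  assert (F : 0 < INR (Factorial.fact k)) by apply INR_fact_lt_0.
  assert (T : (u ^ 2) ^ k / INR (Factorial.fact k) <= exp (u ^ 2)).
  { apply Rle_trans with (2 := exp_ge_taylor (u ^ 2) k (pow2_ge_0 u)).
    destruct k; simpl sum_f_R0; [apply Rle_refl | ].
    rewrite <- (Rplus_0_l (_ / _)) at 1. apply Rplus_le_compat_r.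
    apply cond_pos_sum. intros n. apply Rmult_le_pos.
    - apply pow_le, pow2_ge_0.
    - apply Rlt_le, Rinv_0_lt_compat, INR_fact_lt_0. }
  assert (T' : (u ^ 2) ^ k <= exp (u ^ 2) * INR (Factorial.fact k)).
  { apply (Rmult_le_reg_r (/ INR (Factorial.fact k))); [now apply Rinv_0_lt_compat | ].
    rewrite Rmult_assoc, Rinv_r, Rmult_1_r by lra. exact T. }
  assert (G : Rabs (u ^ k) <= 1 + (u ^ 2) ^ k).
  { replace ((u ^ 2) ^ k) with (Rabs (u ^ k) * Rabs (u ^ k)).
    - generalize (Rabs_pos (u ^ k)). intros. nra.
    - rewrite <- Rabs_mult, Rabs_right.
      + rewrite <- pow_add, <- pow_mult. f_equal. lia.
      + generalize (Rle_0_sqr (u ^ k)). unfold Rsqr. lra. }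
  assert (1 <= exp (u ^ 2)) by (generalize (exp_ineq1_le (u ^ 2)) (pow2_ge_0 u); lra).
  lra.
Qed.

Lemma flat_derive_nonzero k x : x <> 0 ->
  is_derive (flat k) x ((1 - INR k) * flat (S k) x + 2 * flat (3 + k) x).
Proof.
  intros Hx. unfold flat. auto_derive; auto.
  replace (/ x * (/ x * 1)) with ((/ x) ^ 2) by ring. set (e := exp _).
  destruct k; simpl pred.
  - simpl. field. auto.
  - replace (match k with 0%nat => 1 | S _ => INR k + 1 end) with (INR (S k)) by reflexivity.
    replace (3 + S k)%nat with (S (S (S (S k)))) by lia. rewrite <- !tech_pow_Rmult.
    field. auto.
Qed.

Lemma flat_continuous k x : continuous (flat k) x.
Proof.
  destruct (Req_EM_T x 0) as [-> | N].
  - apply continuous_eps. intros eps Heps.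
    assert (F : 0 < 1 + INR (Factorial.fact k)) by (generalize (INR_fact_lt_0 k); lra).
    exists (eps / (1 + INR (Factorial.fact k))). split; [now apply Rdiv_lt_0_compat | ].
    intros y Hy. replace (flat k 0) with 0 by (unfold flat; ring). rewrite Rminus_0_r in *.
    eapply Rle_lt_trans; [apply flat_bound | ]. rewrite Rmult_comm. now apply Rlt_div_r.
  - apply ex_derive_continuous_R. eexists. now apply flat_derive_nonzero.
Qed.

Lemma flat_derive k x : is_derive (flat k) x ((1 - INR k) * flat (S k) x + 2 * flat (3 + k) x).
Proof.
  destruct (Req_EM_T x 0) as [-> | N]; [ | now apply flat_derive_nonzero].
  apply (is_derive_limit (flat k) (fun x => (1 - INR k) * flat (S k) x + 2 * flat (3 + k) x)).
  - apply flat_continuous.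
  - apply (continuous_plus (fun x => (1 - INR k) * flat (S k) x) (fun x => 2 * flat (3 + k) x)).
    + apply (continuous_mult (fun _ => 1 - INR k) (flat (S k))); [apply continuous_const | apply flat_continuous].
    + apply (continuous_mult (fun _ => 2) (flat (3 + k))); [apply continuous_const | apply flat_continuous].
  - apply filter_forall. intros x. apply flat_derive_nonzero.
Qed.

Lemma flat_tower_derive n : forall k x, is_derive (flat_tower n k) x (flat_tower (S n) k x).
Proof.
  induction n; intros k x; [apply flat_derive | ].
  change (is_derive (fun x => (1 - INR k) * flat_tower n (S k) x + 2 * flat_tower n (3 + k) x) x
    ((1 - INR k) * flat_tower (S n) (S k) x + 2 * flat_tower (S n) (3 + k) x)).
  apply (is_derive_plus (fun x => (1 - INR k) * flat_tower n (S k) x) (fun x => 2 * flat_tower n (3 + k) x));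
    apply is_derive_scal; apply IHn.
Qed.

(* The derivatives of [x (1 - exp (-1/x^2))], a bounded function with the Taylor series of [x]. *)
Definition bounded_id (j : nat) (x : R) : R :=
  match j with
  | 0 => x
  | 1 => 1
  | _ => 0
  end - flat_tower j 0 x.

Lemma bounded_id_tower : tower (fun _ => True) bounded_id.
Proof.
  intros j x _. unfold bounded_id.
  apply (is_derive_minus (fun x => match j with 0 => x | 1 => 1 | _ => 0 end)
    (flat_tower j 0)); [ | apply flat_tower_derive].
  destruct j as [ | [ | j]]; auto_derive; auto.
Qed.

(** Since 1 - exp(-1/x^2) is at most 1 and at most 1/x^2, its product with |x| is at most the
    smaller of |x| and 1/|x|. *)
Lemma bounded_id_bound x : Rabs (bounded_id 0 x) <= 1.
Proof.
  unfold bounded_id. simpl. unfold flat. rewrite pow_O, Rmult_1_r.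
  set (e := exp (- (/ x) ^ 2)).
  replace (x - x * e) with (x * (1 - e)) by ring.
  assert (E0 : 0 < e) by apply exp_pos.
  assert (E1 : e <= 1).
  { unfold e. rewrite <- exp_0. destruct (pow2_ge_0 (/ x)) as [H | H].
    - apply Rlt_le, exp_increasing. lra.
    - rewrite <- H. right. f_equal. ring. }
  assert (E2 : 1 - e <= (/ x) ^ 2) by (generalize (exp_ineq1_le (- (/ x) ^ 2)); fold e; lra).
  rewrite Rabs_mult, (Rabs_right (1 - e)) by lra.
  destruct (Rle_dec (Rabs x) 1) as [H | H].
  - generalize (Rabs_pos x). intros. nra.
  - assert (x <> 0) by (intros ->; rewrite Rabs_R0 in H; lra).
    apply Rle_trans with (Rabs x * (/ x) ^ 2); [apply Rmult_le_compat_l; auto; apply Rabs_pos | ].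
    rewrite <- (pow2_abs (/ x)), Rabs_inv.
    replace (Rabs x * (/ Rabs x) ^ 2) with (/ Rabs x) by (field; lra).
    rewrite <- Rinv_1. apply Rinv_le_contravar; lra.
Qed.

(* Taking antiderivatives moves a single nonzero Taylor coefficient to any order, and on [-1,1]
   preserves the bound on the function, hence bounds all derivatives of lower order. *)
Lemma borel_term (n : nat) : forall (a b : R), 0 < b -> exists T, tower (fun _ => True) T /\
  (forall j, T j 0 = if Nat.eq_dec j (S n) then a else 0) /\
  (forall j x, (j <= n)%nat -> Rabs x <= 1 -> Rabs (T j x) <= b).
Proof.
  induction n; intros a b Hb.
  (* The function (a / l) [bounded_id 0] (l x) has derivative [a] at 0 for every [l], while it is
     bounded by |a| / l; this [l] brings the bound below [b]. *)
  - set (l := (Rabs a + 1) / b).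
    assert (Hl : 0 < l) by (apply Rdiv_lt_0_compat; auto; generalize (Rabs_pos a); lra).
    exists (fun j x => a * / l * l ^ j * bounded_id j (l * x)). split; [ | split].
    + intros j x _. replace (a * / l * l ^ S j * bounded_id (S j) (l * x)) with
        (a * / l * l ^ j * (l * bounded_id (S j) (l * x))) by (simpl; ring).
      apply (is_derive_scal (fun x => bounded_id j (l * x))).
      apply (is_derive_comp (bounded_id j) (fun x => l * x)); [now apply bounded_id_tower | ].
      auto_derive; auto. ring.
    + intros j. rewrite Rmult_0_r. unfold bounded_id. rewrite flat_tower_0.
      destruct (Nat.eq_dec j 1) as [-> | N]; [field; lra | ].
      destruct j as [ | [ | j]]; try lia; ring.
    + intros j x Hj Hx. replace j with 0%nat by lia. rewrite pow_O, Rmult_1_r.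
      rewrite Rabs_mult. apply Rle_trans with (Rabs (a * / l) * 1).
      * apply Rmult_le_compat_l; [apply Rabs_pos | apply bounded_id_bound].
      * rewrite Rmult_1_r, Rabs_mult, (Rabs_right (/ l)) by (apply Rle_ge, Rlt_le, Rinv_0_lt_compat; auto).
        unfold l. apply (Rmult_le_reg_r ((Rabs a + 1) / b)); auto.
        rewrite Rmult_assoc, Rinv_l, Rmult_1_r by (apply Rgt_not_eq; auto).
        replace (b * ((Rabs a + 1) / b)) with (Rabs a + 1) by (field; lra). lra.
  - destruct (IHn a b Hb) as (T & HT & H0 & HB).
    assert (C : forall x, continuous (T 0%nat) x).
    { intros x. apply ex_derive_continuous_R. eexists. now apply HT. }
    assert (D : forall x, is_derive (fun x => RInt (T 0%nat) 0 x) x (T 0%nat x)).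
    { intros x. apply (is_derive_RInt (T 0%nat) (fun x => RInt (T 0%nat) 0 x) 0 x); auto.
      apply filter_forall. intros y. apply (RInt_correct (V := R_CompleteNormedModule)).
      apply (ex_RInt_continuous (V := R_CompleteNormedModule)). auto. }
    exists (fun j => match j with O => fun x => RInt (T 0%nat) 0 x | S i => T i end).
    split; [ | split].
    + intros [ | j] x _; [apply D | now apply HT].
    + intros [ | j].
      * apply (RInt_point (V := R_CompleteNormedModule)).
      * rewrite H0. destruct (Nat.eq_dec j (S n)), (Nat.eq_dec (S j) (S (S n))); auto; lia.
    + intros [ | j] x Hj Hx; [ | apply HB; auto; lia].
      destruct (MVT_gen (fun x => RInt (T 0%nat) 0 x) 0 x (T 0%nat)) as (c & Hc & E).
      * intros; apply D.
      * intros y _. apply continuity_pt_filterlim, (ex_derive_continuous_R (fun x => RInt (T 0%nat) 0 x)).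
        eexists; apply D.
      * assert (P : RInt (T 0%nat) 0 0 = 0) by apply (RInt_point (V := R_CompleteNormedModule)).
        rewrite P, !Rminus_0_r in E. rewrite E, Rabs_mult.
        assert (Rabs c <= 1).
        { apply Rabs_le. apply Rabs_le_between in Hx. unfold Rmin, Rmax in Hc. destruct (Rle_dec 0 x); lra. }
        generalize (HB 0%nat c ltac:(lia) H) (Rabs_pos (T 0%nat c)) (Rabs_pos x). intros. nra.
Qed.

Lemma single_series (n0 : nat) (a : R) (u : nat -> R) :
  (forall n, u n = if Nat.eq_dec n n0 then a else 0) -> Series u = a.
Proof.
  intros H. apply is_series_unique.
  assert (S1 : forall N, (N < n0)%nat -> sum_n u N = 0).
  { induction N; intros L.
    - rewrite sum_O, H. destruct (Nat.eq_dec 0 n0); auto; lia.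
    - rewrite sum_Sn, IHN, H by lia. destruct (Nat.eq_dec (S N) n0); [lia | apply Rplus_0_l]. }
  assert (S2 : forall k, sum_n u (k + n0) = a).
  { induction k.
    - simpl. destruct n0.
      + rewrite sum_O, H. now destruct (Nat.eq_dec 0 0).
      + rewrite sum_Sn, S1, H by lia. destruct (Nat.eq_dec (S n0) (S n0)); [apply Rplus_0_l | lia].
    - simpl. rewrite sum_Sn, IHk, H. destruct (Nat.eq_dec (S (k + n0)) n0); [lia | apply Rplus_0_r]. }
  apply (filterlim_ext_loc (fun _ => a)); [ | apply filterlim_const].
  exists n0. intros N HN. rewrite <- (S2 (N - n0)%nat). f_equal. lia.
Qed.

(** The [n]-th summand carries the derivative of order n + 1, and on [-1, 1] its derivatives up to
    order [n] are at most 2^(-n). For fixed [j], the series of [j]-th derivatives is thus dominated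
    by a geometric one from its [j]-th term on, which justifies termwise differentiation. *)
Lemma borel (a : nat -> R) : exists E, tower (fun x => Rabs x < 1) E /\ forall j, E j 0 = a j.
Proof.
  destruct (functional_choice (fun n T => tower (fun _ => True) T /\
    (forall j, T j 0 = if Nat.eq_dec j (S n) then a (S n) else 0) /\
    (forall j x, (j <= n)%nat -> Rabs x <= 1 -> Rabs (T j x) <= (1 / 2) ^ n))) as [T HT].
  { intros n. apply borel_term. apply pow_lt. lra. }
  assert (G : ex_series (fun n => (1 / 2) ^ n)).
  { apply ex_series_geom. rewrite Rabs_right; lra. }
  assert (Tail : forall j x N, Rabs x <= 1 -> (j <= N)%nat ->
    ex_series (fun n => Rabs (T (N + n)%nat j x)) /\
    Rabs (Series (fun n => T (N + n)%nat j x)) <= (1 / 2) ^ N * 2).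
  { intros j x N Hx HN.
    assert (Bd : forall n, 0 <= Rabs (T (N + n)%nat j x) <= (1 / 2) ^ N * (1 / 2) ^ n).
    { intros n. split; [apply Rabs_pos | ]. rewrite <- pow_add. apply HT; auto. lia. }
    assert (G' : ex_series (fun n => (1 / 2) ^ N * (1 / 2) ^ n)).
    { apply (ex_series_scal_l ((1 / 2) ^ N) (fun n => (1 / 2) ^ n) G). }
    assert (X : ex_series (fun n => Rabs (T (N + n)%nat j x))).
    { apply (ex_series_le (V := R_CompleteNormedModule) _ (fun n => (1 / 2) ^ N * (1 / 2) ^ n)); auto.
      intros n. unfold norm; simpl; unfold abs; simpl. rewrite Rabs_Rabsolu. apply Bd. }
    split; auto.
    eapply Rle_trans; [now apply Series_Rabs | ].
    eapply Rle_trans; [apply Series_le; [exact Bd | exact G'] | ].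
    rewrite Series_scal_l, Series_geom by (rewrite Rabs_right; lra). right. field. }
  assert (Ex : forall j x, Rabs x <= 1 -> ex_series (fun n => T n j x)).
  { intros j x Hx. apply (ex_series_incr_n (fun n => T n j x) j).
    apply ex_series_Rabs. now apply (Tail j x j). }
  set (Sg := fun j x => Series (fun n => T n j x)).
  assert (Boule1 : forall x, Boule 0 (mkposreal 1 Rlt_0_1) x -> Rabs x < 1).
  { intros x Hx. unfold Boule in Hx. simpl in Hx. now rewrite Rminus_0_r in Hx. }
  assert (Un : forall j x, Rabs x <= 1 -> forall N, (j <= N)%nat ->
    Rabs (Sg j x - sum_n (fun n => T n j x) N) <= (1 / 2) ^ S N * 2).
  { intros j x Hx N HN. unfold Sg.
    rewrite (Series_incr_n (fun n => T n j x) (S N)) by (auto; lia).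
    simpl pred. rewrite <- sum_n_Reals.
    replace (_ - _) with (Series (fun k => T (S N + k)%nat j x)) by ring.
    apply Tail; auto. }
  assert (Small : forall eps, 0 < eps -> exists N, forall n, (N <= n)%nat -> (1 / 2) ^ n < eps).
  { intros eps He. destruct (pow_lt_1_zero (1 / 2) ltac:(rewrite Rabs_right; lra) eps He) as [N HN].
    exists N. intros n Hn. specialize (HN n Hn). rewrite Rabs_right in HN; auto.
    apply Rle_ge, pow_le. lra. }
  assert (DS : tower (fun x => Rabs x < 1) Sg).
  { intros j x Hx. apply is_derive_Reals.
    apply (CVU_derivable (fun N x => sum_n (fun n => T n j x) N) (fun N x => sum_n (fun n => T n (S j) x) N)
      (Sg j) (Sg (S j)) 0 (mkposreal 1 Rlt_0_1)).
    - intros eps He. destruct (Small eps He) as [N HN].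
      exists (Nat.max N (S j)). intros n y Hn Hy.
      eapply Rle_lt_trans; [apply Un; [apply Rlt_le; auto | lia] | ].
      simpl. replace (1 / 2 * (1 / 2) ^ n * 2) with ((1 / 2) ^ n) by field. apply HN. lia.
    - intros y Hy. apply is_lim_seq_Reals. apply (Series_correct (fun n => T n j y)).
      apply Ex, Rlt_le. auto.
    - intros n y _. apply is_derive_Reals.
      apply (is_derive_sum_n (K := R_AbsRing) (V := R_NormedModule) (fun k => T k j)).
      intros k _. now apply (HT k).
    - unfold Boule. simpl. now rewrite Rminus_0_r. }
  (* The summands begin with order 1, so the value [a 0] enters as a constant. *)
  exists (fun j x => Sg j x + match j with O => a 0%nat | _ => 0 end). split.
  - intros j x Hx.
    replace (Sg (S j) x + 0) with (plus (Sg (S j) x) zero) by reflexivity.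
    apply (is_derive_plus (Sg j) (fun _ => match j with O => a 0%nat | _ => 0 end)).
    + now apply DS.
    + apply (is_derive_const (V := R_NormedModule)).
  - intros [ | m]; unfold Sg.
    + rewrite (single_series 0 0); [ring | ].
      intros n. destruct (HT n) as (_ & H & _). rewrite H. now destruct (Nat.eq_dec n 0).
    + rewrite (single_series m (a (S m))); [ring | ].
      intros n. destruct (HT n) as (_ & H & _). rewrite H.
      destruct (Nat.eq_dec (S m) (S n)), (Nat.eq_dec n m); subst; auto; lia.
Qed.

(** * Whitney's theorem on even functions *)

Definition even_on (d : R) (f : R -> R) : Prop := forall x, Rabs x < d -> f (- x) = f x.

Lemma even_Derive_odd d f : smooth d f -> even_on d f ->
  forall x, Rabs x < d -> Derive f (- x) = - Derive f x.
Proof.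
  intros Hf He x Hx.
  assert (D : is_derive (fun y => f (- y)) x (- Derive f (- x))).
  { replace (- Derive f (- x)) with ((-1) * Derive f (- x)) by ring.
    apply (is_derive_comp f (fun y => - y)).
    - apply Derive_correct, (smooth_ex_derive d); auto. now rewrite Rabs_Ropp.
    - auto_derive; auto; ring. }
  apply (is_derive_ext_loc _ f) in D.
  - apply is_derive_unique in D. lra.
  - generalize (open_Rabs_lt d x Hx). apply filter_imp. exact He.
Qed.

(** The quotient f' / (2 x) is the derivative of [f] with respect to x^2. It is even again, so the
    operation can be iterated. *)
Lemma even_derivative_quotient d f : 0 < d -> smooth d f -> even_on d f ->
  exists g, smooth d g /\ even_on d g /\ forall x, Rabs x < d -> Derive f x = 2 * x * g x.
Proof.
  intros Hd Hf He.
  assert (O := even_Derive_odd d f Hf He).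
  destruct (hadamard d (Derive f) Hd (smooth_Derive d f Hf)) as (h & Hh & E & _).
  assert (Z : Derive f 0 = 0).
  { specialize (O 0 ltac:(rewrite Rabs_R0; auto)). rewrite Ropp_0 in O. lra. }
  exists (fun x => / 2 * h x). split; [ | split].
  - apply smooth_mult; auto. apply smooth_const.
  - intros x Hx. destruct (Req_EM_T x 0) as [-> | N]; [now rewrite Ropp_0 | ].
    assert (E1 := E x Hx). assert (E2 := E (- x) ltac:(now rewrite Rabs_Ropp)).
    rewrite O, Z in E2 by auto. rewrite Z in E1. f_equal.
    apply (Rmult_eq_reg_l x); auto. lra.
  - intros x Hx. rewrite E, Z by auto. field.
Qed.

Lemma sqrt_lt_of_lt d s : 0 < d -> 0 <= s -> s < d * d -> sqrt s < d.
Proof.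
  intros Hd Hs H. rewrite <- (sqrt_square d) by lra. now apply sqrt_lt_1_alt.
Qed.

(* Whitney's theorem on even functions: each derivative of [s |-> f (sqrt s)] extends continuously
   to [0]; the extension to negative [s] is a Borel function with matching derivatives at [0]. *)
Lemma even_function_of_square d f : 0 < d <= 1 -> smooth d f -> even_on d f ->
  exists g, smooth (d * d) g /\ forall x, Rabs x < d -> f x = g (x * x).
Proof.
  intros [Hd Hd1] Hf He.
  destruct (functional_choice (fun f g => smooth d f -> even_on d f ->
    smooth d g /\ even_on d g /\ forall x, Rabs x < d -> Derive f x = 2 * x * g x)) as [Q HQ].
  { intros h. destruct (classic (smooth d h /\ even_on d h)) as [[H1 H2] | N].
    - destruct (even_derivative_quotient d h Hd H1 H2) as [g Hg]. now exists g.
    - exists h. tauto. }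
  (* For s > 0, [k n (sqrt s)] is the [n]-th derivative of [f (sqrt s)] with respect to [s]. *)
  set (k := fun n => Nat.iter n Q f).
  assert (K : forall n, smooth d (k n) /\ even_on d (k n)).
  { induction n; [now split | ]. destruct IHn as [I1 I2].
    destruct (HQ (k n) I1 I2) as (J1 & J2 & _). now split. }
  assert (KD : forall n x, Rabs x < d -> is_derive (k n) x (2 * x * k (S n) x)).
  { intros n x Hx. destruct (K n) as [I1 I2]. destruct (HQ (k n) I1 I2) as (_ & _ & J).
    change (k (S n) x) with (Q (k n) x). rewrite <- J by auto.
    apply Derive_correct, (smooth_ex_derive d); auto. }
  destruct (borel (fun n => k n 0)) as (B & TB & B0).
  set (G := fun n s => if Rle_dec 0 s then k n (sqrt s) else B n s).
  assert (G0 : forall n, G n 0 = k n 0).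
  { intros n. unfold G. destruct (Rle_dec 0 0); [now rewrite sqrt_0 | lra]. }
  assert (D' : 0 < d * d) by nra.
  assert (CG : forall n, continuous (G n) 0).
  { intros n. apply continuous_eps. intros eps Heps. rewrite G0.
    assert (C1 : continuous (k n) 0).
    { destruct (K n) as [I1 _]. apply (smooth_continuous d); auto. now rewrite Rabs_R0. }
    assert (C2 : continuous (B n) 0).
    { apply ex_derive_continuous_R. eexists. apply TB. rewrite Rabs_R0. lra. }
    destruct (proj1 (continuous_eps _ _) C1 eps Heps) as (d1 & P1 & Q1).
    destruct (proj1 (continuous_eps _ _) C2 eps Heps) as (d2 & P2 & Q2).
    exists (Rmin (d1 * d1) d2). split; [apply Rmin_pos; nra | ].
    intros y Hy. rewrite Rminus_0_r in Hy.
    assert (Rabs y < d1 * d1 /\ Rabs y < d2) as [Y1 Y2].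
    { split; eapply Rlt_le_trans; eauto; [apply Rmin_l | apply Rmin_r]. }
    unfold G. destruct (Rle_dec 0 y) as [L | L].
    - apply Q1. rewrite Rminus_0_r, Rabs_right by apply Rle_ge, sqrt_pos.
      apply sqrt_lt_of_lt; auto. rewrite Rabs_right in Y1; lra.
    - rewrite <- B0. apply Q2. now rewrite Rminus_0_r. }
  assert (TG : tower (fun s => Rabs s < d * d) G).
  { intros n s Hs.
    assert (D1 : forall t, Rabs t < d * d -> t <> 0 -> is_derive (G n) t (G (S n) t)).
    { intros t Ht N. destruct (Rlt_dec 0 t) as [L | L].
      - apply (is_derive_ext_loc (fun s => k n (sqrt s))).
        + generalize (open_gt 0 t L). apply filter_imp. intros y Hy.
          unfold G. destruct (Rle_dec 0 y); auto; lra.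
        + unfold G at 1. destruct (Rle_dec 0 t) as [_ | ]; [ | lra].
          replace (k (S n) (sqrt t)) with (/ (2 * sqrt t) * (2 * sqrt t * k (S n) (sqrt t))).
          * apply (is_derive_comp (k n) sqrt).
            -- apply KD. rewrite Rabs_right by apply Rle_ge, sqrt_pos.
               apply sqrt_lt_of_lt; auto; try lra. rewrite Rabs_right in Ht; lra.
            -- auto_derive; auto. field. apply Rgt_not_eq, sqrt_lt_R0; auto.
          * field. apply Rgt_not_eq, sqrt_lt_R0; auto.
      - assert (L' : t < 0) by lra. apply (is_derive_ext_loc (B n)).
        + generalize (open_lt 0 t L'). apply filter_imp. intros y Hy.
          unfold G. destruct (Rle_dec 0 y); auto; lra.
        + unfold G at 1. destruct (Rle_dec 0 t) as [ | _]; [lra | ].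
          apply TB. nra. }
    (* At the junction the matching values of the two branches make every [G n] continuous, and the
       derivative there is the limit of the derivatives on both sides. *)
    destruct (Req_EM_T s 0) as [-> | N]; [ | now apply D1].
    apply is_derive_limit; auto.
    generalize (open_Rabs_lt (d * d) 0 Hs). apply filter_imp. auto. }
  exists (G 0%nat). split.
  - intros n. apply tower_CrR; auto. apply open_Rabs_lt.
  - intros x Hx. unfold G. destruct (Rle_dec 0 (x * x)) as [_ | N]; [ | nra].
    change (sqrt (x * x)) with (sqrt (Rsqr x)). rewrite sqrt_Rsqr_abs. change (k 0%nat) with f.
    unfold Rabs in *. destruct (Rcase_abs x); auto. symmetry. apply He.
    unfold Rabs. destruct (Rcase_abs x); lra.
Qed.

(** The odd part is divided by [x] with Hadamard's lemma; the quotient is even, so Whitney's theorem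
    applies to it as well as to the even part. *)
Lemma parity_decomposition d h : 0 < d <= 1 -> smooth d h ->
  exists a b, smooth (d * d) a /\ smooth (d * d) b /\
    forall x, Rabs x < d -> h x = a (x * x) + x * b (x * x).
Proof.
  intros Hd Hh.
  assert (Hm : smooth d (fun x => h (- x))).
  { apply (smooth_comp d d); auto; [intros; now rewrite Rabs_Ropp | apply smooth_opp, smooth_id]. }
  assert (S1 : smooth d (fun x => / 2 * (h x + h (- x)))).
  { apply smooth_mult; [apply smooth_const | now apply smooth_plus]. }
  assert (S2 : smooth d (fun x => / 2 * (h x - h (- x)))).
  { apply smooth_mult; [apply smooth_const | now apply smooth_minus]. }
  destruct (even_function_of_square d _ Hd S1) as (a & Ha & Ea).
  { intros x Hx. rewrite Ropp_involutive. ring. }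
  destruct (hadamard d _ (proj1 Hd) S2) as (q & Hq & Eq & _).
  destruct (even_function_of_square d q Hd Hq) as (b & Hb & Eb).
  { intros x Hx. destruct (Req_EM_T x 0) as [-> | N]; [now rewrite Ropp_0 | ].
    assert (E1 := Eq x Hx). assert (E2 := Eq (- x) ltac:(now rewrite Rabs_Ropp)). simpl in *.
    rewrite Ropp_involutive in E2. rewrite Ropp_0 in E1, E2.
    apply (Rmult_eq_reg_l x); auto. lra. }
  exists a, b. split; [auto | split; auto].
  intros x Hx. rewrite <- Ea, <- Eb by auto.
  specialize (Eq x Hx). simpl in Eq. rewrite Ropp_0 in Eq. lra.
Qed.

Lemma smooth_mod4_decomposition d h : 0 < d <= 1 -> smooth d h ->
  exists a0 a1 a2 a3, smooth (d ^ 4) a0 /\ smooth (d ^ 4) a1 /\ smooth (d ^ 4) a2 /\ smooth (d ^ 4) a3 /\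
    forall x, Rabs x < d ->
      h x = a0 (x ^ 4) + x * a1 (x ^ 4) + x ^ 2 * a2 (x ^ 4) + x ^ 3 * a3 (x ^ 4).
Proof.
  intros Hd Hh.
  destruct (parity_decomposition d h Hd Hh) as (a & b & Ha & Hb & E).
  assert (Hd2 : 0 < d * d <= 1) by nra.
  destruct (parity_decomposition (d * d) a Hd2 Ha) as (a0 & a2 & H0 & H2 & Ea).
  destruct (parity_decomposition (d * d) b Hd2 Hb) as (a1 & a3 & H1 & H3 & Eb).
  replace (d * d * (d * d)) with (d ^ 4) in * by ring.
  exists a0, a1, a2, a3. repeat (split; auto).
  intros x Hx.
  assert (L : Rabs (x * x) < d * d).
  { rewrite Rabs_mult. generalize (Rabs_pos x). intros. nra. }
  rewrite E, Ea, Eb by auto. replace (x * x * (x * x)) with (x ^ 4) by ring. ring.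
Qed.

(** * Smooth germs *)

Definition smooth_germ (f : R -> R) : Prop := exists d, 0 < d /\ smooth d f.

Lemma smooth_germ_const c : smooth_germ (fun _ => c).
Proof. exists 1. split; [lra | apply smooth_const]. Qed.

Lemma smooth_germ_id : smooth_germ (fun x => x).
Proof. exists 1. split; [lra | apply smooth_id]. Qed.

Lemma smooth_germ_common f g : smooth_germ f -> smooth_germ g ->
  exists d, 0 < d /\ smooth d f /\ smooth d g.
Proof.
  intros (d & Hd & Hf) (e & He & Hg). exists (Rmin d e).
  split; [now apply Rmin_pos | split].
  - apply (smooth_sub d); auto. apply Rmin_l.
  - apply (smooth_sub e); auto. apply Rmin_r.
Qed.

Lemma smooth_germ_plus f g : smooth_germ f -> smooth_germ g -> smooth_germ (fun x => f x + g x).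
Proof.
  intros Hf Hg. destruct (smooth_germ_common f g Hf Hg) as (d & Hd & H1 & H2).
  exists d. split; auto. now apply smooth_plus.
Qed.

Lemma smooth_germ_mult f g : smooth_germ f -> smooth_germ g -> smooth_germ (fun x => f x * g x).
Proof.
  intros Hf Hg. destruct (smooth_germ_common f g Hf Hg) as (d & Hd & H1 & H2).
  exists d. split; auto. now apply smooth_mult.
Qed.

Lemma smooth_germ_opp f : smooth_germ f -> smooth_germ (fun x => - f x).
Proof. intros (d & Hd & Hf). exists d. split; auto. now apply smooth_opp. Qed.

Lemma smooth_germ_minus f g : smooth_germ f -> smooth_germ g -> smooth_germ (fun x => f x - g x).
Proof. intros Hf Hg. apply smooth_germ_plus; auto. now apply smooth_germ_opp. Qed.

Lemma smooth_germ_pow f k : smooth_germ f -> smooth_germ (fun x => f x ^ k).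
Proof. intros (d & Hd & Hf). exists d. split; auto. now apply smooth_pow. Qed.

Lemma smooth_germ_continuous f : smooth_germ f -> continuous f 0.
Proof. intros (d & Hd & Hf). apply (smooth_continuous d); auto. now rewrite Rabs_R0. Qed.

Lemma smooth_germ_restrict f (P : R -> Prop) : smooth_germ f -> locally 0 P ->
  exists d, 0 < d /\ smooth d f /\ forall x, Rabs x < d -> P x.
Proof.
  intros (d & Hd & Hf) HP. apply locally_0 in HP. destruct HP as (e & He & HP).
  exists (Rmin d e). split; [now apply Rmin_pos | split].
  - apply (smooth_sub d); auto. apply Rmin_l.
  - intros x Hx. apply HP. eapply Rlt_le_trans; [exact Hx | apply Rmin_r].
Qed.

Lemma smooth_germ_near f (P : R -> Prop) : smooth_germ f -> open P -> P (f 0) ->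
  locally 0 (fun x => P (f x)).
Proof. intros Hf HP H0. apply (smooth_germ_continuous f Hf P). now apply HP. Qed.

Lemma smooth_germ_inv f : f 0 <> 0 -> smooth_germ f -> smooth_germ (fun x => / f x).
Proof.
  intros H0 Hf.
  destruct (smooth_germ_restrict f _ Hf (smooth_germ_near f _ Hf open_neq0 H0)) as (d & Hd & H1 & H2).
  exists d. split; auto. now apply smooth_inv.
Qed.

Lemma smooth_germ_div f g : g 0 <> 0 -> smooth_germ f -> smooth_germ g -> smooth_germ (fun x => f x / g x).
Proof. intros. apply smooth_germ_mult; auto. now apply smooth_germ_inv. Qed.

Lemma smooth_germ_sqrt f : 0 < f 0 -> smooth_germ f -> smooth_germ (fun x => sqrt (f x)).
Proof.
  intros H0 Hf.
  destruct (smooth_germ_restrict f _ Hf (smooth_germ_near f _ Hf (open_gt 0) H0)) as (d & Hd & H1 & H2).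
  exists d. split; auto. now apply smooth_sqrt.
Qed.

Lemma smooth_germ_comp f u : u 0 = 0 -> smooth_germ f -> smooth_germ u -> smooth_germ (fun x => f (u x)).
Proof.
  intros H0 (e & He & Hf) Hu.
  assert (L : locally 0 (fun x => Rabs (u x) < e)).
  { apply (smooth_germ_near u (fun z => Rabs z < e)); auto; [apply open_Rabs_lt | now rewrite H0, Rabs_R0]. }
  destruct (smooth_germ_restrict u _ Hu L) as (d & Hd & H1 & H2).
  exists d. split; auto. now apply (smooth_comp d e).
Qed.

Lemma smooth_germ_ext f g : locally 0 (fun x => f x = g x) -> smooth_germ f -> smooth_germ g.
Proof.
  intros L Hf. destruct (smooth_germ_restrict f _ Hf L) as (d & Hd & H1 & H2).
  exists d. split; auto. now apply (smooth_ext d f).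
Qed.

Ltac prove_smooth_germ := repeat first
  [ assumption | apply smooth_germ_const | apply smooth_germ_id | apply smooth_germ_minus
  | apply smooth_germ_plus | apply smooth_germ_mult | apply smooth_germ_opp | apply smooth_germ_pow ].

(* The quotient is redefined outside a neighbourhood of [0] so that the identity holds everywhere. *)
Lemma smooth_germ_hadamard f : smooth_germ f -> exists g, smooth_germ g /\
  (forall x, f x = f 0 + x * g x) /\ forall j, Derive_n g j 0 = Derive_n f (S j) 0 / INR (S j).
Proof.
  intros (d & Hd & Hf). destruct (hadamard d f Hd Hf) as (g & Hg & E & D).
  set (g' := fun x => if Rlt_dec (Rabs x) d then g x else (f x - f 0) / x).
  assert (L : locally 0 (fun x => g x = g' x)).
  { apply locally_0. exists d. split; auto. intros x Hx. unfold g'. now destruct (Rlt_dec (Rabs x) d). }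
  exists g'. split; [ | split].
  - apply (smooth_germ_ext g); auto. now exists d.
  - intros x. unfold g'. destruct (Rlt_dec (Rabs x) d); [now apply E | ].
    assert (x <> 0) by (intros ->; rewrite Rabs_R0 in n; lra). field; auto.
  - intros j. rewrite <- D. apply Derive_n_ext_loc. revert L. apply filter_imp. auto.
Qed.

Lemma smooth_germ_mod4 h : smooth_germ h ->
  exists e a0 a1 a2 a3, 0 < e /\ smooth e a0 /\ smooth e a1 /\ smooth e a2 /\ smooth e a3 /\
    locally 0 (fun x => h x = a0 (x ^ 4) + x * a1 (x ^ 4) + x ^ 2 * a2 (x ^ 4) + x ^ 3 * a3 (x ^ 4)).
Proof.
  intros (d & Hd & Hh).
  assert (H1 : 0 < Rmin d 1 <= 1) by (split; [apply Rmin_pos; lra | apply Rmin_r]).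
  destruct (smooth_mod4_decomposition (Rmin d 1) h H1) as (a0 & a1 & a2 & a3 & A0 & A1 & A2 & A3 & E).
  { apply (smooth_sub d); auto. apply Rmin_l. }
  exists (Rmin d 1 ^ 4), a0, a1, a2, a3. split; [apply pow_lt; lra | ].
  repeat (split; auto). apply locally_0. exists (Rmin d 1). split; [lra | auto].
Qed.

Lemma continuous_punctured_value (f : R -> R) (c : R) : continuous f 0 -> locally 0 (fun x => x <> 0 -> f x = c) -> f 0 = c.
Proof.
  intros Cf L. apply locally_0 in L. destruct L as (d & Hd & L).
  destruct (Req_EM_T (f 0) c) as [ | N]; auto. exfalso.
  assert (P : 0 < Rabs (f 0 - c)) by (apply Rabs_pos_lt; lra).
  destruct (proj1 (continuous_eps _ _) Cf _ P) as (e & He & H).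
  assert (Hm : 0 < Rmin d e) by now apply Rmin_pos.
  assert (Q : Rabs (Rmin d e / 2) = Rmin d e / 2) by (apply Rabs_right; lra).
  generalize (Rmin_l d e) (Rmin_r d e). intros.
  specialize (H (Rmin d e / 2)). rewrite Rminus_0_r, Q in H. specialize (H ltac:(lra)).
  rewrite L in H by (try rewrite Q; lra).
  rewrite Rabs_minus_sym in H. lra.
Qed.

(** * Reparametrization by a fourth root *)

Lemma A_equiv_ext_r g1 g2 g3 : A_equiv g1 g2 -> locally 0 (fun t => g2 t = g3 t) -> A_equiv g1 g3.
Proof.
  intros (psi & phi & Psi & H1 & H2 & H3) L. exists psi, phi, Psi. split; [auto | split; auto].
  apply locally_0. rewrite <- locally_0 in H3.
  generalize (filter_and _ _ H3 L). apply filter_imp. intros t [E1 E2]. congruence.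
Qed.

Lemma diffeo1_smooth_germ psi phi : diffeo1_germ Inf psi phi -> smooth_germ phi /\ phi 0 = 0.
Proof.
  intros H. destruct (diffeo1_sym _ _ _ H) as (Z & V & U & OV & OU & V0 & _ & _ & _ & _ & C & _).
  split; auto. specialize (OV 0 V0). apply locally_0 in OV. destruct OV as (d & Hd & HV).
  exists d. split; auto. intros n. apply (CrR_sub n V); auto.
Qed.

(** The new parameter is t U(t)^(1/4), whose fourth power is the first coordinate; s [rho] s is the
    inverse change of parameter. [Y] is arbitrary because the second coordinate is merely carried
    along. *)
Lemma reparametrize_fourth_power U : smooth_germ U -> U 0 = 1 ->
  exists rho, smooth_germ rho /\ rho 0 = 1 /\ locally 0 (fun s => rho s ^ 4 * U (s * rho s) = 1) /\
    forall Y : R -> R, A_equiv (fun t => (t ^ 4 * U t, Y t)) (fun s => (s ^ 4, Y (s * rho s))).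
Proof.
  intros HU U0.
  set (q := fun t => sqrt (sqrt (U t))).
  assert (Q0 : q 0 = 1) by (unfold q; now rewrite U0, !sqrt_1).
  assert (Hq : smooth_germ q).
  { apply smooth_germ_sqrt; [rewrite U0, sqrt_1; lra | ].
    apply smooth_germ_sqrt; auto. rewrite U0; lra. }
  assert (LU : locally 0 (fun t => 0 < U t)).
  { apply (smooth_germ_near U (fun z => 0 < z)); auto; [apply open_gt | lra]. }
  assert (Hs : smooth_germ (fun t => t * q t)) by prove_smooth_germ.
  destruct Hs as (d & Hd & Hs).
  assert (D0 : is_derive (fun t => t * q t) 0 (q 0)).
  { apply is_derive_slope; [now apply smooth_germ_continuous | ].
    apply filter_forall. intros t. ring. }
  destruct (inverse_germ Inf (fun x => Rabs x < d) (fun t => t * q t)) as [phi Hphi]; auto.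
  - discriminate.
  - apply open_Rabs_lt.
  - now rewrite Rabs_R0.
  - ring.
  - replace (Derive _ _) with (q 0); [lra | symmetry; exact (is_derive_unique _ _ _ D0)].
  - destruct (diffeo1_smooth_germ _ _ Hphi) as [Sphi Z].
    destruct (smooth_germ_hadamard phi Sphi) as (rho & Srho & E & _).
    assert (E' : forall x, phi x = x * rho x) by (intros x; rewrite E, Z; ring).
    assert (Inv : locally 0 (fun s => phi s * q (phi s) = s)).
    { destruct (diffeo1_sym _ _ _ Hphi) as (_ & V & V' & OV & _ & V0 & _ & _ & J & _ & _ & _).
      generalize (OV 0 V0). apply filter_imp. exact J. }
    assert (Sq : smooth_germ (fun s => rho s * q (s * rho s))).
    { apply smooth_germ_mult; auto. apply (smooth_germ_comp q (fun s => s * rho s)); auto; [ring | prove_smooth_germ]. }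
    assert (P : locally 0 (fun s => s <> 0 -> rho s * q (s * rho s) = 1)).
    { revert Inv. apply filter_imp. intros s I N. rewrite E' in I.
      apply (Rmult_eq_reg_l s); auto. lra. }
    (* Cancelling [s] loses the origin, where the value of [rho] is recovered by continuity. *)
    assert (P0 := continuous_punctured_value _ 1 (smooth_germ_continuous _ Sq) P). simpl in P0.
    rewrite Rmult_0_l, Q0, Rmult_1_r in P0.
    assert (LU' : locally 0 (fun s => 0 < U (s * rho s))).
    { apply (smooth_germ_near (fun s => U (s * rho s)) (fun z => 0 < z)).
      - apply (smooth_germ_comp U (fun s => s * rho s)); auto; [ring | prove_smooth_germ].
      - apply open_gt.
      - rewrite Rmult_0_l. lra. }
    assert (R4 : locally 0 (fun s => rho s ^ 4 * U (s * rho s) = 1)).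
    { generalize (filter_and _ _ P LU'). apply filter_imp. intros s [Ps Us].
      destruct (Req_EM_T s 0) as [-> | N]; [rewrite Rmult_0_l, P0, U0; ring | ].
      specialize (Ps N).
      assert (E4 : U (s * rho s) = q (s * rho s) ^ 4).
      { unfold q. replace (sqrt (sqrt (U (s * rho s))) ^ 4) with ((sqrt (sqrt (U (s * rho s))) ^ 2) ^ 2) by ring.
        rewrite pow2_sqrt by apply sqrt_pos. rewrite pow2_sqrt; lra. }
      rewrite E4, <- Rpow_mult_distr, Ps. ring. }
    exists rho. split; [auto | split; [auto | split; [auto | ]]].
    intros Y. apply (Cr_equiv_source Inf _ _ _ phi Hphi).
    revert R4. apply filter_imp. intros s R4s. rewrite E'. f_equal.
    rewrite Rpow_mult_distr, Rmult_assoc, R4s. ring.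
Qed.

(** The equation reads 1 - rho^4 = s^m rho^(m+4) k(s rho), and 1 - rho^4 = (1 - rho)(1 + rho)(1 +
    rho^2). The last two factors have product 4 at 0, whence [k 0 / 4]. *)
Lemma fourth_root_expansion m U k rho : smooth_germ k -> smooth_germ rho -> rho 0 = 1 ->
  (forall t, U t = 1 + t ^ m * k t) -> locally 0 (fun s => rho s ^ 4 * U (s * rho s) = 1) ->
  exists kappa, smooth_germ kappa /\ kappa 0 = k 0 / 4 /\ locally 0 (fun s => rho s = 1 - s ^ m * kappa s).
Proof.
  intros Hk Hr R0 EU R4.
  exists (fun s => rho s ^ (m + 4) * k (s * rho s) / ((rho s + 1) * (rho s ^ 2 + 1))).
  split; [ | split].
  - apply smooth_germ_div; [rewrite R0; lra | | prove_smooth_germ].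
    apply smooth_germ_mult; [prove_smooth_germ | ].
    apply (smooth_germ_comp k (fun s => s * rho s)); auto; [ring | prove_smooth_germ].
  - rewrite Rmult_0_l, R0, pow1. field.
  - assert (P : locally 0 (fun s => 0 < rho s)).
    { apply (smooth_germ_near rho (fun z => 0 < z)); auto; [apply open_gt | lra]. }
    generalize (filter_and _ _ R4 P). apply filter_imp. intros s [H1 H2].
    rewrite EU, Rpow_mult_distr in H1.
    assert (N1 : rho s + 1 <> 0) by lra.
    assert (N2 : rho s ^ 2 + 1 <> 0) by (generalize (pow2_ge_0 (rho s)); lra).
    assert (H3 : s ^ m * (rho s ^ (m + 4) * k (s * rho s)) = 1 - rho s ^ 4) by (rewrite pow_add; lra).
    replace (s ^ m * (_ / _)) with
      (s ^ m * (rho s ^ (m + 4) * k (s * rho s)) / ((rho s + 1) * (rho s ^ 2 + 1))) by (field; auto).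
    rewrite H3. field; auto.
Qed.

(** * Reduction to the normal form *)

Lemma CrR2_pow n U f k : open U -> CrR2 n U f -> CrR2 n U (fun p => f p ^ k).
Proof.
  intros HU Hf. induction k; simpl; [now apply CrR2_const | now apply CrR2_mult].
Qed.

Lemma CrR2_minus n U f g : open U -> CrR2 n U f -> CrR2 n U g -> CrR2 n U (fun p => f p - g p).
Proof.
  intros HU Hf Hg. apply (CrR2_ext n U (fun p => f p + (-1) * g p)); auto.
  - intros; ring.
  - apply CrR2_plus; auto. apply CrR2_mult; auto. now apply CrR2_const.
Qed.

Lemma CrR2_div n U f g : open U -> (forall p, U p -> g p <> 0) ->
  CrR2 n U f -> CrR2 n U g -> CrR2 n U (fun p => f p / g p).
Proof.
  intros HU H Hf Hg. apply CrR2_mult; auto.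
  apply (CrR2_comp1 n U (fun x => x <> 0) Rinv g); auto; [apply open_neq0 | apply CrR_inv].
Qed.

Ltac prove_CrR2 := repeat first
  [ assumption | apply open_true | apply CrR2_fst | apply CrR2_snd | apply CrR2_const | apply CrR2_minus
  | apply CrR2_plus | apply CrR2_div | apply CrR2_mult | apply CrR2_pow ].

Lemma affine_diffeo r (a b c d e f : R) p : a * d - b * c <> 0 ->
  diffeo2_germ r (fun q => (a * (fst q - e) + b * (snd q - f), c * (fst q - e) + d * (snd q - f))) p.
Proof.
  intros N.
  apply (diffeo2_global r _ (fun q => (e + (d * fst q - b * snd q) / (a * d - b * c),
    f + (a * snd q - c * fst q) / (a * d - b * c)))).
  - intros [x y]; simpl. f_equal; field; auto.
  - intros [x y]; simpl. f_equal; field; auto.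
  - intros n. simpl. split; prove_CrR2.
  - intros n. simpl. split; prove_CrR2; auto.
Qed.

Lemma shear_diffeo r (p q : R) x0 :
  diffeo2_germ r (fun z => (fst z + p * snd z + q * snd z ^ 2, snd z)) x0.
Proof.
  apply (diffeo2_global r _ (fun z => (fst z - p * snd z - q * snd z ^ 2, snd z))).
  - intros [x y]; simpl. f_equal; ring.
  - intros [x y]; simpl. f_equal; ring.
  - intros n. simpl. split; prove_CrR2.
  - intros n. simpl. split; prove_CrR2.
Qed.

(** The shear x + p y + q y^2 turns the first coordinate into t^4 (1 + p t w + q t^6 w^2), and a
    reparametrization restores it to s^4. The expansion of [rho] shows the effect on the second
    coordinate. *)
Lemma shear_reparametrize w p q k m : smooth_germ w -> w 0 = 1 -> smooth_germ k ->
  (forall t, p * t * w t + q * t ^ 6 * w t ^ 2 = t ^ S m * k t) ->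
  exists rho kappa, smooth_germ rho /\ rho 0 = 1 /\ smooth_germ kappa /\ kappa 0 = k 0 / 4 /\
    locally 0 (fun s => rho s = 1 - s ^ S m * kappa s) /\
    A_equiv (fun t => (t ^ 4, t ^ 5 * w t)) (fun s => (s ^ 4, s ^ 5 * (rho s ^ 5 * w (s * rho s)))).
Proof.
  intros Hw w0 Hk Ek.
  set (U := fun t => 1 + t ^ S m * k t).
  destruct (reparametrize_fourth_power U) as (rho & Hrho & r0 & R4 & Equ).
  { unfold U. prove_smooth_germ. }
  { unfold U. rewrite pow_i by lia. ring. }
  destruct (fourth_root_expansion (S m) U k rho) as (kappa & Hka & k0 & Ekap); auto.
  exists rho, kappa. repeat (split; auto).
  apply (Cr_equiv_trans Inf _ (fun t => (t ^ 4 * U t, t ^ 5 * w t))).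
  - apply (Cr_equiv_target Inf _ _ _ (shear_diffeo Inf p q _)). apply filter_forall. intros t.
    simpl fst; simpl snd. f_equal. unfold U. rewrite <- Ek. ring.
  - apply (A_equiv_ext_r _ _ _ (Equ (fun t => t ^ 5 * w t))). apply filter_forall. intros s.
    f_equal. ring.
Qed.

Lemma curve_smooth_germ a b g : a < 0 < b -> smooth_curve_on a b g ->
  smooth_germ (fun t => fst (g t)) /\ smooth_germ (fun t => snd (g t)).
Proof.
  intros Hab H.
  assert (D : 0 < Rmin (- a) b) by (apply Rmin_pos; lra).
  split; exists (Rmin (- a) b); split; auto; intros n; destruct (H n);
    (apply (CrR_sub n (fun t => a < t < b)); [ | assumption]);
    intros x Hx; apply Rabs_def2 in Hx; generalize (Rmin_l (- a) b) (Rmin_r (- a) b); lra.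
Qed.

(** Hadamard's lemma four times; the denominator is (4 + j)! / j!. *)
Lemma smooth_germ_taylor4 f : smooth_germ f -> exists g, smooth_germ g /\
  (forall x, f x = f 0 + Derive_n f 1 0 * x + Derive_n f 2 0 / 2 * x ^ 2 + Derive_n f 3 0 / 6 * x ^ 3
    + x ^ 4 * g x) /\
  forall j, Derive_n g j 0 = Derive_n f (4 + j) 0 / (INR (1 + j) * INR (2 + j) * INR (3 + j) * INR (4 + j)).
Proof.
  intros Hf.
  destruct (smooth_germ_hadamard f Hf) as (g1 & H1 & E1 & D1).
  destruct (smooth_germ_hadamard g1 H1) as (g2 & H2 & E2 & D2).
  destruct (smooth_germ_hadamard g2 H2) as (g3 & H3 & E3 & D3).
  destruct (smooth_germ_hadamard g3 H3) as (g4 & H4 & E4 & D4).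
  exists g4. split; [auto | split].
  - intros x.
    assert (V1 := D1 0%nat). assert (V2 := D2 0%nat). assert (V3 := D3 0%nat).
    rewrite D1 in V2. rewrite D2, D1 in V3.
    change (Derive_n g1 0 0) with (g1 0) in V1. change (Derive_n g2 0 0) with (g2 0) in V2.
    change (Derive_n g3 0 0) with (g3 0) in V3.
    rewrite E1, E2, E3, E4, V1, V2, V3. simpl INR. field.
  - intros j. rewrite D4, D3, D2, D1. cbn [Nat.add]. field.
    repeat split; apply not_0_INR; lia.
Qed.

Lemma cusp45_prenormal a b g : a < 0 < b -> smooth_curve_on a b g -> cusp45_cond g ->
  exists w, smooth_germ w /\ w 0 = 1 /\ A_equiv g (fun t => (t ^ 4, t ^ 5 * w t)).
Proof.
  intros Hab Hg (C1 & C2 & C3 & CA).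
  destruct (curve_smooth_germ a b g Hab Hg) as [Sx Sy].
  assert (X1 := f_equal fst C1). assert (X2 := f_equal fst C2). assert (X3 := f_equal fst C3).
  assert (Y1 := f_equal snd C1). assert (Y2 := f_equal snd C2). assert (Y3 := f_equal snd C3).
  unfold dgam in *. cbn [fst snd] in *.
  destruct (smooth_germ_taylor4 _ Sx) as (xi & Hxi & Ex & Dx).
  destruct (smooth_germ_taylor4 _ Sy) as (eta & Heta & Ey & Dy).
  rewrite X1, X2, X3 in Ex. rewrite Y1, Y2, Y3 in Ey.
  assert (x4 := Dx 0%nat). assert (x5 := Dx 1%nat). assert (y4 := Dy 0%nat). assert (y5 := Dy 1%nat).
  cbn [Nat.add] in x4, x5, y4, y5. simpl INR in x4, x5, y4, y5.
  change (Derive_n xi 0 0) with (xi 0) in x4. change (Derive_n eta 0 0) with (eta 0) in y4.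
  unfold cA, det2, dgam in CA. cbn [fst snd] in CA.
  set (p := xi 0) in *. set (r := eta 0) in *.
  set (p' := Derive_n xi 1 0) in *. set (r' := Derive_n eta 1 0) in *.
  set (De := p * r' - p' * r).
  assert (HD : De <> 0).
  { unfold De. rewrite x4, x5, y4, y5. intros K. apply CA. field_simplify in K. lra. }
  (* [U] and [Z] come from the inverse of the matrix with columns (p, r) and (p', r'), the Taylor
     coefficients of orders 4 and 5. Its determinant [De] equals - A / 2880. *)
  set (U := fun t => r' / De * xi t + - p' / De * eta t).
  set (Z := fun t => - r / De * xi t + p / De * eta t).
  assert (SU : smooth_germ U) by (unfold U; prove_smooth_germ).
  assert (SZ : smooth_germ Z) by (unfold Z; prove_smooth_germ).
  destruct (smooth_germ_hadamard Z SZ) as (w & Hw & Ew & Dw).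
  assert (U0 : U 0 = 1) by (unfold U; fold p r; unfold De; field; auto).
  assert (Z0 : Z 0 = 0) by (unfold Z; fold p r; field; auto).
  assert (w0 : w 0 = 1).
  { change (w 0) with (Derive_n w 0 0). rewrite Dw. simpl. rewrite Rdiv_1_r.
    assert (DX : is_derive xi 0 p').
    { destruct Hxi as (d & Hd & H). apply Derive_correct, (smooth_ex_derive d); auto. now rewrite Rabs_R0. }
    assert (DY : is_derive eta 0 r').
    { destruct Heta as (d & Hd & H). apply Derive_correct, (smooth_ex_derive d); auto. now rewrite Rabs_R0. }
    assert (DZ : is_derive Z 0 (- r / De * p' + p / De * r')).
    { apply (is_derive_plus (fun t => - r / De * xi t) (fun t => p / De * eta t));
        now apply is_derive_scal. }
    change (Derive Z 0 = 1). rewrite (is_derive_unique _ _ _ DZ). unfold De. field. auto. }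
  destruct (reparametrize_fourth_power U SU U0) as (rho & Hrho & r0 & _ & Equ).
  exists (fun s => rho s ^ 5 * w (s * rho s)). split; [ | split].
  - apply smooth_germ_mult; [prove_smooth_germ | ].
    apply (smooth_germ_comp w (fun s => s * rho s)); auto; [ring | prove_smooth_germ].
  - rewrite Rmult_0_l, r0, w0. ring.
  - apply (Cr_equiv_trans Inf _ (fun t => (t ^ 4 * U t, t ^ 5 * w t))).
    + assert (N : r' / De * (p / De) - - p' / De * (- r / De) <> 0).
      { replace (r' / De * (p / De) - - p' / De * (- r / De)) with (/ De) by (unfold De; field; auto).
        now apply Rinv_neq_0_compat. }
      apply (Cr_equiv_target Inf _ _ _ (affine_diffeo Inf _ _ _ _ (fst (g 0)) (snd (g 0)) _ N)).
      apply filter_forall. intros t. rewrite (Ex t), (Ey t). f_equal; [unfold U; field; auto | ].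
      transitivity (t ^ 4 * Z t); [unfold Z; field; auto | ]. rewrite Ew, Z0. ring.
    + apply (A_equiv_ext_r _ _ _ (Equ (fun t => t ^ 5 * w t))). apply filter_forall. intros s.
      f_equal. ring.
Qed.

Lemma kill_t6 w : smooth_germ w -> w 0 = 1 ->
  exists H, smooth_germ H /\ A_equiv (fun t => (t ^ 4, t ^ 5 * w t)) (fun t => (t ^ 4, t ^ 5 * (1 + t ^ 2 * H t))).
Proof.
  intros Hw w0.
  destruct (smooth_germ_hadamard w Hw) as (w1 & Hw1 & Ew & _).
  (* Here rho = 1 - (p / 4) s + ..., so s^5 rho^5 contributes -(5 / 4) p s^6, which has to cancel
     the coefficient [w1 0]. *)
  set (p := 4 / 5 * w1 0).
  destruct (shear_reparametrize w p 0 (fun t => p * w t) 0) as (rho & kap & Hr & r0 & Hk & k0 & Er & Equ); auto.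
  { prove_smooth_germ. }
  { intros t. ring. }
  (* Chosen so that rho^5 w(s rho) = 1 + s M(s) near 0; the value of [p] amounts to M(0) = 0. *)
  set (M := fun s => rho s ^ 6 * w1 (s * rho s)
    - kap s * (1 + rho s + rho s ^ 2 + rho s ^ 3 + rho s ^ 4)).
  assert (SM : smooth_germ M).
  { apply smooth_germ_minus; [ | prove_smooth_germ]. apply smooth_germ_mult; [prove_smooth_germ | ].
    apply (smooth_germ_comp w1 (fun s => s * rho s)); auto; [ring | prove_smooth_germ]. }
  destruct (smooth_germ_hadamard M SM) as (H & HH & EM & _).
  assert (M0 : M 0 = 0) by (unfold M; rewrite k0, r0, Rmult_0_l, w0; unfold p; field).
  exists H. split; auto. apply (A_equiv_ext_r _ _ _ Equ). revert Er. apply filter_imp. intros s Es.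
  f_equal. f_equal.
  replace (s ^ 2 * H s) with (s * M s) by (rewrite EM, M0; ring).
  rewrite (Ew (s * rho s)), w0, pow_1 in *. unfold M.
  assert (K : s * kap s = 1 - rho s) by lra.
  transitivity (1 + s * rho s ^ 6 * w1 (s * rho s)
    - s * kap s * (1 + rho s + rho s ^ 2 + rho s ^ 3 + rho s ^ 4)); [rewrite K | ]; ring.
Qed.

(** The cofactor of 1 - x in 1 - x^k. It expands the powers of rho = 1 - s^6 kappa exactly, with a
    smooth factor whose value at 0 is [k]. *)
Fixpoint geometric_sum (k : nat) (x : R) : R :=
  match k with O => 0 | S i => geometric_sum i x + x ^ i end.

Lemma geometric_sum_pow k x : x ^ k = 1 - (1 - x) * geometric_sum k x.
Proof. induction k; simpl; [ring | lra]. Qed.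

Lemma smooth_germ_geometric_sum k f : smooth_germ f -> smooth_germ (fun x => geometric_sum k (f x)).
Proof. intros Hf. induction k; simpl; prove_smooth_germ. Qed.

Lemma geometric_sum_1 k : geometric_sum k 1 = INR k.
Proof. induction k; [reflexivity | ]. simpl geometric_sum. rewrite IHk, pow1, S_INR. reflexivity. Qed.

(* The order 11 is not in the semigroup generated by 4 and 5, so the coefficient of [t ^ 11] has to be
   adjusted by a change of the first coordinate; the value [c * e4] is the one produced by
   [e4 * x * y] along [(t ^ 4, t ^ 5 + c * t ^ 7)]. *)
Lemma adjust_t11 H : smooth_germ H ->
  exists c e3 e4 e5 h, smooth_germ h /\
    A_equiv (fun t => (t ^ 4, t ^ 5 * (1 + t ^ 2 * H t)))
      (fun t => (t ^ 4, t ^ 5 + c * t ^ 7 + e3 * t ^ 8 + e4 * t ^ 9 + e5 * t ^ 10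
        + c * e4 * t ^ 11 + t ^ 12 * h t)).
Proof.
  intros HH.
  destruct (smooth_germ_hadamard H HH) as (H1 & S1 & E1 & _).
  destruct (smooth_germ_hadamard H1 S1) as (H2 & S2 & E2 & _).
  destruct (smooth_germ_hadamard H2 S2) as (H3 & S3 & E3 & _).
  destruct (smooth_germ_hadamard H3 S3) as (H4 & S4 & E4 & _).
  destruct (smooth_germ_hadamard H4 S4) as (h0 & S0 & E5 & _).
  set (c := H 0) in *. set (e3 := H1 0) in *. set (e4 := H2 0) in *. set (e5 := H3 0) in *.
  set (e6 := H4 0) in *.
  assert (EH : forall t, H t = c + e3 * t + e4 * t ^ 2 + e5 * t ^ 3 + e6 * t ^ 4 + t ^ 5 * h0 t).
  { intros t. rewrite E1, E2, E3, E4, E5. ring. }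
  set (w := fun t => 1 + t ^ 2 * H t).
  assert (Sw : smooth_germ w) by (unfold w; prove_smooth_germ).
  assert (w0 : w 0 = 1) by (unfold w; ring).
  (* As y^2 has order 10 = 4 + 6, here rho = 1 - (q / 4) s^6 + ..., and s^5 rho^5 contributes -(5 /
     4) q s^11. This moves the coefficient [e6] to [c * e4]. *)
  set (q := 4 / 5 * (e6 - c * e4)).
  destruct (shear_reparametrize w 0 q (fun t => q * w t ^ 2) 5) as (rho & kap & Hr & r0 & Hk & k0 & Er & Equ); auto.
  { prove_smooth_germ. }
  { intros t. ring. }
  set (P := fun k s => geometric_sum k (rho s)).
  assert (SP : forall k, smooth_germ (P k)) by (intros k; now apply smooth_germ_geometric_sum).
  assert (SN : smooth_germ (fun s => e6 - kap s * P 5%nat s)) by (prove_smooth_germ; apply SP).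
  destruct (smooth_germ_hadamard _ SN) as (N & HN & EN & _).
  assert (N0 : e6 - kap 0 * P 5%nat 0 = c * e4).
  { unfold P. rewrite r0, geometric_sum_1, k0, w0. unfold q. simpl INR. field. }
  exists c, e3, e4, e5, (fun s => N s + (rho s ^ 12 * h0 (s * rho s)
    - s * (c * kap s * P 7%nat s) - s ^ 2 * (e3 * kap s * P 8%nat s) - s ^ 3 * (e4 * kap s * P 9%nat s)
    - s ^ 4 * (e5 * kap s * P 10%nat s) - s ^ 5 * (e6 * kap s * P 11%nat s))).
  split.
  - apply smooth_germ_plus; auto. repeat apply smooth_germ_minus; [ | prove_smooth_germ; apply SP ..].
    apply smooth_germ_mult; [prove_smooth_germ | ].
    apply (smooth_germ_comp h0 (fun s => s * rho s)); auto; [ring | prove_smooth_germ].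
  - apply (A_equiv_ext_r _ _ _ Equ). revert Er. apply filter_imp. intros s Es.
    f_equal.
    assert (R : forall k, rho s ^ k = 1 - s ^ 6 * kap s * P k s).
    { intros k. rewrite geometric_sum_pow. unfold P. rewrite Es at 1. ring. }
    specialize (EN s). cbv beta in EN. rewrite N0 in EN.
    unfold w. rewrite EH.
    transitivity (s ^ 5 * (rho s ^ 5 + s ^ 2 * (c * rho s ^ 7 + e3 * s * rho s ^ 8 + e4 * s ^ 2 * rho s ^ 9
      + e5 * s ^ 3 * rho s ^ 10 + e6 * s ^ 4 * rho s ^ 11 + s ^ 5 * (rho s ^ 12 * h0 (s * rho s))))); [ring | ].
    rewrite (R 5%nat), (R 7%nat), (R 8%nat), (R 9%nat), (R 10%nat), (R 11%nat).
    transitivity (s ^ 5 + c * s ^ 7 + e3 * s ^ 8 + e4 * s ^ 9 + e5 * s ^ 10 + (e6 - kap s * P 5%nat s) * s ^ 11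
      + s ^ 12 * (rho s ^ 12 * h0 (s * rho s)
    - s * (c * kap s * P 7%nat s) - s ^ 2 * (e3 * kap s * P 8%nat s) - s ^ 3 * (e4 * kap s * P 9%nat s)
    - s ^ 4 * (e5 * kap s * P 10%nat s) - s ^ 5 * (e6 * kap s * P 11%nat s))); [ring | ].
    rewrite EN. ring.
Qed.

(* Along [y = t ^ 5 + c * t ^ 7], [x = t ^ 4], the monomials [x ^ 3], [x ^ 2 * y], [x * y ^ 2], [y ^ 3] span
   [t ^ 12 * C^oo(t)] over the functions of [x]: the matrix expressing them in terms of
   [t ^ 12], ..., [t ^ 15] is invertible near [x = 0]. *)
Lemma finite_determinacy c e3 e4 e5 h : smooth_germ h ->
  A_equiv (fun t => (t ^ 4, t ^ 5 + c * t ^ 7))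
    (fun t => (t ^ 4, t ^ 5 + c * t ^ 7 + e3 * t ^ 8 + e4 * t ^ 9 + e5 * t ^ 10
        + c * e4 * t ^ 11 + t ^ 12 * h t)).
Proof.
  intros Hh.
  (* The term e5 y^2 supplies e5 t^10 but also e5 (2 c t^12 + c^2 t^14), which is removed from the
     remainder beforehand. *)
  assert (Sh' : smooth_germ (fun t => h t - e5 * (2 * c + c ^ 2 * t ^ 2))) by prove_smooth_germ.
  destruct (smooth_germ_mod4 _ Sh') as (e & a0 & a1 & a2 & a3 & He & A0 & A1 & A2 & A3 & E).
  set (W := fun p : R * R => Rabs (fst p) < e /\ (1 - c ^ 4 * fst p ^ 2 <> 0 /\ 1 + c ^ 2 * fst p <> 0)).
  assert (OW : open W).
  { apply open_and; [apply (open_fst (fun x => Rabs x < e)), open_Rabs_lt | apply open_and].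
    - apply (open_comp (fun p : R * R => 1 - c ^ 4 * fst p ^ 2) (fun z => z <> 0)); [ | apply open_neq0].
      intros p _. apply (CrR2_continuous 0 (fun _ => True)); auto. prove_CrR2.
    - apply (open_comp (fun p : R * R => 1 + c ^ 2 * fst p) (fun z => z <> 0)); [ | apply open_neq0].
      intros p _. apply (CrR2_continuous 0 (fun _ => True)); auto. prove_CrR2. }
  assert (W0 : W (0, 0)).
  { split; [simpl; now rewrite Rabs_R0 | simpl; split; lra]. }
  (* The three quotients equal t^13, t^14, t^15 on the curve. Indeed x^2 y = t^13 + c t^15 and y^3 =
     (3 c x + c^3 x^2) t^13 + (1 + 3 c^2 x) t^15 form a system of determinant 1 - c^4 x^2, and x y^2
     = (1 + c^2 x) t^14 + 2 c x^4. *)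
  set (F := fun p : R * R => snd p + e3 * fst p ^ 2 + e4 * (fst p * snd p) + e5 * snd p ^ 2
    + a0 (fst p) * fst p ^ 3
    + a1 (fst p) * (((1 + 3 * c ^ 2 * fst p) * fst p ^ 2 * snd p - c * snd p ^ 3) / (1 - c ^ 4 * fst p ^ 2))
    + a2 (fst p) * ((fst p * snd p ^ 2 - 2 * c * fst p ^ 4) / (1 + c ^ 2 * fst p))
    + a3 (fst p) * ((snd p ^ 3 - (3 * c * fst p + c ^ 3 * fst p ^ 2) * fst p ^ 2 * snd p)
        / (1 - c ^ 4 * fst p ^ 2))).
  assert (SF : forall n, CrR2 n W F).
  { intros n.
    assert (L : forall a, smooth e a -> CrR2 n W (fun p => a (fst p))).
    { intros a Ha. apply (CrR2_sub n (fun p => Rabs (fst p) < e)); [intros p [Hp _]; exact Hp | ].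
      apply (CrR2_lift_fst n (fun x => Rabs x < e) a); [apply open_Rabs_lt | apply Ha]. }
    assert (L0 := L a0 A0). assert (L1 := L a1 A1). assert (L2 := L a2 A2). assert (L3 := L a3 A3).
    unfold F. prove_CrR2; intros p Hp; apply Hp. }
  assert (D2 : d2 F (0, 0) = 1).
  { unfold d2. simpl fst; simpl snd.
    rewrite (Derive_ext _ (fun s => s + e5 * s ^ 2 + (a3 0 - c * a1 0) * s ^ 3)).
    - apply is_derive_unique. auto_derive; auto. ring.
    - intros s. unfold F. simpl fst; simpl snd. field. }
  apply (Cr_equiv_target Inf _ _ (fun p => (fst p, F p))).
  - replace (0 ^ 4, 0 ^ 5 + c * 0 ^ 7) with (0, 0) by (f_equal; ring).
    apply (fibered_diffeo Inf W F); auto; [discriminate | rewrite D2; lra].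
  - assert (LW : locally 0 (fun t : R => W (t ^ 4, t ^ 5))).
    { assert (C : continuous (fun t : R => (t ^ 4, t ^ 5)) 0).
      { apply continuous_pair; apply ex_derive_continuous_R; cbn [fst snd]; auto_derive; auto. }
      apply (C W). replace (0 ^ 4, 0 ^ 5) with (0, 0) by (f_equal; ring). now apply OW. }
    generalize (filter_and _ _ E LW). apply filter_imp. intros t [Et (_ & N1 & N2)].
    simpl fst in *. f_equal. unfold F. cbn [fst snd].
    replace (h t) with (e5 * (2 * c + c ^ 2 * t ^ 2) + (a0 (t ^ 4) + t * a1 (t ^ 4) + t ^ 2 * a2 (t ^ 4) + t ^ 3 * a3 (t ^ 4)))
      by (rewrite <- Et; ring).
    generalize (a0 (t ^ 4)) (a1 (t ^ 4)) (a2 (t ^ 4)) (a3 (t ^ 4)). intros b0 b1 b2 b3. clear - N1 N2. cbn [fst] in N1, N2.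
    assert (Q : forall u v d, d <> 0 -> u = v * d -> u / d = v) by (intros u v d Hd ->; field; auto).
    assert (M1 : ((1 + 3 * c ^ 2 * t ^ 4) * (t ^ 4) ^ 2 * (t ^ 5 + c * t ^ 7) - c * (t ^ 5 + c * t ^ 7) ^ 3)
      / (1 - c ^ 4 * (t ^ 4) ^ 2) = t ^ 13) by (apply Q; [exact N1 | ring]).
    assert (M2 : (t ^ 4 * (t ^ 5 + c * t ^ 7) ^ 2 - 2 * c * (t ^ 4) ^ 4) / (1 + c ^ 2 * t ^ 4) = t ^ 14)
      by (apply Q; [exact N2 | ring]).
    assert (M3 : ((t ^ 5 + c * t ^ 7) ^ 3 - (3 * c * t ^ 4 + c ^ 3 * (t ^ 4) ^ 2) * (t ^ 4) ^ 2 * (t ^ 5 + c * t ^ 7))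
      / (1 - c ^ 4 * (t ^ 4) ^ 2) = t ^ 15) by (apply Q; [exact N1 | ring]).
    rewrite M1, M2, M3. ring.
Qed.

Lemma polynomial_curve_continuous c : continuous (fun t : R => (t ^ 4, t ^ 5 + c * t ^ 7)) 0.
Proof. apply continuous_pair; apply ex_derive_continuous_R; cbn [fst snd]; auto_derive; auto. Qed.

Lemma cusp45_normal_form a b g : a < 0 < b -> smooth_curve_on a b g -> cusp45_cond g ->
  exists c, A_equiv g (fun t => (t ^ 4, t ^ 5 + c * t ^ 7)).
Proof.
  intros Hab Hg HC.
  destruct (cusp45_prenormal a b g Hab Hg HC) as (w & Hw & w0 & Q1).
  destruct (kill_t6 w Hw w0) as (H & HH & Q2).
  destruct (adjust_t11 H HH) as (c & e3 & e4 & e5 & h & Sh & Q3).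
  exists c. apply (Cr_equiv_trans Inf _ _ _ Q1). apply (Cr_equiv_trans Inf _ _ _ Q2).
  apply (Cr_equiv_trans Inf _ _ _ Q3). apply Cr_equiv_sym; [apply polynomial_curve_continuous | ].
  now apply finite_determinacy.
Qed.

(** Weighted homogeneity: the weights of t^5 and t^7 differ by 2, so scaling divides [c] by a square
    and preserves its sign. *)
Lemma scale_normal_form c l : 0 < l ->
  A_equiv (fun t => (t ^ 4, t ^ 5 + c * t ^ 7)) (fun t => (t ^ 4, t ^ 5 + c / l ^ 2 * t ^ 7)).
Proof.
  intros Hl.
  exists (fun t => l * t), (fun t => / l * t),
    (fun q => (l ^ 4 * (fst q - 0) + 0 * (snd q - 0), 0 * (fst q - 0) + l ^ 5 * (snd q - 0))).
  split; [ | split].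
  - split; [ring | ]. exists (fun _ => True), (fun _ => True).
    repeat (split; auto using open_true); try (intros; field; lra).
    + apply Cr1_iff. intros n _. apply CrR_mult; [apply open_true | apply CrR_const | apply CrR_id].
    + apply Cr1_iff. intros n _. apply CrR_mult; [apply open_true | apply CrR_const | apply CrR_id].
  - apply affine_diffeo. apply Rgt_not_eq.
    assert (0 < l ^ 4) by now apply pow_lt. assert (0 < l ^ 5) by now apply pow_lt. nra.
  - exists 1. split; [lra | ]. intros t _. cbn [fst snd]. f_equal; field; lra.
Qed.

(** * Invariance of the sign of the curvature *)

(** Applied after a factor t^4 has been split off, so the four coefficients are those of orders 4 to
    7 of the curve, the orders that enter [kappa_q]. *)
Definition jet3 (f : R -> R) (a0 a1 a2 a3 : R) : Prop :=
  exists h, smooth_germ h /\ forall t, f t = a0 + a1 * t + a2 * t ^ 2 + a3 * t ^ 3 + t ^ 4 * h t.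

Lemma jet3_eq f a0 a1 a2 a3 b0 b1 b2 b3 : jet3 f a0 a1 a2 a3 ->
  a0 = b0 -> a1 = b1 -> a2 = b2 -> a3 = b3 -> jet3 f b0 b1 b2 b3.
Proof. intros; subst; auto. Qed.

Lemma jet3_ext f g a0 a1 a2 a3 : jet3 f a0 a1 a2 a3 -> (forall t, f t = g t) -> jet3 g a0 a1 a2 a3.
Proof.
  intros (h & Hh & E) H. exists h. split; auto. intros t. now rewrite <- H.
Qed.

Lemma jet3_plus f g a0 a1 a2 a3 b0 b1 b2 b3 : jet3 f a0 a1 a2 a3 -> jet3 g b0 b1 b2 b3 ->
  jet3 (fun t => f t + g t) (a0 + b0) (a1 + b1) (a2 + b2) (a3 + b3).
Proof.
  intros (h & Hh & E) (k & Hk & F). exists (fun t => h t + k t). split; [prove_smooth_germ | ].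
  intros t. rewrite E, F. ring.
Qed.

Lemma jet3_mult f g a0 a1 a2 a3 b0 b1 b2 b3 : jet3 f a0 a1 a2 a3 -> jet3 g b0 b1 b2 b3 ->
  jet3 (fun t => f t * g t) (a0 * b0) (a0 * b1 + a1 * b0) (a0 * b2 + a1 * b1 + a2 * b0)
    (a0 * b3 + a1 * b2 + a2 * b1 + a3 * b0).
Proof.
  intros (h & Hh & E) (k & Hk & F).
  exists (fun t => a1 * b3 + a2 * b2 + a3 * b1 + t * (a2 * b3 + a3 * b2) + t ^ 2 * (a3 * b3)
    + h t * (b0 + b1 * t + b2 * t ^ 2 + b3 * t ^ 3) + (a0 + a1 * t + a2 * t ^ 2 + a3 * t ^ 3) * k t
    + t ^ 4 * (h t * k t)).
  split; [prove_smooth_germ | ]. intros t. rewrite E, F. ring.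
Qed.

Lemma jet3_const c : jet3 (fun _ => c) c 0 0 0.
Proof. exists (fun _ => 0). split; [prove_smooth_germ | ]. intros; ring. Qed.

Lemma jet3_id : jet3 (fun t => t) 0 1 0 0.
Proof. exists (fun _ => 0). split; [prove_smooth_germ | ]. intros; ring. Qed.

Lemma jet3_order4 h : smooth_germ h -> jet3 (fun t => t ^ 4 * h t) 0 0 0 0.
Proof. intros Hh. exists h. split; auto. intros; ring. Qed.

Lemma jet3_smooth_germ f a0 a1 a2 a3 : jet3 f a0 a1 a2 a3 -> smooth_germ f.
Proof.
  intros (h & Hh & E).
  apply (smooth_germ_ext (fun t => a0 + a1 * t + a2 * t ^ 2 + a3 * t ^ 3 + t ^ 4 * h t)); [ | prove_smooth_germ].
  apply filter_forall. intros t. now rewrite E.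
Qed.

(** Substituting t rho(t) into t^4 xi(t) and splitting off t^4 leaves rho^4 xi(t rho); the
    coefficients come from multiplying truncated series. *)
Lemma jet3_reparametrize rho xi p1 p2 p3 p4 x4 x5 x6 x7 :
  jet3 rho p1 p2 p3 p4 -> jet3 xi x4 x5 x6 x7 ->
  jet3 (fun t => rho t ^ 4 * xi (t * rho t))
    (p1 ^ 4 * x4)
    (p1 ^ 5 * x5 + 4 * p1 ^ 3 * p2 * x4)
    (p1 ^ 6 * x6 + 5 * p1 ^ 4 * p2 * x5 + (4 * p1 ^ 3 * p3 + 6 * p1 ^ 2 * p2 ^ 2) * x4)
    (p1 ^ 7 * x7 + 6 * p1 ^ 5 * p2 * x6 + (5 * p1 ^ 4 * p3 + 10 * p1 ^ 3 * p2 ^ 2) * x5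
      + (4 * p1 ^ 3 * p4 + 12 * p1 ^ 2 * p2 * p3 + 4 * p1 * p2 ^ 3) * x4).
Proof.
  intros Hr (h & Hh & E).
  assert (Sr := jet3_smooth_germ _ _ _ _ _ Hr).
  assert (Hu := jet3_mult _ _ _ _ _ _ _ _ _ _ jet3_id Hr).
  assert (Hu2 := jet3_mult _ _ _ _ _ _ _ _ _ _ Hu Hu).
  assert (Hu3 := jet3_mult _ _ _ _ _ _ _ _ _ _ Hu Hu2).
  assert (Hr2 := jet3_mult _ _ _ _ _ _ _ _ _ _ Hr Hr).
  assert (Hr4 := jet3_mult _ _ _ _ _ _ _ _ _ _ Hr2 Hr2).
  assert (HR : jet3 (fun t => t ^ 4 * (rho t ^ 4 * h (t * rho t))) 0 0 0 0).
  { apply jet3_order4. apply smooth_germ_mult; [prove_smooth_germ | ].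
    apply (smooth_germ_comp h (fun s => s * rho s)); auto; [ring | prove_smooth_germ]. }
  assert (K := jet3_mult _ _ _ _ _ _ _ _ _ _ Hr4
    (jet3_plus _ _ _ _ _ _ _ _ _ _ (jet3_plus _ _ _ _ _ _ _ _ _ _
      (jet3_plus _ _ _ _ _ _ _ _ _ _ (jet3_plus _ _ _ _ _ _ _ _ _ _ (jet3_const x4)
       (jet3_mult _ _ _ _ _ _ _ _ _ _ (jet3_const x5) Hu))
       (jet3_mult _ _ _ _ _ _ _ _ _ _ (jet3_const x6) Hu2))
       (jet3_mult _ _ _ _ _ _ _ _ _ _ (jet3_const x7) Hu3)) HR)).
  assert (K' := jet3_ext _ (fun t => rho t ^ 4 * xi (t * rho t)) _ _ _ _ K
    ltac:(intros t; cbv beta; rewrite E; ring)).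
  apply (jet3_eq _ _ _ _ _ _ _ _ _ K'); ring.
Qed.

Lemma jet3_taylor f : smooth_germ f ->
  jet3 f (f 0) (Derive_n f 1 0) (Derive_n f 2 0 / 2) (Derive_n f 3 0 / 6).
Proof.
  intros Hf. destruct (smooth_germ_taylor4 f Hf) as (g & Hg & E & _). exists g. split; auto.
Qed.

(** * Action of plane maps on the 7-jet *)

Fixpoint horner (l : list R) (t : R) : R :=
  match l with nil => 0 | a :: l' => a + t * horner l' t end.

Lemma horner_continuous l : continuous (horner l) 0.
Proof.
  apply ex_derive_continuous_R.
  enough (H : forall t, ex_derive (horner l) t) by apply H.
  induction l; intros t; simpl; [apply ex_derive_const | ].
  apply (ex_derive_plus (fun _ => a) (fun t => t * horner l t)); [apply ex_derive_const | ].
  apply ex_derive_mult; [apply ex_derive_id | apply IHl].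
Qed.

(** Letting t tend to 0 kills the constant coefficient; dividing by t then lowers both the length
    and the exponent. The bound is assumed for t <> 0, which is what this division preserves. *)
Lemma horner_small_zero l : (exists K, locally 0 (fun t => t <> 0 -> Rabs (horner l t) <= K * Rabs t ^ length l)) ->
  List.Forall (fun a => a = 0) l.
Proof.
  induction l as [ | a l IH]; intros [K L]; [constructor | ].
  assert (a0 : a = 0).
  { destruct (Req_EM_T a 0) as [ | N]; auto. exfalso.
    assert (P : 0 < Rabs a / 2) by (generalize (Rabs_pos_lt a N); lra).
    assert (Cl := horner_continuous (a :: l)).
    destruct (proj1 (continuous_eps _ _) Cl _ P) as (e & He & H).
    apply locally_0 in L. destruct L as (d & Hd & L).
    (* At this point the polynomial is within |a| / 2 of [a] by continuity, yet smaller than |a| / 2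
       in absolute value by the assumed bound. *)
    set (s := Rmin (Rmin d e) (Rmin 1 (Rabs a / (2 * (Rabs K + 1)))) / 2).
    assert (HK : 0 < Rabs K + 1) by (generalize (Rabs_pos K); lra).
    assert (Hq : 0 < Rabs a / (2 * (Rabs K + 1))) by (apply Rdiv_lt_0_compat; lra).
    assert (Hs : 0 < s).
    { unfold s. apply Rdiv_lt_0_compat; [ | lra]. repeat apply Rmin_pos; lra. }
    assert (s < d /\ s < e /\ s < 1 /\ s < Rabs a / (2 * (Rabs K + 1))) as (s1 & s2 & s3 & s4).
    { unfold s in *. generalize (Rmin_l (Rmin d e) (Rmin 1 (Rabs a / (2 * (Rabs K + 1)))))
        (Rmin_r (Rmin d e) (Rmin 1 (Rabs a / (2 * (Rabs K + 1)))))
        (Rmin_l d e) (Rmin_r d e) (Rmin_l 1 (Rabs a / (2 * (Rabs K + 1)))) (Rmin_r 1 (Rabs a / (2 * (Rabs K + 1)))).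
      intros. repeat split; lra. }
    assert (As : Rabs s = s) by (apply Rabs_right; lra).
    specialize (H s). rewrite Rminus_0_r, As in H. specialize (H s2).
    specialize (L s). rewrite As in L. specialize (L s1 ltac:(lra)).
    assert (H0 : horner (a :: l) 0 = a) by (simpl; ring). rewrite H0 in H.
    assert (B : Rabs (horner (a :: l) s) <= (Rabs K + 1) * s).
    { eapply Rle_trans; [exact L | ]. simpl length. simpl pow.
      assert (0 <= s ^ length l <= 1).
      { split; [apply pow_le; lra | ]. rewrite <- (pow1 (length l)). apply pow_incr; lra. }
      generalize (Rle_abs K) (Rabs_pos K). intros.
      assert (0 <= s * s ^ length l <= s) by nra. nra. }
    assert (B2 : (Rabs K + 1) * s < Rabs a / 2).
    { apply (Rmult_lt_compat_l (Rabs K + 1)) in s4; auto.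
      replace ((Rabs K + 1) * (Rabs a / (2 * (Rabs K + 1)))) with (Rabs a / 2) in s4 by (field; lra). lra. }
    assert (T := Rabs_triang_inv a (horner (a :: l) s)).
    rewrite Rabs_minus_sym in H. lra. }
  constructor; auto. subst a. apply IH. exists K. apply locally_0 in L. destruct L as (d & Hd & L).
    apply locally_0. exists d. split; auto. intros t Ht N. specialize (L t Ht N). simpl in L.
    rewrite Rplus_0_l, Rabs_mult in L. apply (Rmult_le_reg_l (Rabs t)); [now apply Rabs_pos_lt | ]. lra.
Qed.

(* Only the linear part of [f] matters below order 8, since the curve has order 4. *)
Lemma jet_linear_part (U : R * R -> Prop) (f : R * R -> R) (X0 Y0 : R) : open U -> CrR2 2 U f -> U (X0, Y0) ->
  exists L1 L2, forall Qx Qy Z a0 a1 a2 a3 b0 b1 b2 b3,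
    jet3 Qx a0 a1 a2 a3 -> jet3 Qy b0 b1 b2 b3 -> smooth_germ Z ->
    locally 0 (fun t => Z t = f (X0 + t ^ 4 * Qx t, Y0 + t ^ 4 * Qy t)) ->
    Derive_n Z 1 0 = 0 /\ Derive_n Z 2 0 = 0 /\ Derive_n Z 3 0 = 0 /\
    Derive_n Z 4 0 = 24 * (L1 * a0 + L2 * b0) /\ Derive_n Z 5 0 = 120 * (L1 * a1 + L2 * b1) /\
    Derive_n Z 6 0 = 720 * (L1 * a2 + L2 * b2) /\ Derive_n Z 7 0 = 5040 * (L1 * a3 + L2 * b3).
Proof.
  intros HU Hf H0.
  assert (EX : forall n f, CrR2 n U f -> forall x y, U (x, y) -> ex_diff_n (fun x y => f (x, y)) n x y).
  { clear. induction n; intros f Hf x y Hxy.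
    - split; auto. apply continuity_2d_pt_filterlim. change (continuous (fun z : R * R => f (fst z, snd z)) (x, y)).
      apply (continuous_ext f); [now intros [] | now apply Hf].
    - destruct Hf as (F1 & F2 & F3 & F4). split; [ | split; [ | split; [ | split]]].
      + apply continuity_2d_pt_filterlim. change (continuous (fun z : R * R => f (fst z, snd z)) (x, y)).
        apply (continuous_ext f); [now intros [] | now apply F1].
      + apply (F2 (x, y) Hxy).
      + apply (F2 (x, y) Hxy).
      + apply (IHn (d1 f) F3 x y Hxy).
      + apply (IHn (d2 f) F4 x y Hxy). }
  (* The first-order Taylor remainder is quadratic in the displacement, hence O(t^8) along a curve
     of order 4. *)
  destruct (Taylor_Lagrange_2d (fun x y => f (x, y)) 1 X0 Y0) as [D HD].
  { destruct (HU _ H0) as [e He]. exists e. intros u v Hu Hv. apply (EX 2%nat); auto.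
    apply He. now split. }
  exists (d1 f (X0, Y0)), (d2 f (X0, Y0)). set (L1 := d1 f (X0, Y0)). set (L2 := d2 f (X0, Y0)).
  assert (HD' : locally (X0, Y0) (fun p => Rabs (f p - (f (X0, Y0) + L1 * (fst p - X0) + L2 * (snd p - Y0)))
    <= D * Rmax (Rabs (fst p - X0)) (Rabs (snd p - Y0)) ^ 2)).
  { destruct HD as [e He]. exists e. intros [u v] [Hu Hv]. specialize (He u v Hu Hv).
    replace (DL_pol 1 (fun x y => f (x, y)) X0 Y0 (u - X0) (v - Y0)) with
      (f (X0, Y0) + L1 * (u - X0) + L2 * (v - Y0)) in He; [exact He | ].
    unfold DL_pol, differential, partial_derive, Binomial.C. simpl. unfold L1, L2, d1, d2. simpl.
    field. }
  intros Qx Qy Z a0 a1 a2 a3 b0 b1 b2 b3 JX JY HZ EZ.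
  destruct (smooth_germ_taylor4 Z HZ) as (G1 & SG1 & EG1 & DG1).
  destruct (smooth_germ_taylor4 G1 SG1) as (G2 & SG2 & EG2 & _).
  assert (E4 := DG1 0%nat). assert (E5 := DG1 1%nat). assert (E6 := DG1 2%nat). assert (E7 := DG1 3%nat).
  cbn [Nat.add] in E4, E5, E6, E7. simpl INR in E4, E5, E6, E7. change (Derive_n G1 0 0) with (G1 0) in E4.
  rewrite E5, E6, E7, E4 in EG2.
  assert (SX := jet3_smooth_germ _ _ _ _ _ JX). assert (SY := jet3_smooth_germ _ _ _ _ _ JY).
  destruct JX as (hx & Hhx & EX'). destruct JY as (hy & Hhy & EY').
  assert (Cc : continuous (fun t : R => (X0 + t ^ 4 * Qx t, Y0 + t ^ 4 * Qy t)) 0).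
  { apply continuous_pair; cbn [fst snd]; apply smooth_germ_continuous; prove_smooth_germ. }
  assert (HC : locally 0 (fun t : R => Rabs (f (X0 + t ^ 4 * Qx t, Y0 + t ^ 4 * Qy t)
      - (f (X0, Y0) + L1 * (t ^ 4 * Qx t) + L2 * (t ^ 4 * Qy t)))
    <= D * Rmax (Rabs (t ^ 4 * Qx t)) (Rabs (t ^ 4 * Qy t)) ^ 2)).
  { assert (E0 : (X0, Y0) = (X0 + 0 ^ 4 * Qx 0, Y0 + 0 ^ 4 * Qy 0)) by (f_equal; ring).
    rewrite E0 in HD' at 1.
    assert (HC := Cc _ HD'). unfold filtermap in HC. revert HC. apply filter_imp. intros t. cbn [fst snd].
    replace (X0 + t ^ 4 * Qx t - X0) with (t ^ 4 * Qx t) by ring.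
    replace (Y0 + t ^ 4 * Qy t - Y0) with (t ^ 4 * Qy t) by ring. auto. }
  assert (Bd : forall h, smooth_germ h -> exists K, 0 <= K /\ locally 0 (fun t => Rabs (h t) <= K)).
  { intros h Hh. exists (Rabs (h 0) + 1). split; [generalize (Rabs_pos (h 0)); lra | ].
    apply locally_0. destruct (proj1 (continuous_eps _ _) (smooth_germ_continuous _ Hh) 1 Rlt_0_1) as (d & Hd & H).
    exists d. split; auto. intros t Ht. specialize (H t). rewrite Rminus_0_r in H. specialize (H Ht).
    generalize (Rabs_triang_inv (h t) (h 0)). lra. }
  destruct (Bd Qx SX) as (Kx & Kx0 & LKx). destruct (Bd Qy SY) as (Ky & Ky0 & LKy).
  destruct (Bd (fun t => G2 t - L1 * hx t - L2 * hy t)) as (Kh & Kh0 & LKh).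
  { prove_smooth_germ. }
  (* The Taylor coefficients of orders 0 to 7 of [Z] minus the affine part of [f] along the curve.
     That difference is O(t^8), so all eight vanish. *)
  set (l := (Z 0 - f (X0, Y0)) :: Derive_n Z 1 0 :: Derive_n Z 2 0 / 2 :: Derive_n Z 3 0 / 6 ::
    (Derive_n Z 4 0 / 24 - (L1 * a0 + L2 * b0)) :: (Derive_n Z 5 0 / 120 - (L1 * a1 + L2 * b1)) ::
    (Derive_n Z 6 0 / 720 - (L1 * a2 + L2 * b2)) :: (Derive_n Z 7 0 / 5040 - (L1 * a3 + L2 * b3)) :: nil).
  assert (Zl : List.Forall (fun a => a = 0) l).
  { apply horner_small_zero. exists (Rabs D * Rmax Kx Ky ^ 2 + Kh).
    generalize (filter_and _ _ EZ (filter_and _ _ HC (filter_and _ _ LKx (filter_and _ _ LKy LKh)))).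
    apply filter_imp. intros t (T1 & T2 & T3 & T4 & T5) _. rewrite <- T1 in T2.
    assert (Eh : horner l t = (Z t - (f (X0, Y0) + L1 * (t ^ 4 * Qx t) + L2 * (t ^ 4 * Qy t)))
      - t ^ 8 * (G2 t - L1 * hx t - L2 * hy t)).
    { rewrite EG1, EG2, EX', EY'. unfold l. cbn [horner]. field. }
    rewrite Eh. simpl length.
    unfold Rminus at 1. eapply Rle_trans; [apply Rabs_triang | ]. rewrite Rabs_Ropp, Rabs_mult, RPow_abs.
    assert (P8 : Rabs (t ^ 8) = Rabs (t ^ 4) ^ 2).
    { rewrite RPow_abs. f_equal. ring. }
    rewrite P8, Rmult_plus_distr_r.
    assert (T0 := Rabs_pos (t ^ 4)).
    apply Rplus_le_compat.
    - eapply Rle_trans; [exact T2 | ].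
      assert (M : 0 <= Rmax (Rabs (t ^ 4 * Qx t)) (Rabs (t ^ 4 * Qy t)) <= Rmax Kx Ky * Rabs (t ^ 4)).
      { split; [eapply Rle_trans; [apply Rabs_pos | apply Rmax_l] | ].
        generalize (Rmax_l Kx Ky) (Rmax_r Kx Ky). intros.
        apply Rmax_lub; rewrite Rabs_mult, Rmult_comm; apply Rmult_le_compat_r; lra. }
      rewrite Rmult_assoc, <- Rpow_mult_distr.
      eapply Rle_trans; [apply Rmult_le_compat_r; [apply pow2_ge_0 | apply Rle_abs] | ].
      apply Rmult_le_compat_l; [apply Rabs_pos | ]. apply pow_incr; auto.
    - rewrite Rmult_comm. apply Rmult_le_compat_r; auto. apply pow2_ge_0. }
  unfold l in Zl. rewrite !List.Forall_cons_iff in Zl. destruct Zl as (_ & Z1 & Z2 & Z3 & Z4 & Z5 & Z6 & Z7 & _).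
  repeat split; lra.
Qed.

Definition kappa_numerator (g : R -> R * R) : R :=
  -77 * cB g ^ 2 + 105 * cA g * cD g + 60 * cA g * cC g.

Definition smooth_curve_germ (g : R -> R * R) : Prop :=
  smooth_germ (fun t => fst (g t)) /\ smooth_germ (fun t => snd (g t)).

(** In the numerator the contributions of the higher coefficients [p2], [p3], [p4] of the
    reparametrization cancel; this is what the weights -77, 105, 60 achieve. Only [0 <= m] is
    stated, so no Jacobian has to be shown invertible; nonvanishing is recovered later by using the
    equivalence in both directions. *)
Lemma A_equiv_invariants g1 g2 : smooth_curve_germ g1 -> smooth_curve_germ g2 ->
  dgam g1 1 = (0, 0) -> dgam g1 2 = (0, 0) -> dgam g1 3 = (0, 0) -> A_equiv g1 g2 ->
  dgam g2 1 = (0, 0) /\ dgam g2 2 = (0, 0) /\ dgam g2 3 = (0, 0) /\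
  exists k m, 0 <= m /\ cA g2 = k * cA g1 /\ kappa_numerator g2 = m * kappa_numerator g1.
Proof.
  intros [Sx Sy] [SX SY] C1 C2 C3 (psi & phi & Psi & Hphi & (U & V & Phi & OU & OV & Up & _ & _ & _ & _ & CPsi & _) & L).
  rewrite <- locally_0 in L.
  destruct (diffeo1_smooth_germ _ _ Hphi) as [Sphi Z].
  destruct (smooth_germ_hadamard phi Sphi) as (rho & Srho & Ephi & _).
  assert (Jr := jet3_taylor rho Srho).
  revert Jr. generalize (rho 0) (Derive_n rho 1 0) (Derive_n rho 2 0 / 2) (Derive_n rho 3 0 / 6).
  intros p1 p2 p3 p4 Jr.
  destruct (smooth_germ_taylor4 _ Sx) as (xi & Hxi & Ex & Dx).
  destruct (smooth_germ_taylor4 _ Sy) as (eta & Heta & Ey & Dy).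
  assert (X1 := f_equal fst C1). assert (X2 := f_equal fst C2). assert (X3 := f_equal fst C3).
  assert (Y1 := f_equal snd C1). assert (Y2 := f_equal snd C2). assert (Y3 := f_equal snd C3).
  unfold dgam in X1, X2, X3, Y1, Y2, Y3. cbn [fst snd] in X1, X2, X3, Y1, Y2, Y3.
  rewrite X1, X2, X3 in Ex. rewrite Y1, Y2, Y3 in Ey.
  assert (x4 := Dx 0%nat). assert (x5 := Dx 1%nat). assert (x6 := Dx 2%nat). assert (x7 := Dx 3%nat).
  assert (y4 := Dy 0%nat). assert (y5 := Dy 1%nat). assert (y6 := Dy 2%nat). assert (y7 := Dy 3%nat).
  cbn [Nat.add] in x4, x5, x6, x7, y4, y5, y6, y7. simpl INR in x4, x5, x6, x7, y4, y5, y6, y7.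
  change (Derive_n xi 0 0) with (xi 0) in x4. change (Derive_n eta 0 0) with (eta 0) in y4.
  assert (Jx := jet3_reparametrize _ _ _ _ _ _ _ _ _ _ Jr (jet3_taylor xi Hxi)).
  assert (Jy := jet3_reparametrize _ _ _ _ _ _ _ _ _ _ Jr (jet3_taylor eta Heta)).
  rewrite x4, x5, x6, x7 in Jx. rewrite y4, y5, y6, y7 in Jy.
  destruct (CPsi 2%nat) as [Cf1 Cf2].
  assert (Up' : U (fst (g1 0), snd (g1 0))) by (now destruct (g1 0)).
  assert (Along : forall t, g1 (phi t) = (fst (g1 0) + t ^ 4 * (rho t ^ 4 * xi (t * rho t)),
    snd (g1 0) + t ^ 4 * (rho t ^ 4 * eta (t * rho t)))).
  { intros t. assert (Et : phi t = t * rho t) by (rewrite Ephi, Z; ring). rewrite Et.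
    rewrite (surjective_pairing (g1 (t * rho t))).
    rewrite (Ex (t * rho t)), (Ey (t * rho t)). f_equal; field. }
  destruct (jet_linear_part U _ _ _ OU Cf1 Up') as (a & b & Lf).
  destruct (jet_linear_part U _ _ _ OU Cf2 Up') as (c & d & Lg).
  destruct (Lf _ _ (fun t => fst (g2 t)) _ _ _ _ _ _ _ _ Jx Jy SX) as (F1 & F2 & F3 & F4 & F5 & F6 & F7).
  { revert L. apply filter_imp. intros t <-. now rewrite Along. }
  destruct (Lg _ _ (fun t => snd (g2 t)) _ _ _ _ _ _ _ _ Jx Jy SY) as (G1 & G2 & G3 & G4 & G5 & G6 & G7).
  { revert L. apply filter_imp. intros t <-. now rewrite Along. }
  unfold dgam. rewrite F1, F2, F3, G1, G2, G3. repeat (split; [reflexivity | ]).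
  (* The exponents add up orders of derivatives: 5 + 4 = 9 for A, and 2 (6 + 4) = (5 + 4) + (6 + 5)
     = (5 + 4) + (7 + 4) = 20 for the three terms of the numerator. *)
  exists ((a * d - b * c) * p1 ^ 9), ((a * d - b * c) ^ 2 * p1 ^ 20).
  unfold kappa_numerator, cA, cB, cC, cD, det2, dgam. cbn [fst snd].
  rewrite F4, F5, F6, F7, G4, G5, G6, G7.
  generalize (Derive_n (fun t => fst (g1 t)) 4 0) (Derive_n (fun t => fst (g1 t)) 5 0)
    (Derive_n (fun t => fst (g1 t)) 6 0) (Derive_n (fun t => fst (g1 t)) 7 0)
    (Derive_n (fun t => snd (g1 t)) 4 0) (Derive_n (fun t => snd (g1 t)) 5 0)
    (Derive_n (fun t => snd (g1 t)) 6 0) (Derive_n (fun t => snd (g1 t)) 7 0).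
  clear. intros u4 u5 u6 u7 v4 v5 v6 v7. split; [ | split].
  - apply Rmult_le_pos; [apply pow2_ge_0 | ]. replace (p1 ^ 20) with ((p1 ^ 10) ^ 2) by ring. apply pow2_ge_0.
  - field.
  - field.
Qed.

(** * Classification *)

Definition Ec (c t : R) : R * R := (t ^ 4, t ^ 5 + c * t ^ 7).

Lemma E0_Ec : E0 = Ec 0.
Proof. apply functional_extensionality. intros t. unfold E0, Ec. f_equal. ring. Qed.

Lemma Ep_Ec : Ep = Ec 1.
Proof. apply functional_extensionality. intros t. unfold Ep, Ec. f_equal. ring. Qed.

Lemma Em_Ec : Em = Ec (-1).
Proof. apply functional_extensionality. intros t. unfold Em, Ec. f_equal. ring. Qed.

Lemma Ec_smooth c : smooth_curve_germ (Ec c).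
Proof. split; unfold Ec; cbn [fst snd]; prove_smooth_germ. Qed.

Lemma smooth_curve_germ_continuous g : smooth_curve_germ g -> continuous g 0.
Proof. intros [H1 H2]. apply continuous_pair; now apply smooth_germ_continuous. Qed.

Lemma Ec_dgam c : dgam (Ec c) 1 = (0, 0) /\ dgam (Ec c) 2 = (0, 0) /\ dgam (Ec c) 3 = (0, 0) /\
  dgam (Ec c) 4 = (24, 0) /\ dgam (Ec c) 5 = (0, 120) /\ dgam (Ec c) 6 = (0, 0) /\
  dgam (Ec c) 7 = (0, 5040 * c).
Proof.
  assert (TX : tower (fun _ => True) (fun j t => match j with
    | 0 => t ^ 4 | 1 => 4 * t ^ 3 | 2 => 12 * t ^ 2 | 3 => 24 * t | 4 => 24 | _ => 0 end)).
  { intros j t _. do 5 (destruct j as [ | j]; [auto_derive; auto; ring | ]). auto_derive; auto. }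
  assert (TY : tower (fun _ => True) (fun j t => match j with
    | 0 => t ^ 5 + c * t ^ 7 | 1 => 5 * t ^ 4 + 7 * c * t ^ 6 | 2 => 20 * t ^ 3 + 42 * c * t ^ 5
    | 3 => 60 * t ^ 2 + 210 * c * t ^ 4 | 4 => 120 * t + 840 * c * t ^ 3 | 5 => 120 + 2520 * c * t ^ 2
    | 6 => 5040 * c * t | 7 => 5040 * c | _ => 0 end)).
  { intros j t _. do 8 (destruct j as [ | j]; [auto_derive; auto; ring | ]). auto_derive; auto. }
  assert (DX := fun j => tower_Derive_n _ _ open_true TX j 0 I).
  assert (DY := fun j => tower_Derive_n _ _ open_true TY j 0 I).
  cbv beta iota in DX, DY. unfold dgam, Ec. cbn [fst snd].
  rewrite !DX, !DY. repeat split; f_equal; ring.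
Qed.

(** The sixth derivative vanishes, so B = D = 0 and only 60 A C remains: the numerator has the sign
    of [c]. *)
Lemma Ec_kappa_numerator c : cA (Ec c) = -2880 /\ kappa_numerator (Ec c) = 60 * 2880 * 120960 * c.
Proof.
  destruct (Ec_dgam c) as (_ & _ & _ & D4 & D5 & D6 & D7).
  unfold kappa_numerator, cA, cB, cC, cD. rewrite D4, D5, D6, D7. unfold det2. cbn [fst snd].
  split; ring.
Qed.

(** Starting from [Ec c], invariance shows that the first three derivatives of [g] vanish, which
    permits applying it from [g] back to [Ec c]. The return direction gives A <> 0 and, when c <> 0,
    excludes m = 0. *)
Lemma A_equiv_kappa g c : smooth_curve_germ g -> A_equiv g (Ec c) ->
  cusp45_cond g /\ exists s, 0 < s /\ kappa_q g = s * c.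
Proof.
  intros Hg H.
  assert (H' : A_equiv (Ec c) g).
  { apply Cr_equiv_sym; auto. now apply smooth_curve_germ_continuous. }
  destruct (Ec_dgam c) as (Z1 & Z2 & Z3 & _). destruct (Ec_kappa_numerator c) as [A0 N0].
  destruct (A_equiv_invariants (Ec c) g (Ec_smooth c) Hg Z1 Z2 Z3 H')
    as (W1 & W2 & W3 & k & m & Hm & _ & EN).
  destruct (A_equiv_invariants g (Ec c) Hg (Ec_smooth c) W1 W2 W3 H)
    as (_ & _ & _ & k' & m' & Hm' & EA' & EN').
  assert (NA : cA g <> 0) by (intros K; rewrite A0, K in EA'; lra).
  split; [repeat split; auto | ].
  assert (Pn : 0 < norm2 (dgam g 4)).
  { unfold norm2. apply sqrt_lt_R0. destruct (Req_EM_T (fst (dgam g 4)) 0) as [K1 | K1].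
    - destruct (Req_EM_T (snd (dgam g 4)) 0) as [K2 | K2].
      + exfalso. apply NA. unfold cA, det2. rewrite K1, K2. ring.
      + generalize (pow2_ge_0 (fst (dgam g 4))). assert (0 < snd (dgam g 4) ^ 2) by (apply pow2_gt_0; auto). lra.
    - generalize (pow2_ge_0 (snd (dgam g 4))). assert (0 < fst (dgam g 4) ^ 2) by (apply pow2_gt_0; auto). lra. }
  assert (P5 : 0 < norm2 (dgam g 4) ^ 5) by now apply pow_lt.
  change (kappa_q g) with (kappa_numerator g / norm2 (dgam g 4) ^ 5).
  destruct (Req_EM_T c 0) as [-> | Nc].
  (* For c = 0 both sides vanish and any positive factor would do; [m] itself might be 0 here. *)
  - exists 1. split; [lra | ]. rewrite EN, N0. field. lra.
  - exists (m * (60 * 2880 * 120960) / norm2 (dgam g 4) ^ 5). split.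
    + apply Rdiv_lt_0_compat; auto.
      destruct Hm as [Hm | Hm]; [nra | ]. exfalso. rewrite <- Hm, Rmult_0_l in EN.
      rewrite EN, Rmult_0_r, N0 in EN'. apply Nc. lra.
    + rewrite EN, N0. field. lra.
Qed.

Lemma cusp45_kappa a b g : a < 0 < b -> smooth_curve_on a b g -> cusp45_cond g ->
  exists c s, 0 < s /\ kappa_q g = s * c /\ A_equiv g (Ec c).
Proof.
  intros Hab Hg HC. destruct (cusp45_normal_form a b g Hab Hg HC) as [c Hc].
  destruct (A_equiv_kappa g c) as (_ & s & Hs & E); auto.
  { now apply (curve_smooth_germ a b). }
  exists c, s. auto.
Qed.

Lemma scale_to_sign g c e : A_equiv g (Ec c) -> e = 1 \/ e = -1 -> 0 < c * e -> A_equiv g (Ec e).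
Proof.
  intros H He Hc.
  assert (P : 0 < Rabs c) by (apply Rabs_pos_lt; intros ->; lra).
  apply (Cr_equiv_trans Inf _ _ _ H).
  (* Scaling by the square root of |c| turns [c] into its sign, which is [e] by the assumption on
     the product. *)
  replace e with (c / sqrt (Rabs c) ^ 2).
  - apply scale_normal_form. now apply sqrt_lt_R0.
  - rewrite pow2_sqrt by lra. destruct He; subst e.
    + rewrite Rabs_right by lra. field. lra.
    + rewrite Rabs_left by lra. field. lra.
Qed.

(** The curvature of [Ec c] is a positive multiple of [e] by the supposed equivalence and of [c] by
    reflexivity, so the two would have the same sign. *)
Lemma Ec_not_A_equiv c e : c * e <= 0 -> c <> e -> ~ A_equiv (Ec c) (Ec e).
Proof.
  intros Hce N H.
  assert (Rf : A_equiv (Ec c) (Ec c)).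
  { apply (Cr_equiv_source Inf _ _ _ _ (diffeo1_id Inf)). now apply filter_forall. }
  destruct (A_equiv_kappa _ _ (Ec_smooth c) H) as (_ & s & Hs & E).
  destruct (A_equiv_kappa _ _ (Ec_smooth c) Rf) as (_ & u & Hu & F).
  rewrite E in F. destruct (Req_EM_T c 0) as [-> | Nc].
  - apply N. rewrite Rmult_0_r in F. destruct (Rmult_integral _ _ F); lra.
  - assert (0 < c ^ 2) by now apply pow2_gt_0.
    assert (s * (c * e) = u * c ^ 2) by (replace (s * (c * e)) with (c * (s * e)) by ring; rewrite F; ring).
    assert (0 < u * c ^ 2) by nra. nra.
Qed.

(* The case distinction is needed because [Rpower 0 (2 / 5)] is the junk value [1]. *)
Definition pow25 (y : R) : R := if Req_EM_T y 0 then 0 else Rpower (Rabs y) (2 / 5).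

Lemma pow25_nonneg y : 0 <= pow25 y.
Proof. unfold pow25. destruct (Req_EM_T y 0); [lra | apply Rlt_le, exp_pos]. Qed.

Lemma pow25_pow5 t : pow25 (t ^ 5) = t ^ 2.
Proof.
  unfold pow25. destruct (Req_EM_T (t ^ 5) 0) as [E | N].
  - assert (t = 0) as -> by (destruct (Req_EM_T t 0); auto; exfalso; now apply (pow_nonzero t 5)). ring.
  - assert (Ht : 0 < Rabs t) by (apply Rabs_pos_lt; intros ->; apply N; ring).
    rewrite <- RPow_abs, <- (Rpower_pow 5), Rpower_mult by auto.
    replace (INR 5 * (2 / 5)) with (INR 2) by (simpl; field).
    rewrite Rpower_pow by auto. apply pow2_abs.
Qed.

Lemma pow25_derive y : y <> 0 -> is_derive (fun y => y * pow25 y) y (7 / 5 * pow25 y).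
Proof.
  intros N.
  assert (L : locally y (fun z => z <> 0)) by now apply open_neq0.
  unfold pow25 at 2. destruct (Req_EM_T y 0) as [ | _]; [contradiction | ].
  destruct (Rlt_dec 0 y) as [P | P].
  - apply (is_derive_ext_loc (fun z => z * exp (2 / 5 * ln z))).
    + generalize (open_gt 0 y P). apply filter_imp. intros z Hz. unfold pow25.
      destruct (Req_EM_T z 0); [lra | ]. unfold Rpower. rewrite Rabs_right by lra. reflexivity.
    + unfold Rpower. rewrite Rabs_right by lra. auto_derive; auto. field. lra.
  - assert (P' : y < 0) by lra. apply (is_derive_ext_loc (fun z => z * exp (2 / 5 * ln (- z)))).
    + generalize (open_lt 0 y P'). apply filter_imp. intros z Hz. unfold pow25.
      destruct (Req_EM_T z 0); [lra | ]. unfold Rpower. rewrite Rabs_left by lra. reflexivity.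
    + unfold Rpower. rewrite Rabs_left by lra. auto_derive; [lra | ]. field. lra.
Qed.

Lemma pow25_continuous y : continuous pow25 y.
Proof.
  destruct (Req_EM_T y 0) as [-> | N].
  - apply continuous_eps. intros eps He. exists (Rpower eps (5 / 2)). split; [apply exp_pos | ].
    intros y Hy. rewrite Rminus_0_r in Hy.
    assert (Z : pow25 0 = 0) by (unfold pow25; destruct (Req_EM_T 0 0); lra).
    rewrite Z, Rminus_0_r, Rabs_right by apply Rle_ge, pow25_nonneg.
    unfold pow25. destruct (Req_EM_T y 0) as [ | N]; auto.
    replace eps with (Rpower (Rpower eps (5 / 2)) (2 / 5)).
    + apply Rlt_Rpower_l; [lra | ]. split; auto. now apply Rabs_pos_lt.
    + rewrite Rpower_mult. replace (5 / 2 * (2 / 5)) with 1 by field. now apply Rpower_1.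
  (* Away from 0, continuity is inherited from the differentiable product by dividing by z. *)
  - apply (continuous_ext_loc _ (fun z => z * pow25 z * / z)).
    + generalize (open_neq0 y N). apply filter_imp. intros z Hz. change (z * pow25 z * / z = pow25 z). field. auto.
    + apply (continuous_mult (fun z => z * pow25 z) Rinv).
      * apply ex_derive_continuous_R. eexists. now apply pow25_derive.
      * now apply (CrR_continuous 0 _ _ (CrR_inv 0)).
Qed.

(** At 0 the difference quotient of y [pow25] y is [pow25] itself, which tends to 0 and so agrees
    with the formula valid elsewhere. *)
Lemma pow25_derive_all y : is_derive (fun y => y * pow25 y) y (7 / 5 * pow25 y).
Proof.
  destruct (Req_EM_T y 0) as [-> | N]; [ | now apply pow25_derive].
  assert (Z : pow25 0 = 0) by (unfold pow25; destruct (Req_EM_T 0 0); lra).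
  rewrite Z, Rmult_0_r. rewrite <- Z at 2.
  apply (is_derive_slope (fun y => y * pow25 y)); [apply pow25_continuous | ].
  apply filter_forall. intros s. ring.
Qed.

(* [t ^ 7 = y * |y| ^ (2/5)] along [y = t ^ 5], and [y |-> y * |y| ^ (2/5)] is of class [C^1]. *)
Lemma E0_C1_equiv c : Cr_equiv (Fin 1) (Ec 0) (Ec c).
Proof.
  set (h := fun y => y + c * (y * pow25 y)).
  assert (D : forall y, is_derive h y (1 + c * (7 / 5 * pow25 y))).
  { intros y. apply (is_derive_plus (fun y => y) (fun y => c * (y * pow25 y))).
    - apply (is_derive_id (K := R_AbsRing)).
    - apply (is_derive_scal (fun y => y * pow25 y)). apply pow25_derive_all. }
  assert (Sh : CrR 1 (fun _ => True) h).
  { split; [ | split].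
    - intros y _. apply ex_derive_continuous_R. eexists. apply D.
    - intros y _. eexists. apply D.
    - intros y _. apply (continuous_ext (fun y => 1 + c * (7 / 5 * pow25 y))).
      + intros z. symmetry. apply is_derive_unique, D.
      + apply (continuous_plus (fun _ => 1) (fun y => c * (7 / 5 * pow25 y))); [apply continuous_const | ].
        apply (continuous_mult (fun _ => c) (fun y => 7 / 5 * pow25 y)); [apply continuous_const | ].
        apply (continuous_mult (fun _ => 7 / 5) pow25); [apply continuous_const | apply pow25_continuous]. }
  assert (SF : CrR2 1 (fun _ => True) (fun p => h (snd p))).
  { apply (CrR2_lift_snd 1 (fun _ => True) h); [apply open_true | exact Sh]. }
  apply (Cr_equiv_target (Fin 1) _ _ (fun p => (fst p, h (snd p)))).
  - replace (Ec 0 0) with (0, 0) by (unfold Ec; f_equal; ring).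
    apply (fibered_diffeo (Fin 1) (fun _ => True)); auto.
    + discriminate.
    + apply open_true.
    + intros n ->. exact SF.
    + unfold d2. cbn [fst snd].
      replace (Derive _ _) with (1 + c * (7 / 5 * pow25 0)) by (symmetry; apply (is_derive_unique h), D).
      unfold pow25. destruct (Req_EM_T 0 0); lra.
  - apply filter_forall. intros t. unfold Ec. cbn [fst snd]. f_equal.
    replace (t ^ 5 + 0 * t ^ 7) with (t ^ 5) by ring. unfold h. rewrite pow25_pow5. ring.
Qed.

Lemma Ec_C1_equiv c e : Cr_equiv (Fin 1) (Ec c) (Ec e).
Proof.
  apply (Cr_equiv_trans (Fin 1) _ (Ec 0)); [ | apply E0_C1_equiv].
  apply Cr_equiv_sym; [apply smooth_curve_germ_continuous, Ec_smooth | apply E0_C1_equiv].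
Qed.

Theorem mainTheorem16 :
  (forall (a b : R) (g : R -> R * R),
      a < 0 < b -> smooth_curve_on a b g ->
      (A_equiv g E0 <-> cusp45_cond g /\ kappa_q g = 0) /\
      (A_equiv g Ep <-> cusp45_cond g /\ kappa_q g > 0) /\
      (A_equiv g Em <-> cusp45_cond g /\ kappa_q g < 0)) /\
  (~ A_equiv E0 Ep /\ ~ A_equiv Ep E0 /\
   ~ A_equiv E0 Em /\ ~ A_equiv Em E0 /\
   ~ A_equiv Ep Em /\ ~ A_equiv Em Ep) /\
  (Cr_equiv (Fin 1) E0 Ep /\ Cr_equiv (Fin 1) Ep E0 /\
   Cr_equiv (Fin 1) E0 Em /\ Cr_equiv (Fin 1) Em E0 /\
   Cr_equiv (Fin 1) Ep Em /\ Cr_equiv (Fin 1) Em Ep).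
Proof.
  rewrite E0_Ec, Ep_Ec, Em_Ec. split; [ | split].
  - intros a b g Hab Hg. assert (Sg := curve_smooth_germ a b g Hab Hg).
    split; [ | split]; (split;
      [intros H; destruct (A_equiv_kappa g _ Sg H) as (HC & s & Hs & E); split; [exact HC | lra] | ]);
      intros [HC Hk]; destruct (cusp45_kappa a b g Hab Hg HC) as (c & s & Hs & E & H); rewrite E in Hk.
    + destruct (Rmult_integral _ _ Hk); [lra | now subst c].
    + apply (scale_to_sign g c); auto. nra.
    + apply (scale_to_sign g c); auto. nra.
  - repeat split; apply Ec_not_A_equiv; lra.
  - repeat split; apply Ec_C1_equiv.
Qed.
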